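(* Let $d\in\mathbb{N}$, $L\in\{2,3,\ldots\}$, and let $\mathcal{J}:[0,\infty)\times E\to[0,\infty)$ be a proper family of kernels on the hierarchical lattice $\mathbb{H}^d_L$, with critical value $\lambda_c=\lambda_c(\mathcal{J})$. \begin{enumerate} \item If $\mathcal{J}\gg n^{-2d}\log\log n$ and $\lambda_c<\infty$, then $\mathbb{P}_{\mathcal{J}(\lambda_c)}(|K_0|=\infty)=0$. \item If $\mathcal{J}\ll n^{-2d}\log\log n$, then $\lambda_c=\infty$. \item If $\mathcal{J}\approx n^{-2d}\log\log n$ and $\lambda_c<\infty$, then $\mathbb{P}_{\mathcal{J}(\lambda_c)}(|K_0|=\infty)>0$. \end{enumerate}
   Context: The hierarchical lattice $\mathbb{H}^d_L$ is the abelian group $\bigoplus_{i=1}^\infty(\mathbb{Z}/L\mathbb{Z})^d$ with the ultrametric $\|x-y\|=L^{\max\{i:x_i\neq y_i\}}$ for $x\neq y$. For $n\ge 0$, the ball of radius $L^n$ around $x$ is the $n$-block $\Lambda_n(x)$, and $\Lambda_n=\Lambda_n(0)$. The edge set is $E=\{\{x,y\}:x\neq y\}$, and $|e|=\|x-y\|$ for $e=\{x,y\}$. For a kernel $J:E\to[0,\infty)$, $\mathbb{P}_J$ is the law of the random graph on $\mathbb{H}^d_L$ in which each edge $e$ is open independently with probability $1-\exp(-J(e))$; $K_0$ is the open cluster of the origin. We write $J(x,y)=\mathbb{1}(x\neq y)J(\{x,y\})$. A kernel is isometry-invariant if $J(e)=J(f)$ whenever $|e|=|f|$; integrable if $\sum_{e\ni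 0}J(e)<\infty$; regular if there is $C<\infty$ such that $\sum_{x\notin\Lambda_n}J(0,x)\le C\sum_{x\in\Lambda_{n+1}\setminus\Lambda_n}J(0,x)$ for all sufficiently large $n$. For a family $\mathcal{J}:[0,\infty)\times E\to[0,\infty)$ write $\mathbb{P}_{\mathcal{J}(\lambda)}$ for $\mathbb{P}_{\mathcal{J}(\lambda,\cdot)}$. The family is monotone if $\mathcal{J}(\lambda,e)$ is non-decreasing in $\lambda$ for each $e$; continuous if for each $\lambda^\star>0$ the functions $\lambda\mapsto\sup_e \mathcal{J}(\lambda,e)/\mathcal{J}(\lambda^\star,e)$ and $\lambda\mapsto\sup_e\mathcal{J}(\lambda^\star,e)/\mathcal{J}(\lambda,e)$ are finite-valued and continuous on $(0,\infty)$; non-percolative at $0$ if $\sum_{e\ni 0}\mathcal{J}(\lambda,e)<1$ for all sufficiently small $\lambda\ge0$. It is proper if it is monotone, continuous, non-percolative at $0$, and $\mathcal{J}(\lambda,\cdot)$ is isometry-invariant, integrable and regular for every $\lambda>0$. $\lambda_c(\mathcal{J})=\inf\{\lambda\ge0:\mathbb{P}_{\mathcal{J}(\lambda)}(|K_0|=\infty)>0\}$. For $f:\mathbb{N}\to[0,\infty)$: $\mathcal{J}\approx f$ means $0<\liminf_{|e|\to\infty}\mathcal{J}(\lambda,e)/f(|e|)\le\limsup_{|e|\to\infty}\mathcal{J}(\lambda,e)/f(|e|)<\infty$ for every $\lambda>0$; $\mathcal{J}\ll f$ means $\limsup_{|e|\to\infty}\mathcal{J}(\lambda,e)/f(|e|)=0$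 for every $\lambda>0$; $\mathcal{J}\gg f$ means $\liminf_{|e|\to\infty}\mathcal{J}(\lambda,e)/f(|e|)=\infty$ for every $\lambda>0$. *)

(* Defs.v *)
From HB Require Import structures.
From mathcomp Require Import all_boot all_order all_algebra.
From mathcomp Require Import all_classical all_reals all_analysis.
Unset Printing Implicit Defensive.
Import Order.TTheory GRing.Theory Num.Theory numFieldNormedType.Exports.
Local Open Scope classical_set_scope.
Local Open Scope ring_scope.

(* A point is a sequence x = (x_1, x_2, ...) of elements of (Z/LZ)^d.  *)
(* We encode it as x : nat -> 'I_d -> nat, where x i j is the j-th     *)
(* coordinate of x_{i+1} (0-based block index i), with 0 <= x i j < L  *)
(* and x i = 0 for all but finitely many i.                            *)
Definition pt (d : nat) := nat -> 'I_d -> nat.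

Definition HL (d L : nat) : set (pt d) :=
  [set x | (forall i j, (x i j < L)%N) /\
           exists N, forall i j, (N <= i)%N -> x i j = 0%N].

Definition pt0 (d : nat) : pt d := fun _ _ => 0%N.

(* y lies in the n-block of x (ball of radius L^n around x):            *)
(* x_i = y_i for all (1-based) i > n.                                   *)
Definition inblock (d : nat) (n : nat) (x y : pt d) : Prop :=
  forall i, (n <= i)%N -> x i = y i.

Definition Lam (d : nat) (n : nat) : set (pt d) :=
  [set y | inblock d n (pt0 d) y].

(* dexp x y = the least n with y in Lambda_n(x); for x <> y in H^d_L,   *)
(* ||x - y|| = L ^ (dexp x y) (= L^{max{i : x_i <> y_i}}, 1-based i).   *)
Definition dexp (d : nat) (x y : pt d) : nat :=
  xget 0%N [set n | inblock d n x y /\ forall m, inblock d m x y -> (n <= m)%N].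

Definition hnorm (d L : nat) (x y : pt d) : nat := (L ^ dexp d x y)%N.

(* A kernel J : E -> [0,oo) is encoded as a symmetric function          *)
(* J : pt d -> pt d -> R whose values on pairs x <> y of H^d_L are the  *)
(* values on the edge {x,y}; other values are irrelevant.               *)
(* A family is JJ : R -> pt d -> pt d -> R (only lambda >= 0 matters).  *)
Section Kernels.
Variable R : realType.
Variables d L : nat.

Definition is_edge (x y : pt d) := HL d L x /\ HL d L y /\ x <> y.

Definition sum0 (J : pt d -> pt d -> R) (S : set (pt d)) : \bar R :=
  \esum_(x in [set x | HL d L x /\ x <> pt0 d /\ S x]) (J (pt0 d) x)%:E.

Definition kernel_nonneg (J : pt d -> pt d -> R) :=
  forall x y, is_edge x y -> 0 <= J x y.

Definition kernel_sym (J : pt d -> pt d -> R) :=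
  forall x y, is_edge x y -> J x y = J y x.

Definition isometry_invariant (J : pt d -> pt d -> R) :=
  forall x y u v, is_edge x y -> is_edge u v ->
    hnorm d L x y = hnorm d L u v -> J x y = J u v.

Definition integrable (J : pt d -> pt d -> R) :=
  (sum0 J setT < +oo)%E.

Definition regular (J : pt d -> pt d -> R) :=
  exists C : R, exists N : nat, forall n, (N <= n)%N ->
    (sum0 J (~` Lam d n) <= C%:E * sum0 J (Lam d n.+1 `\` Lam d n))%E.

Definition kratio (a b : R) : \bar R :=
  if b == 0 then (if a == 0 then 0%E else +oo%E) else (a / b)%:E.

Definition sup_ratio (JJ : R -> pt d -> pt d -> R) (l ls : R) : \bar R :=
  ereal_sup [set kratio (JJ l p.1 p.2) (JJ ls p.1 p.2) | p in
              [set p : pt d * pt d | is_edge p.1 p.2]].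

Definition monotone_family (JJ : R -> pt d -> pt d -> R) :=
  forall l l' x y, 0 <= l -> l <= l' -> is_edge x y -> JJ l x y <= JJ l' x y.

Definition continuous_family (JJ : R -> pt d -> pt d -> R) :=
  forall ls : R, 0 < ls ->
    (forall l : R, 0 < l -> sup_ratio JJ l ls \is a fin_num /\
                        sup_ratio JJ ls l \is a fin_num) /\
    (forall l : R, 0 < l ->
       {for l, continuous (fun l' : R => fine (sup_ratio JJ l' ls))} /\
       {for l, continuous (fun l' : R => fine (sup_ratio JJ ls l'))}).

Definition nonpercolative_at0 (JJ : R -> pt d -> pt d -> R) :=
  exists2 delta : R, 0 < delta &
    forall l, 0 <= l -> l < delta -> (sum0 (JJ l) setT < 1)%E.

Definition proper_family (JJ : R -> pt d -> pt d -> R) :=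
  [/\ (forall l, 0 <= l -> kernel_nonneg (JJ l) /\ kernel_sym (JJ l)),
      monotone_family JJ, continuous_family JJ, nonpercolative_at0 JJ &
      forall l, 0 < l ->
        [/\ isometry_invariant (JJ l), integrable (JJ l) & regular (JJ l)]].

Definition fcrit (n : R) : R := n ^- (2 * d) * ln (ln n).

Definition ratio_at (JJ : R -> pt d -> pt d -> R) l x y : R :=
  JJ l x y / fcrit (hnorm d L x y)%:R.

Definition fam_gg (JJ : R -> pt d -> pt d -> R) :=
  forall l, 0 < l -> forall M : R, exists N : nat, forall x y,
    is_edge x y -> (N <= hnorm d L x y)%N -> M <= ratio_at JJ l x y.

Definition fam_ll (JJ : R -> pt d -> pt d -> R) :=
  forall l, 0 < l -> forall eps : R, 0 < eps -> exists N : nat, forall x y,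
    is_edge x y -> (N <= hnorm d L x y)%N -> ratio_at JJ l x y <= eps.

Definition fam_approx (JJ : R -> pt d -> pt d -> R) :=
  forall l, 0 < l -> exists c C : R, 0 < c /\ exists N : nat, forall x y,
    is_edge x y -> (N <= hnorm d L x y)%N ->
    c <= ratio_at JJ l x y <= C.

(* Percolation.  All the measures P_{JJ(lambda)} are realised on one    *)
(* probability space (Omega, P) carrying i.i.d. Uniform[0,1] variables  *)
(* U_e indexed by the edges; the edge e is open in P_{JJ(lambda)} iff   *)
(* U_e <= 1 - exp(-JJ(lambda,e)).  Thus, for each lambda, the edges are *)
(* independently open with probability 1 - exp(-JJ(lambda,e)).          *)
Definition iid_uniform_edges {dT : measure_display} {Omega : measurableType dT}
    (P : probability Omega R) (U : pt d -> pt d -> Omega -> R) :=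
  [/\ (forall x y w, is_edge x y -> U x y w = U y x w),
      (forall x y (t : R), is_edge x y -> measurable [set w | U x y w <= t]) &
      (forall (n : nat) (x y : 'I_n -> pt d) (t : 'I_n -> R),
         (forall k, is_edge (x k) (y k) /\ 0 <= t k <= 1) ->
         (forall k k', k <> k' ->
            ~ (x k = x k' /\ y k = y k') /\ ~ (x k = y k' /\ y k = x k')) ->
         P (\bigcap_(k in [set: 'I_n]) [set w | U (x k) (y k) w <= t k])
           = (\prod_(k < n) t k)%:E)].

Definition open_edge {Omega : Type} (U : pt d -> pt d -> Omega -> R)
    (J : pt d -> pt d -> R) (w : Omega) (x y : pt d) : Prop :=
  U x y w <= 1 - expR (- J x y).

Definition cluster0 {Omega : Type} (U : pt d -> pt d -> Omega -> R)
    (J : pt d -> pt d -> R) (w : Omega) : set (pt d) :=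
  [set y | exists (m : nat) (z : nat -> pt d),
     [/\ z 0%N = pt0 d, z m = y &
         forall k, (k < m)%N -> is_edge (z k) (z k.+1) /\
                               open_edge U J w (z k) (z k.+1)]].

Definition theta {dT : measure_display} {Omega : measurableType dT}
    (P : probability Omega R) (U : pt d -> pt d -> Omega -> R)
    (J : pt d -> pt d -> R) : \bar R :=
  P [set w | ~ finite_set (cluster0 U J w)].

Definition lambda_c {dT : measure_display} {Omega : measurableType dT}
    (P : probability Omega R) (U : pt d -> pt d -> Omega -> R)
    (JJ : R -> pt d -> pt d -> R) : \bar R :=
  ereal_inf [set l%:E | l in [set l : R | 0 <= l /\ (0 < theta P U (JJ l))%E]].

End Kernels.

(* Main.v *)
(** Write [B = L ^ d], and let [J k] be the value of the kernel on the edges of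
    length [L ^ k].

    Discontinuity.  Given the configuration in [Lam n], a cluster of [Lam n]
    with [s] points is isolated with probability at least
    [exp (- s * tail_mass n)].  By a second moment estimate the cluster of the
    origin in [Lam n] typically has at most about [theta * B ^ n] points, and
    [tail_mass n] is of order [ln n / B ^ n] when [B ^ (2 n) * J n <= C * ln n].
    Hence, if [theta * C] is small, the isolation events at the levels
    [n = k ^ 2] have probabilities that are not summable, which forces
    [theta = 0]: a positive [theta] is bounded away from [0].  For a family of
    order [n ^ (-2d) * log (log n)] this bound is uniform to the right of
    [lambda_c], and it passes to the limit because escaping from [Lam m] is
    approximated uniformly by finite-volume events.

    Continuity.  When [B ^ (2 n) * J n / ln n] diverges and [theta > 0] at
    [lambda_c], some block contains, with probability close to [1], a cluster
    of positive density.  This is a finite-volume event, so it persists at some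
    [lambda < lambda_c].  There it starts a renormalisation: the giant clusters
    of the [B] blocks of size [n] in a block of size [n + 1] are all joined but
    for an error of order [n ^ (-2)].  So [theta > 0] below [lambda_c], which is
    absurd.

    The events of finite volume live on the finite group of matrices
    ['M['I_L]_(M, d)], a copy of [Lam M]; a configuration is a finite set of
    edges, and an edge a set of two vertices. *)

Require Import Defs.
From mathcomp Require Import all_boot all_order all_algebra.
From mathcomp Require Import reals sequences exp.
From mathcomp Require Import ring lra zify.
Import Order.TTheory GRing.Theory Num.Theory.
Set Implicit Arguments.
Unset Strict Implicit.
Unset Printing Implicit Defensive.
Local Open Scope ring_scope.

(** * Product measures on finite sets of edges *)

(** Ultrametricity reduces everything to cardinalities: a point outside [Lam n] is equally far from
    all points of [Lam n], so cutting off a cluster costs an exponent that depends on its size only,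
    and separating two sets in distinct sub-blocks one that depends on the product of their sizes.
    For sets of positive density that product is of order [B ^ (2 n)]; a failure is then
    polynomially small in [n] exactly when [B ^ (2 n) * J n] is of order [ln n], and summability
    over the levels decides. Both directions use the same inequality: [f n' - f n] is at least
    [expR (- A)] times the probability of leaving [Lam n'] with a cluster of at most
    [A / tail_mass n] points. Where clusters are known to be small it gives a contradiction; where
    [f] has almost converged it shows that clusters are large. Large is still far from giant, and
    nothing provides a unique large cluster. Merging is obtained by a union bound over families of
    large clusters: the number of families and the cost of a cut both have exponents of order
    [J n * B ^ (2 n)], and a large [A] makes the first constant the smaller one. *)

Lemma ler_sum_sub (R : realFieldType) (I : finType) (P Q : pred I) (F : I -> R) :
  (forall i, P i -> Q i) -> (forall i, Q i -> 0 <= F i) ->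
  \sum_(i | P i) F i <= \sum_(i | Q i) F i.
Proof.
move=> PQ F0; rewrite big_mkcond [leRHS]big_mkcond; apply: ler_sum => i _.
case: ifP => [/PQ->//|_]; by case: ifP => // /F0.
Qed.

(** [s] and [t] are the sides of a nearly balanced split of two masses of at least [mu]. If the
    majorities lie on opposite sides, both are at least [mu / 2]; if [t] has both, the lower bound
    on [s0 + s1] leaves [mu / 4] to one of [s0] and [s1]; if [s] has both, they are ties. *)
Lemma balanced_product (R : realFieldType) (mu s0 s1 t0 t1 : R) : 0 < mu ->
    0 <= s0 -> 0 <= s1 -> 0 <= t0 -> 0 <= t1 ->
    mu <= s0 + t0 -> mu <= s1 + t1 ->
    s0 + s1 <= (s0 + t0 + (s1 + t1)) / 2 ->
    (s0 + t0 + (s1 + t1)) / 2 - mu / 2 <= s0 + s1 ->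
  mu ^+ 2 / 8 <= s0 * t1 \/ mu ^+ 2 / 8 <= t0 * s1.
Proof.
move=> mu0 s0_ge0 s1_ge0 t0_ge0 t1_ge0 hm0 hm1 hle hge.
have prod (x y : R) : mu / 4 <= x -> mu / 2 <= y -> mu ^+ 2 / 8 <= x * y.
  move=> hx hy; have -> : mu ^+ 2 / 8 = mu / 4 * (mu / 2) by field.
  by apply: ler_pM => //; lra.
case: (lerP t0 s0) => st0; case: (lerP t1 s1) => st1.
- by right; apply: prod; lra.
- by left; apply: prod; lra.
- by right; apply: prod; lra.
case: (lerP (mu / 4) s0) => ?; [left|right; rewrite [leRHS]mulrC]; apply: prod; lra.
Qed.

Lemma card_bigcup_le (I T : finType) (P : pred I) (F : I -> {set T}) :
  (#|\bigcup_(i | P i) F i| <= \sum_(i | P i) #|F i|)%N.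
Proof.
elim/big_rec2: _ => [|i n S _ IH]; first by rewrite cards0.
by apply: leq_trans (leq_card_setU _ _) _; rewrite leq_add2l.
Qed.

Section ProductMeasure.
Variables (R : realFieldType) (E : finType) (p : E -> R).
Implicit Types (c D T : {set E}) (f g : {set E} -> R) (Q : pred {set E}).

Definition wt c : R := \prod_e (if e \in c then p e else 1 - p e).
Definition Ex f : R := \sum_c wt c * f c.
Definition Pr Q : R := Ex (fun c => (Q c)%:R).

Definition mix D c c' : {set E} := (c :&: D) :|: (c' :\: D).

(** Measurability with respect to the edges of [D]. The codomain is arbitrary, since clusters and
    random sets of edges must be measurable too. *)
Definition supported (X : Type) D (f : {set E} -> X) :=
  forall c c', c :&: D = c' :&: D -> f c = f c'.

Lemma sum_wt : \sum_c wt c = 1.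
Proof.
rewrite /wt.
have := bigA_distr 1 +%R p (fun e => 1 - p e) => /= <-.
by rewrite big1 // => e _; rewrite addrC subrK.
Qed.

Lemma Ex_cst a : Ex (fun=> a) = a.
Proof. by rewrite /Ex -mulr_suml sum_wt mul1r. Qed.

Lemma eq_Ex f g : f =1 g -> Ex f = Ex g.
Proof. by move=> fg; apply: eq_bigr => c _; rewrite fg. Qed.

Lemma eq_Pr Q Q' : Q =1 Q' -> Pr Q = Pr Q'.
Proof. by move=> fg; apply: eq_Ex => c; rewrite fg. Qed.

Lemma ExD f g : Ex (fun c => f c + g c) = Ex f + Ex g.
Proof. by rewrite /Ex -big_split; apply: eq_bigr => c _; rewrite mulrDr. Qed.

Lemma ExZ a f : Ex (fun c => a * f c) = a * Ex f.
Proof. by rewrite /Ex mulr_sumr; apply: eq_bigr => c _; rewrite mulrCA. Qed.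

Lemma ExZr a f : Ex (fun c => f c * a) = Ex f * a.
Proof. by rewrite mulrC -ExZ; apply: eq_Ex => c; rewrite mulrC. Qed.

Lemma ExB f g : Ex (fun c => f c - g c) = Ex f - Ex g.
Proof.
rewrite -mulN1r -ExZ -ExD; apply: eq_Ex => c; by rewrite mulN1r.
Qed.

Lemma Ex_sum (I : Type) (r : seq I) (P : pred I) (F : I -> {set E} -> R) :
  Ex (fun c => \sum_(i <- r | P i) F i c) = \sum_(i <- r | P i) Ex (F i).
Proof.
rewrite /Ex; under eq_bigr do rewrite mulr_sumr.
by rewrite exchange_big.
Qed.

Lemma mix_in D c c' e :
  (e \in mix D c c') = if e \in D then e \in c else e \in c'.
Proof. by rewrite !inE; case: (e \in D); rewrite ?andbT ?andbF ?orbF. Qed.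

Lemma mixI D c c' : mix D c c' :&: D = c :&: D.
Proof. by apply/setP => e; rewrite inE mix_in !inE; case: ifP; rewrite ?andbF. Qed.

Lemma mixIC D c c' : mix D c c' :&: ~: D = c' :&: ~: D.
Proof.
by apply/setP => e; rewrite inE mix_in !inE; case: ifP => //; rewrite ?andbF.
Qed.

Lemma supported_mix (X : Type) D (f : {set E} -> X) c c' :
  supported D f -> f (mix D c c') = f c.
Proof. by apply; exact: mixI. Qed.

Lemma supportedC_mix (X : Type) D (f : {set E} -> X) c c' :
  supported (~: D) f -> f (mix D c c') = f c'.
Proof. by apply; exact: mixIC. Qed.

Lemma supportedS (X : Type) D D' (f : {set E} -> X) :
  D \subset D' -> supported D f -> supported D' f.
Proof.
move=> DD' fD c c' cc'; apply: fD.
by rewrite -(finset.setIidPr DD') !setIA cc'.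
Qed.

(* Two independent configurations that exchange their edges outside [D] are
   again two independent configurations. *)
Lemma Ex_mix D f : Ex f = Ex (fun c => Ex (fun c' => f (mix D c c'))).
Proof.
pose sw (u : {set E} * {set E}) := (mix D u.1 u.2, mix D u.2 u.1).
have swK : involutive sw.
  move=> [c c']; rewrite /sw /=; congr pair; apply/setP => e;
    by rewrite !mix_in; case: (e \in D).
transitivity (\sum_c \sum_c' wt c * wt c' * f c).
  rewrite /Ex; apply: eq_bigr => c _.
  by rewrite -mulr_suml -mulr_sumr sum_wt mulr1.
rewrite pair_big /= (reindex_inj (inv_inj swK)) /=.
transitivity (\sum_(u : {set E} * {set E}) wt u.1 * wt u.2 * f (mix D u.1 u.2)).
  apply: eq_bigr => -[c c'] _ /=; congr (_ * _).
  rewrite /wt -!big_split; apply: eq_bigr => e _ /=.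
  by rewrite !mix_in; case: (e \in D) => //; rewrite mulrC.
rewrite -(pair_big xpredT xpredT (fun c c' => wt c * wt c' * f (mix D c c'))) /=.
rewrite /Ex; apply: eq_bigr => c _; rewrite mulr_sumr.
by apply: eq_bigr => c' _; rewrite mulrA.
Qed.

Lemma Ex_indep D f g : supported D f -> supported (~: D) g ->
  Ex (fun c => f c * g c) = Ex f * Ex g.
Proof.
move=> fD gD; rewrite (Ex_mix D) -ExZr; apply: eq_Ex => c.
rewrite -ExZ; apply: eq_Ex => c'.
by rewrite (supported_mix _ _ fD) (supportedC_mix _ _ gD).
Qed.

Lemma Pr_disjoint T : Pr (fun c => [disjoint c & T]) = \prod_(e in T) (1 - p e).
Proof.
(* Each factor is the sum of an open and a closed weight, the open one being suppressed on [T];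
   expanding the product gives the sum over configurations. *)
transitivity (\prod_e ((if e \in T then 0 else p e) + (1 - p e))); last first.
  rewrite [RHS]big_mkcond; apply: eq_bigr => e _; case: ifP; rewrite ?add0r //.
  by rewrite addrC subrK.
rewrite bigA_distr /Pr /Ex; apply: eq_bigr => c _.
case: (boolP [disjoint c & T]) => [dis|/pred0Pn[e /= /andP[ec eT]]].
  rewrite mulr1; apply: eq_bigr => e _; case: ifP => // ec.
  by case: ifP => // eT; rewrite (disjointFr dis ec) in eT.
rewrite mulr0; symmetry; apply/eqP; rewrite prodf_seq_eq0; apply/hasP.
by exists e; rewrite ?mem_index_enum //= ec eT.
Qed.

Lemma Ex_perm (h : E -> E) f : injective h -> (forall e, p (h e) = p e) ->
  Ex (fun c => f (h @: c)) = Ex f.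
Proof.
move=> hinj hp; rewrite /Ex [RHS](reindex_inj (imset_inj hinj)) /=.
apply: eq_bigr => c _; congr (_ * _).
rewrite /wt [RHS](reindex_inj hinj) /=; apply: eq_bigr => e _.
by rewrite mem_imset // hp.
Qed.

Lemma disjoint_mix D c c' T : T \subset ~: D ->
  [disjoint mix D c c' & T] = [disjoint c' & T].
Proof.
move=> /subsetP TD; apply/pred0P/pred0P => dis e; have := dis e => /=;
  rewrite mix_in; have := TD e; rewrite inE;
  by case: (e \in T) => [/(_ isT)/negbTE->|]; rewrite ?andbF.
Qed.

Lemma disjoint_supported D (T : {set E} -> {set E}) :
    supported D T -> (forall c, T c \subset D) ->
  supported D (fun c => [disjoint c & T c]).
Proof.
move=> TD TsubD c c' cc'; rewrite (TD _ _ cc').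
have sub e : e \in T c' -> e \in D by move/subsetP: (TsubD c'); apply.
have ec e : e \in D -> (e \in c) = (e \in c').
  by move/setP/(_ e): cc'; rewrite !inE => cc' eD; rewrite !eD !andbT in cc'.
by apply/pred0P/pred0P => dis e; have /= := dis e;
  case: (boolP (e \in T c')) => [/sub/ec->|]; rewrite ?andbF.
Qed.

(** Exploration: once the edges of [D] are revealed, [T c] is a fixed set of edges that have not
    been looked at. *)
Lemma Pr_and_disjoint D Q (T : {set E} -> {set E}) :
    supported D Q -> supported D T -> (forall c, T c \subset ~: D) ->
  Pr (fun c => Q c && [disjoint c & T c]) =
  Ex (fun c => (Q c)%:R * \prod_(e in T c) (1 - p e)).
Proof.
move=> QD TD TsubD; rewrite /Pr (Ex_mix D); apply: eq_Ex => c.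
rewrite -Pr_disjoint /Pr -ExZ; apply: eq_Ex => c'.
by rewrite (supported_mix _ _ QD) (supported_mix _ _ TD) disjoint_mix // -natrM mulnb.
Qed.

Hypothesis p01 : forall e, 0 <= p e <= 1.

Lemma wt_ge0 c : 0 <= wt c.
Proof.
apply: prodr_ge0 => e _; case/andP: (p01 e) => p0 p1.
by case: ifP => // _; rewrite subr_ge0.
Qed.

Lemma ler_Ex f g : (forall c, f c <= g c) -> Ex f <= Ex g.
Proof. by move=> fg; apply: ler_sum => c _; rewrite ler_wpM2l ?wt_ge0. Qed.

Lemma Ex_le_cst f a : (forall c, f c <= a) -> Ex f <= a.
Proof. by move=> fa; rewrite -[leRHS](Ex_cst a); exact: ler_Ex. Qed.

Lemma Ex_ge0 f : (forall c, 0 <= f c) -> 0 <= Ex f.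
Proof. by move=> f0; rewrite -(Ex_cst 0); exact: ler_Ex. Qed.

Lemma Pr_ge0 Q : 0 <= Pr Q.
Proof. by apply: Ex_ge0 => c; rewrite ler0n. Qed.

Lemma Pr_le1 Q : Pr Q <= 1.
Proof. by apply: Ex_le_cst => c; rewrite lern1 leq_b1. Qed.

Lemma Pr_sub Q Q' : (forall c, Q c -> Q' c) -> Pr Q <= Pr Q'.
Proof.
move=> QQ'; apply: ler_Ex => c; rewrite ler_nat.
by case: (Q c) (QQ' c) => // /(_ isT) ->.
Qed.

Lemma Pr_predT : Pr predT = 1.
Proof. exact: Ex_cst. Qed.

Lemma Pr_predC Q : Pr (fun c => ~~ Q c) = 1 - Pr Q.
Proof.
rewrite -Pr_predT -ExB; apply: eq_Ex => c /=.
by case: (Q c); rewrite ?subrr ?subr0.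
Qed.

Lemma Pr_or Q Q' : Pr (fun c => Q c || Q' c) <= Pr Q + Pr Q'.
Proof.
rewrite -ExD; apply: ler_Ex => c.
by case: (Q c); case: (Q' c); rewrite /= -?natrD ler_nat.
Qed.

Lemma Pr_or_sub Q Q1 Q2 : (forall c, Q c -> Q1 c || Q2 c) ->
  Pr Q <= Pr Q1 + Pr Q2.
Proof. by move=> QQ; apply: le_trans (Pr_or _ _); exact: Pr_sub. Qed.

Lemma Pr_exists (I : finType) (A : pred I) (Q : I -> pred {set E}) :
  Pr (fun c => [exists i, A i && Q i c]) <= \sum_(i | A i) Pr (Q i).
Proof.
rewrite -Ex_sum; apply: ler_Ex => c.
case: existsP => [[i /andP[Ai Qi]]|_]; last by apply: sumr_ge0.
rewrite (bigD1 i) //= Qi lerDl; exact: sumr_ge0.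
Qed.

Lemma Pr_indep D Q Q' : supported D Q -> supported (~: D) Q' ->
  Pr (fun c => Q c && Q' c) = Pr Q * Pr Q'.
Proof.
move=> QD QD'; rewrite /Pr -(@Ex_indep D) => [|c c' /QD->//|c c' /QD'->//].
by apply: eq_Ex => c; rewrite -natrM mulnb.
Qed.

Lemma Pr_mix D Q : Pr Q = Ex (fun c => Pr (fun c' => Q (mix D c c'))).
Proof. exact: Ex_mix. Qed.

Lemma Markov Q f a : 0 < a -> (forall c, 0 <= f c) ->
  (forall c, Q c -> a <= f c) -> Pr Q <= Ex f / a.
Proof.
move=> a0 f0 Qf; rewrite ler_pdivlMr // -ExZr; apply: ler_Ex => c.
by case: (boolP (Q c)) => [/Qf|_]; rewrite ?mul1r ?mul0r.
Qed.

End ProductMeasure.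

(** * Dependence of the product measure on the edge probabilities *)

Section Perturbation.
Variables (R : realFieldType) (E : finType).
Implicit Types (p : E -> R) (c D : {set E}).

Lemma eq_Ex_supported p p' D (f : {set E} -> R) :
  supported D f -> {in D, p =1 p'} -> Ex p f = Ex p' f.
Proof.
(* Two independent configurations of laws [p] and [p'] may exchange their edges
   in [D], where the two laws agree. *)
move=> fD pp'.
pose sw (u : {set E} * {set E}) := (mix D u.2 u.1, mix D u.1 u.2).
have swK : involutive sw.
  move=> [c c']; rewrite /sw /=; congr pair; apply/setP => e;
    by rewrite !mix_in; case: (e \in D).
transitivity (\sum_(u : {set E} * {set E}) wt p u.1 * wt p' u.2 * f u.1).
  rewrite -(pair_big xpredT xpredT (fun c c' => wt p c * wt p' c' * f c)) /=.
  apply: eq_bigr => c _.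
  by rewrite -mulr_suml -mulr_sumr sum_wt mulr1.
rewrite (reindex_inj (inv_inj swK)) /=.
transitivity (\sum_(u : {set E} * {set E}) wt p u.1 * wt p' u.2 * f u.2).
  apply: eq_bigr => -[c c'] _ /=; rewrite (supported_mix _ _ fD); congr (_ * _).
  rewrite /wt -!big_split; apply: eq_bigr => e _ /=.
  by rewrite !mix_in; case: (boolP (e \in D)) => // /pp' ->; rewrite mulrC.
rewrite -(pair_big xpredT xpredT (fun c c' => wt p c * wt p' c' * f c')) /=.
rewrite exchange_big; apply: eq_bigr => c _ /=.
by rewrite -mulr_suml -mulr_suml sum_wt mul1r.
Qed.

Lemma ler_dist_prod (I : Type) (r : seq I) (F G : I -> R) (P : pred I) :
    (forall i, 0 <= F i <= 1) -> (forall i, 0 <= G i <= 1) ->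
  `|\prod_(i <- r | P i) F i - \prod_(i <- r | P i) G i| <=
  \sum_(i <- r | P i) `|F i - G i|.
Proof.
move=> F01 G01; have prod01 (H : I -> R) s : (forall i, 0 <= H i <= 1) ->
    0 <= \prod_(i <- s | P i) H i <= 1.
  by move=> H01; rewrite prodr_ge0 ?prodr_ile1 // => i _; case/andP: (H01 i).
elim: r => [|i r IH]; first by rewrite !big_nil subrr normr0.
rewrite !big_cons; case: ifP => // _.
have -> : F i * \prod_(j <- r | P j) F j - G i * \prod_(j <- r | P j) G j =
    F i * (\prod_(j <- r | P j) F j - \prod_(j <- r | P j) G j) +
    (F i - G i) * \prod_(j <- r | P j) G j by ring.
apply: le_trans (ler_normD _ _) _; rewrite addrC !normrM; apply: lerD.
  by rewrite ler_piMr // ger0_norm; case/andP: (prod01 G r G01).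
apply: le_trans IH; rewrite ler_piMl // ger0_norm; by case/andP: (F01 i).
Qed.

Lemma Pr_perturb p p' D (Q : pred {set E}) (del : R) :
    (forall e, 0 <= p e <= 1) -> (forall e, 0 <= p' e <= 1) ->
    supported D Q -> {in D, forall e, `|p e - p' e| <= del} ->
  Pr p Q <= Pr p' Q + 2 ^+ #|D| * (#|D|%:R * del).
Proof.
move=> p01 p'01 QD close.
(* Closing all edges outside [D] leaves at most [2 ^+ #|D|] configurations of nonzero weight, so the
   bound ignores the size of [E]. Each of these weights changes by at most [#|D|%:R * del]. *)
pose cut (q : E -> R) e := if e \in D then q e else 0.
have cut01 q : (forall e, 0 <= q e <= 1) -> forall e, 0 <= cut q e <= 1.
  by move=> q01 e; rewrite /cut; case: ifP => // _; rewrite lexx ler01.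
have cutE q : Pr q Q = Pr (cut q) Q.
  by apply: (@eq_Ex_supported _ _ D) => [c c' /QD->//|e eD]; rewrite /cut eD.
rewrite (cutE p) (cutE p') -lerBlDl /Pr /Ex -sumrB.
apply: (@le_trans _ _ (\sum_(c in powerset D) (#|D|%:R * del))); last first.
  by rewrite sumr_const card_powerset -[leLHS]mulr_natl natrX.
rewrite [leRHS]big_mkcond; apply: ler_sum => c _; rewrite inE.
have [cD|/subsetPn[e ec eD]] := boolP (c \subset D); last first.
  have wt0 q : wt (cut q) c = 0.
    by rewrite /wt (bigD1 e) //= ec /cut (negbTE eD) mul0r.
  by rewrite !wt0 !mul0r subrr.
rewrite -mulrBl; apply: le_trans (ler_norm _) _; rewrite normrM.
have le1 : `|(Q c)%:R| <= 1 :> R by rewrite ger0_norm // lern1 leq_b1.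
apply: le_trans (ler_wpM2l (normr_ge0 _) le1) _; rewrite mulr1.
apply: le_trans (ler_dist_prod _ _ _ _) _ => [e|e|].
- by have /andP[? ?] := cut01 p p01 e; case: ifP => _; apply/andP; split; lra.
- by have /andP[? ?] := cut01 p' p'01 e; case: ifP => _; apply/andP; split; lra.
apply: (@le_trans _ _ (\sum_(e in D) del)); last by rewrite sumr_const mulr_natl.
rewrite [leRHS]big_mkcond; apply: ler_sum => e _; rewrite /cut.
case: (boolP (e \in D)) => eD; case: (e \in c); rewrite ?subrr ?normr0 //.
  exact: close.
have -> : 1 - p e - (1 - p' e) = p' e - p e by ring.
by rewrite distrC; exact: close.
Qed.

End Perturbation.

(** * Clusters *)

Section Clusters.
Variable V : finType.
Implicit Types (B S : {set V}) (c : {set {set V}}) (x y u v : V).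

Definition adj B c : rel V :=
  fun x y => [&& x \in B, y \in B, x != y & [set x; y] \in c].

Definition clu B c x : {set V} := [set y | connect (adj B c) x y].

(** The empty set is excluded so that disjoint blocks have disjoint sets of inner edges. *)
Definition inner B : {set {set V}} := [set e : {set V} | (e != set0) && (e \subset B)].

Lemma clu_refl B c x : x \in clu B c x.
Proof. by rewrite inE connect0. Qed.

Lemma adj_sym B c : symmetric (adj B c).
Proof.
move=> x y; rewrite /adj eq_sym setUC.
by case: (x \in B); case: (y \in B).
Qed.

Lemma clu_sym B c x y : (y \in clu B c x) = (x \in clu B c y).
Proof. by rewrite !inE (sym_connect_sym (adj_sym B c)). Qed.

Lemma clu_eq B c x y : y \in clu B c x -> clu B c y = clu B c x.
Proof.
rewrite inE => xy; apply/setP => z; rewrite !inE.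
by rewrite (same_connect (sym_connect_sym (adj_sym B c)) xy).
Qed.

Lemma clu_closed_sub B c S x : x \in S ->
  (forall u v, u \in S -> adj B c u v -> v \in S) -> clu B c x \subset S.
Proof.
move=> xS closedS; apply/subsetP => y; rewrite inE => /connectP[p].
elim: p x xS => [|z p IH] x xS /=; first by move=> _ ->.
by move=> /andP[xz pz] yl; apply: (IH z) => //; exact: closedS xz.
Qed.

Lemma clu_adj B c x u v : u \in clu B c x -> adj B c u v -> v \in clu B c x.
Proof. by rewrite !inE => xu uv; exact: connect_trans xu (connect1 uv). Qed.

Lemma clu_sub B c x : x \in B -> clu B c x \subset B.
Proof. by move=> xB; apply: clu_closed_sub => // u v _ /and4P[]. Qed.

Lemma clu_mono B B' c c' x : B \subset B' -> c \subset c' ->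
  clu B c x \subset clu B' c' x.
Proof.
move=> /subsetP BB' /subsetP cc'; apply: clu_closed_sub => [|u v uS /and4P[]];
  first exact: clu_refl.
move=> uB vB uv uvc; apply: clu_adj uS _.
by rewrite /adj !BB' // uv cc'.
Qed.

(** The exit edge starts in the cluster grown inside the small block, which depends on inner edges
    only, while the edge itself is not an inner edge; this is what independence arguments need. *)
Lemma clu_exit B B' c x : x \in B -> B \subset B' ->
  ~~ (clu B' c x \subset B) ->
  exists u v, [/\ u \in clu B c x, v \in B' :\: B & [set u; v] \in c].
Proof.
move=> xB BB' nsub; case: (boolP [exists u, exists v,
    [&& u \in clu B c x, v \in B' :\: B & [set u; v] \in c]]).
  by move=> /existsP[u /existsP[v /and3P[]]]; exists u, v.
rewrite negb_exists => /forallP noexit; case/negP: nsub.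
apply: subset_trans (clu_sub c xB).
apply: clu_closed_sub => [|u v ux /and4P[uB' vB' uv uvc]]; first exact: clu_refl.
have uB := subsetP (clu_sub c xB) _ ux.
apply: clu_adj (ux) _; rewrite /adj uB uv uvc andbT /=.
have := noexit u; rewrite negb_exists => /forallP/(_ v).
by rewrite ux uvc andbT /= inE vB' andbT negbK => ->.
Qed.

Lemma clu_exitP B B' c x u v : B \subset B' -> u \in clu B c x -> u \in B ->
  v \in B' :\: B -> [set u; v] \in c -> v \in clu B' c x.
Proof.
move=> BB' ux uB /setDP[vB' vB] uvc.
have ux' := subsetP (clu_mono x BB' (subxx c)) _ ux.
apply: clu_adj ux' _; rewrite /adj vB' (subsetP BB') // uvc andbT /=.
by apply: contraNneq vB => <-.
Qed.

Lemma clu_supported B x : supported (inner B) (fun c => clu B c x).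
Proof.
move=> c c' cc'; rewrite /clu; apply/setP => y; rewrite !inE.
apply: eq_connect => u v; rewrite /adj.
case: (boolP (u \in B)) => //= uB; case: (boolP (v \in B)) => //= vB.
congr (_ && _); move/setP/(_ [set u; v]): cc'; rewrite !inE.
have -> : [set u; v] \subset B by rewrite subUset !sub1set uB.
have -> : [set u; v] != set0 by apply/set0Pn; exists u; rewrite set21.
by rewrite !andbT.
Qed.

Lemma clu_supportedS B (D : {set {set V}}) x : inner B \subset D ->
  supported D (fun c => clu B c x).
Proof. by move=> BD; apply: supportedS BD _; exact: clu_supported. Qed.

Lemma innerS B B' : B \subset B' -> inner B \subset inner B'.
Proof. by move=> BB'; apply/subsetP => e; rewrite !inE => /andP[-> /subset_trans->]. Qed.

Lemma clu_imset (h : V -> V) B c x : injective h ->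
  clu (h @: B) [set h @: e | e : {set V} in c] (h x) = h @: clu B c x.
Proof.
move=> hinj; have hset u v : [set h u; h v] = h @: [set u; v].
  by rewrite imsetU1 imset_set1.
have hadj u v : adj (h @: B) [set h @: e | e : {set V} in c] (h u) (h v) = adj B c u v.
  by rewrite /adj !mem_imset // (inj_eq hinj) hset mem_imset //; exact: imset_inj.
apply/eqP; rewrite eqEsubset; apply/andP; split.
  apply: clu_closed_sub => [|u v /imsetP[u' u'x ->]].
    by rewrite mem_imset // clu_refl.
  move=> uv; have /imsetP[v' v'B ev] : v \in h @: B by case/and4P: uv.
  rewrite ev mem_imset //; apply: clu_adj u'x _; by rewrite -hadj -ev.
rewrite sub_imset_pre; apply: clu_closed_sub => [|u v].
  by rewrite inE clu_refl.
by rewrite !inE -hadj => /connect_trans xu /connect1; exact: xu.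
Qed.

End Clusters.

(** * Percolation on a finite ultrametric group *)

Section Hier.
Variables (R : realType) (V : finZmodType) (lev : V -> nat) (J : nat -> R).
Hypothesis lev_eq0 : forall x, (lev x == 0%N) = (x == 0).
Hypothesis levN : forall x, lev (- x) = lev x.
Hypothesis levD : forall x y, (lev (x + y)%R <= maxn (lev x) (lev y))%N.
Hypothesis J_ge0 : forall n, 0 <= J n.
Implicit Types (x y u v : V) (S T B : {set V}) (c : {set {set V}}).

Definition diam (e : {set V}) : nat := \max_(x in e) \max_(y in e) lev (x - y)%R.

(** Configurations range over sets of arbitrary vertex sets; those that are not pairs get
    probability [0]. *)
Definition edge_prob (e : {set V}) : R :=
  if #|e| == 2%N then 1 - expR (- J (diam e)) else 0.

Lemma lev0 : lev 0 = 0%N. Proof. by apply/eqP; rewrite lev_eq0. Qed.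

Lemma levB x y : (lev (x - y)%R <= maxn (lev x) (lev y))%N.
Proof. by rewrite -(levN y) levD. Qed.

Lemma levBC x y : lev (x - y) = lev (y - x).
Proof. by rewrite -levN opprB. Qed.

Lemma levB_lt x y : (lev x < lev y)%N -> lev (x - y) = lev y.
Proof.
move=> xy; apply/eqP; rewrite eqn_leq; apply/andP; split.
  by rewrite (leq_trans (levB x y)) // geq_max leqnn ltnW.
have := levB x (x - y); rewrite subKr leq_max; by lia.
Qed.

Lemma diam2 x y : diam [set x; y] = lev (x - y).
Proof.
apply/eqP; rewrite eqn_leq; apply/andP; split.
  apply/bigmax_leqP => u; rewrite !inE => /orP[]/eqP->;
    apply/bigmax_leqP => v; rewrite !inE => /orP[]/eqP->;
    by rewrite ?subrr ?lev0 // levBC.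
apply: leq_trans (leq_bigmax_cond _ (set21 x y)).
exact: leq_trans (leq_bigmax_cond _ (set22 x y)).
Qed.

Lemma edge_prob_pair x y : x != y -> edge_prob [set x; y] = 1 - expR (- J (lev (x - y))).
Proof. by move=> xy; rewrite /edge_prob cards2 xy diam2. Qed.

Lemma edge_prob01 e : 0 <= edge_prob e <= 1.
Proof.
rewrite /edge_prob; case: ifP => _; last by rewrite lexx ler01.
rewrite subr_ge0 expR_le1 oppr_le0 J_ge0 /= lerBlDr lerDl; exact: expR_ge0.
Qed.

Lemma edge_prob_tr a (e : {set V}) : edge_prob [set a + x | x in e] = edge_prob e.
Proof.
rewrite /edge_prob card_imset; last exact: addrI.
case: ifP => // _; congr (_ - expR (- J _)).
rewrite /diam big_imset /=; last by move=> x y _ _; exact: addrI.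
apply: eq_bigr => x _; rewrite big_imset /=; last by move=> ? ? _ _; exact: addrI.
by apply: eq_bigr => y _; congr lev; rewrite opprD addrACA subrr add0r.
Qed.

Local Notation Ex := (Ex edge_prob).
Local Notation Pr := (Pr edge_prob).

Definition translate a c : {set {set V}} := [set [set a + x | x in e] | e : {set V} in c].

Lemma Ex_tr a f : Ex (fun c => f (translate a c)) = Ex f.
Proof.
apply: (Ex_perm (h := fun e : {set V} => [set a + x | x in e])) => [|e].
  by apply: imset_inj; exact: addrI.
exact: edge_prob_tr.
Qed.

Lemma Pr_tr a Q : Pr (fun c => Q (translate a c)) = Pr Q.
Proof. exact: Ex_tr a (fun c => (Q c)%:R). Qed.

Lemma clu_tr a B c x :
  clu [set a + z | z in B] (translate a c) (a + x) = [set a + z | z in clu B c x].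
Proof. by apply: (clu_imset (h := fun z => a + z)); exact: addrI. Qed.

Definition cross S T : {set {set V}} := [set [set u; v] | u in S, v in T].

Definition conductance S T : R := \sum_(u in S) \sum_(v in T) J (lev (u - v)).

Lemma prod_cross S T : [disjoint S & T] ->
  \prod_(e in cross S T) (1 - edge_prob e) = expR (- conductance S T).
Proof.
move=> dST; rewrite /cross curry_imset2X big_imset /=; last first.
  move=> [u v] [u' v'] /=; rewrite !inE /= => /andP[uS vT] /andP[u'S v'T].
  move=> /setP eq2; have := eq2 u; have := eq2 v.
  rewrite !inE !eqxx orbT /= => /esym/orP ev /esym/orP eu.
  have nST w : w \in S -> w \in T -> False.
    by move=> wS; rewrite (disjointFr dST wS).
  case: eu => /eqP eu; last by case: (nST u) => //; rewrite eu.
  case: ev => /eqP ev; first by case: (nST v) => //; rewrite ev.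
  by rewrite eu ev.
transitivity (\prod_(u in S) \prod_(v in T) (1 - edge_prob [set u; v])).
  by rewrite pair_big; apply: eq_big => -[u v]; rewrite ?inE.
rewrite /conductance -sumrN expR_sum.
apply: eq_bigr => u uS; rewrite -sumrN expR_sum; apply: eq_bigr => v vT.
rewrite edge_prob_pair ?subKr //; apply: contraTneq uS => ->.
by rewrite (disjointFl dST vT).
Qed.

Lemma crossP S T c : reflect
  (exists u v, [/\ u \in S, v \in T & [set u; v] \in c])
  (~~ [disjoint c & cross S T]).
Proof.
apply: (iffP pred0Pn) => [[e /= /andP[ec /imset2P[u v uS vT e_def]]]|].
  by exists u, v; rewrite -e_def.
move=> [u [v [uS vT uvc]]]; exists [set u; v]; rewrite /= uvc /=.
by apply/imset2P; exists u v.
Qed.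

Lemma Pr_cross_le S T : [disjoint S & T] ->
  Pr (fun c => ~~ [disjoint c & cross S T]) <= conductance S T.
Proof.
move=> dST; rewrite Pr_predC // Pr_disjoint prod_cross //.
have := expR_ge1Dx (- conductance S T); lra.
Qed.

Definition Lam n : {set V} := [set x | (lev x <= n)%N].
Definition block n x : {set V} := [set y | (lev (y - x)%R <= n)%N].
Definition tail_mass n : R := \sum_(x | (n < lev x)%N) J (lev x).

Lemma LamS m n : (m <= n)%N -> Lam m \subset Lam n.
Proof. by move=> mn; apply/subsetP => x; rewrite !inE => /leq_trans->. Qed.

Lemma Lam0 n : 0 \in Lam n.
Proof. by rewrite inE lev0. Qed.

Lemma block0 n : block n 0 = Lam n.
Proof. by apply/setP => x; rewrite !inE subr0. Qed.

Lemma block_refl n x : x \in block n x.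
Proof. by rewrite inE subrr lev0. Qed.

Lemma LamD n x y : x \in Lam n -> y \in Lam n -> x + y \in Lam n.
Proof. by rewrite !inE => xn yn; rewrite (leq_trans (levD _ _)) // geq_max xn. Qed.

Lemma LamN n x : (- x \in Lam n) = (x \in Lam n).
Proof. by rewrite !inE levN. Qed.

Lemma LamB n x y : x \in Lam n -> y \in Lam n -> x - y \in Lam n.
Proof. by move=> xn yn; rewrite LamD // LamN. Qed.

Lemma block_tr n x : block n x = [set x + z | z in Lam n].
Proof.
apply/setP => y; rewrite inE; apply/idP/imsetP => [yx|[z]].
  by exists (y - x); rewrite ?inE // addrC subrK.
by rewrite inE => zn ->; rewrite addrC addKr.
Qed.

Lemma card_block n x : #|block n x| = #|Lam n|.
Proof. by rewrite block_tr card_imset //; exact: addrI. Qed.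

Lemma Lam_tr n x : x \in Lam n -> [set x + z | z in Lam n] = Lam n.
Proof.
move=> xn; rewrite -block_tr; apply/setP => y; rewrite inE.
apply/idP/idP => [yx|yn]; last by have := LamB yn xn; rewrite inE.
by rewrite -[y](subrK x) LamD // inE.
Qed.

Lemma tail_mass_ge0 n : 0 <= tail_mass n. Proof. exact: sumr_ge0. Qed.

Lemma conductance_Lam n S : S \subset Lam n -> conductance S (~: Lam n) = #|S|%:R * tail_mass n.
Proof.
move=> /subsetP Sn; rewrite /conductance -sumr_const mulr_suml; apply: eq_bigr => u uS.
rewrite mul1r; apply: eq_big => [v|v]; rewrite !inE -ltnNge // => nv.
by rewrite levB_lt //; have := Sn _ uS; rewrite inE => /leq_ltn_trans->.
Qed.

Definition escapes m n c : bool := ~~ (clu (Lam n) c 0 \subset Lam m).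

Lemma escapes_antimono m m' n c : (m <= m')%N -> escapes m' n c -> escapes m n c.
Proof. by move=> mm'; apply: contraNN => /subset_trans->//; exact: LamS. Qed.

Lemma escapes_mono m n n' c : (n <= n')%N -> escapes m n c -> escapes m n' c.
Proof.
move=> nn'; apply: contraNN => /(subset_trans _)->//; apply: clu_mono => //.
exact: LamS.
Qed.

Lemma escapes_exit m n n' c : (m <= n)%N -> (n <= n')%N -> escapes m n' c ->
  escapes m n c || ~~ [disjoint c & cross (Lam m) (~: Lam n)].
Proof.
move=> mn nn' Hc; have [//|nH] /= := boolP (escapes m n c).
have [u [v [um /setDP[vn' vm] uvc]]] := clu_exit (Lam0 m) (LamS (leq_trans mn nn')) Hc.
have uL := subsetP (clu_sub c (Lam0 m)) _ um.
apply/crossP; exists u, v; split => //; rewrite inE.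
apply: contra nH => vn; apply/subsetPn; exists v => //.
by apply: clu_exitP um uL _ uvc; rewrite ?LamS // inE vm.
Qed.

(* Given the configuration in [Lam n], a cluster of at most [A / tail_mass n]
   points has no open edge out of [Lam n] with probability at least [exp (- A)],
   and then the full cluster is stuck in [Lam n]. *)
Lemma isolation n' n M A : (n' <= n <= M)%N -> (forall x, (lev x <= M)%N) ->
  expR (- A) * Pr (fun c => escapes n' n c && (#|clu (Lam n) c 0|%:R * tail_mass n <= A))
  <= Pr (escapes n' M) - Pr (escapes n M).
Proof.
move=> /andP[n'n nM] levM; set X := (fun c => _ && _).
have LM : Lam M = [set: V] by apply/setP => x; rewrite !inE levM.
pose cr c := cross (clu (Lam n) c 0) (~: Lam n).
have cluL c : clu (Lam n) c 0 \subset Lam n by apply: clu_sub; exact: Lam0.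
have cluD := @clu_supported _ (Lam n) 0.
have step1 : expR (- A) * Pr X <= Pr (fun c => X c && [disjoint c & cr c]).
  rewrite (@Pr_and_disjoint _ _ _ (inner (Lam n))); first last.
  - move=> c; apply/subsetP => e /imset2P[u v _ vn ->]; move: vn; rewrite inE.
    by rewrite !inE; apply: contraNN => /andP[_ /subsetP]/(_ _ (set22 u v)); rewrite inE.
  - by move=> c c' /cluD; rewrite /cr => /= ->.
  - by move=> c c' /cluD; rewrite /X /escapes => /= ->.
  rewrite /Pr -ExZ; apply: ler_Ex => [|c]; first exact: edge_prob01.
  case: (boolP (X c)) => [/andP[_ Xc]|_]; last by rewrite !mulr0 mul0r.
  rewrite mulr1 mul1r prod_cross; last by rewrite disjoints_subset setCK.
  by rewrite ler_expR lerN2 conductance_Lam.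
apply: le_trans step1 _; rewrite lerBrDr -ExD; apply: ler_Ex => [|c].
  exact: edge_prob01.
have [Hn|nHn] := boolP (escapes n M c); last first.
  rewrite addr0 ler_nat; case: (boolP (X c)) => [/andP[Hc _]|_] //=.
  by rewrite (escapes_mono nM Hc) leq_b1.
rewrite (escapes_antimono n'n Hn); suff -> : [disjoint c & cr c] = false.
  by rewrite andbF add0r.
apply/negbTE/crossP.
have [u [v [un /setDP[_ vn] uvc]]] := clu_exit (Lam0 n) (LamS nM) Hn.
by exists u, v; split => //; rewrite inE.
Qed.

(** * Second moment of the number of points in large clusters *)

Definition leaves n m x c : bool := ~~ (clu (Lam n) c x \subset block m x).

Lemma leaves_tr n m x y c : x \in Lam n ->
  leaves n m (x + y) (translate x c) = leaves n m y c.
Proof.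
move=> xn; rewrite /leaves -{1}(Lam_tr xn) clu_tr; congr (~~ _).
have -> : block m (x + y) = [set x + z | z in block m y].
  rewrite !block_tr -imset_comp; apply: eq_imset => z /=; by rewrite addrA.
by apply/idP/idP => [|/imsetS->//]; move/subsetP => sub;
  apply/subsetP => z zc; have := sub (x + z);
  rewrite !mem_imset => [/(_ zc)||]; try exact: addrI.
Qed.

Lemma leaves0 n m c : leaves n m 0 c = escapes m n c.
Proof. by rewrite /leaves block0. Qed.

Lemma Pr_leaves n m x : x \in Lam n -> Pr (leaves n m x) = Pr (escapes m n).
Proof.
move=> xn; rewrite -(Pr_tr x); apply: eq_Pr => c.
by rewrite -{1}[x]addr0 leaves_tr // leaves0.
Qed.

Lemma block_disjoint m y : y \notin Lam m -> [disjoint block m 0 & block m y].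
Proof.
move=> ym; apply/pred0P => z /=; apply: contraNF ym => /andP[].
rewrite block0 => z0; rewrite inE => zy.
by rewrite -[y](subKr z) LamB // inE.
Qed.

Lemma lev_block_diff n y u v : y \notin Lam n -> u \in Lam n -> v \in block n y ->
  lev (u - v) = lev y.
Proof.
move=> yn un vy; have -> : u - v = (u - (v - y)) - y.
  by rewrite opprD opprK addrA addrK.
rewrite levB_lt // (@leq_ltn_trans n) //; last by move: yn; rewrite inE -ltnNge.
have : u - (v - y) \in Lam n; last by rewrite inE.
by rewrite LamB //; move: vy; rewrite !inE.
Qed.

(* The two clusters are grown separately inside their disjoint [m]-blocks; the
   last term accounts for an open edge between these blocks. *)
Lemma leaves_both n m y : (m <= n)%N -> y \in Lam n -> y \notin Lam m ->
  Pr (fun c => leaves n m 0 c && leaves n m y c) <=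
  Pr (escapes m n) ^+ 2 + #|Lam m|%:R ^+ 2 * J (lev y).
Proof.
move=> mn yn ym; have dis := block_disjoint ym.
(* [G x x'] asks for an exit from the cluster grown in the block of [x], towards a vertex outside
   both blocks. It depends only on edges that meet the block of [x] and avoid that of [x'], so
   [G 0 y] and [G y 0] are independent. *)
pose G x x' c :=
  ~~ [disjoint c & cross (clu (block m x) c x) ((Lam n :\: block m x) :\: block m x')].
have blockL x : x \in Lam n -> block m x \subset Lam n.
  by move=> xn; rewrite block_tr -(Lam_tr xn) imsetS // LamS.
have leavesG x x' c : x \in Lam n -> leaves n m x c ->
    [disjoint c & cross (block m x) (block m x')] -> G x x' c.
  move=> xn lx nocross.
  have [u [v [ux vD uvc]]] := clu_exit (block_refl m x) (blockL x xn) lx.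
  apply/crossP; exists u, v; split => //; rewrite inE vD andbT.
  apply: contraTN nocross => vx'; apply/crossP; exists u, v; split => //.
  exact: subsetP (clu_sub c (block_refl m x)) _ ux.
have Gleaves x x' c : x \in Lam n -> G x x' c -> leaves n m x c.
  move=> xn /crossP[u [v [ux /setDP[vD _] uvc]]].
  have uB := subsetP (clu_sub c (block_refl m x)) _ ux.
  apply/subsetPn; exists v; last by case/setDP: vD.
  exact: clu_exitP (blockL x xn) ux uB vD uvc.
have Gsupp x x' (D : {set {set V}}) : inner (block m x) \subset D ->
    cross (block m x) (~: block m x') \subset D -> supported D (G x x').
  move=> iD /subsetP cD.
  pose T c := cross (clu (block m x) c x) ((Lam n :\: block m x) :\: block m x').
  have TD : supported D T by move=> d d' /(clu_supportedS x iD); rewrite /T => /= ->.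
  have TsubD c : T c \subset D.
    apply/subsetP => e /imset2P[u v ux /setDP[_ vx'] ->].
    apply: cD; apply/imset2P; exists u v => //; last by rewrite inE.
    exact: subsetP (clu_sub c (block_refl m x)) _ ux.
  by move=> c c' /(disjoint_supported TD TsubD) /= eqT; congr (~~ _).
pose D : {set {set V}} := [set e : {set V} | [disjoint e & block m y]].
have H0 := Lam0 n.
apply: (@le_trans _ _ (Pr (fun c => G 0 y c && G y 0 c)
    + Pr (fun c => ~~ [disjoint c & cross (block m 0) (block m y)]))).
  apply: Pr_or_sub => [|c /andP[l0 ly]]; first exact: edge_prob01.
  have [nocross|] := boolP [disjoint c & _]; last by rewrite orbT.
  rewrite (leavesG 0 y c) ?(leavesG y 0 c) //.
  apply: contraTT nocross => /crossP[u [v [uy v0 uvc]]]; apply/crossP.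
  by exists v, u; rewrite setUC.
apply: lerD.
  rewrite (@Pr_indep _ _ _ D).
  - rewrite expr2; apply: ler_pM; rewrite ?(Pr_ge0 edge_prob01) //.
      rewrite -(Pr_leaves m H0); apply: Pr_sub; first exact: edge_prob01.
      by move=> c; exact: Gleaves.
    rewrite -(Pr_leaves m yn); apply: Pr_sub; first exact: edge_prob01.
    by move=> c; exact: Gleaves.
  - apply: Gsupp; apply/subsetP => e; rewrite ?inE.
      move=> /andP[_ /subsetP e0]; apply/pred0P => z /=.
      by apply/negbTE/negP => /andP[/e0 z0]; rewrite (disjointFr dis z0).
    move=> /imset2P[u v u0 vy ->]; apply/pred0P => z /=.
    apply/negbTE/negP => /andP[]; rewrite !inE => /orP[]/eqP-> zy.
      by have := disjointFr dis u0; rewrite inE zy.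
    by move: vy; rewrite !inE zy.
  - apply: Gsupp; apply/subsetP => e; rewrite !inE.
      move=> /andP[/set0Pn[z ze] /subsetP ey]; apply/pred0Pn; exists z => /=.
      by rewrite ze ey.
    move=> /imset2P[u v uy _ ->]; apply/pred0Pn; exists u => /=.
    by rewrite set21 uy.
apply: le_trans (Pr_cross_le dis) _.
rewrite block0 (_ : conductance _ _ = \sum_(u in Lam m) \sum_(v in block m y) J (lev y)).
  by rewrite !sumr_const card_block -[X in X *+ _]mulr_natl -[X in X <= _]mulr_natl mulrA expr2.
by apply: eq_bigr => u um; apply: eq_bigr => v vy; rewrite (lev_block_diff ym um vy).
Qed.

(** The terms come from [y] in [Lam m], where the probability is bounded by [1], from the
    independent exits, and from open edges between the two [m]-blocks. *)
Definition pair_bound m n : R :=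
  #|Lam m|%:R + #|Lam n|%:R * Pr (escapes m n) ^+ 2 + #|Lam m|%:R ^+ 2 * tail_mass 0.

Lemma sum_leaves_both n m : (m <= n)%N ->
  \sum_(y in Lam n) Pr (fun c => leaves n m 0 c && leaves n m y c) <= pair_bound m n.
Proof.
move=> mn; rewrite (bigID (mem (Lam m))) /= /pair_bound -addrA; apply: lerD.
  apply: (@le_trans _ _ (\sum_(y in Lam m) 1)); last by rewrite sumr_const.
  rewrite [leLHS](eq_bigl (mem (Lam m))) => [|y]; last first.
    by apply: andb_idl; apply/subsetP; exact: LamS.
  by apply: ler_sum => y _; apply: Pr_le1; exact: edge_prob01.
apply: (@le_trans _ _ (\sum_(y in Lam n | y \notin Lam m)
    (Pr (escapes m n) ^+ 2 + #|Lam m|%:R ^+ 2 * J (lev y)))).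
  by apply: ler_sum => y /andP[yn ym]; exact: leaves_both.
rewrite big_split /= -[X in _ + X <= _]mulr_sumr; apply: lerD.
  rewrite mulr_natl -sumr_const; apply: ler_sum_sub => [y /andP[]//|y _].
  exact: sqr_ge0.
rewrite ler_wpM2l ?exprn_ge0 // /tail_mass; apply: ler_sum_sub => // y /andP[_].
by rewrite inE -ltnNge => /(leq_ltn_trans (leq0n _)).
Qed.

Lemma clu_large_leaves n m c x y : x \in Lam n -> y \in clu (Lam n) c x ->
  (#|Lam m| < #|clu (Lam n) c x|)%N -> leaves n m y c.
Proof.
move=> xn yx big; rewrite /leaves (clu_eq yx); apply: contraL big => sub.
by rewrite -leqNgt -(card_block m y) subset_leq_card.
Qed.

(** Markov for the number of [y] such that [0] and [y] both leave their [m]-blocks: a cluster with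
    more than [s] points, too large for an [m]-block, provides at least [s] of them. *)
Lemma cluster_upper_tail n m (s : R) : (m <= n)%N -> 0 < s -> #|Lam m|%:R <= s ->
  Pr (fun c => s < #|clu (Lam n) c 0|%:R) <= pair_bound m n / s.
Proof.
move=> mn s0 ms; rewrite ler_pdivlMr //.
apply: le_trans (sum_leaves_both mn); rewrite -Ex_sum -ExZr.
apply: ler_Ex => [|c]; first exact: edge_prob01.
have [sc|_] := boolP (s < _); last by rewrite mul0r sumr_ge0.
rewrite mul1r; apply: le_trans (ltW sc) _; rewrite -sumr_const.
have cn := clu_sub c (Lam0 n).
have big : (#|Lam m| < #|clu (Lam n) c 0%R|)%N by rewrite -(ltr_nat R) (le_lt_trans ms).
apply: (@le_trans _ _ (\sum_(y in clu (Lam n) c 0)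
    (leaves n m 0 c && leaves n m y c)%:R)).
  by apply: ler_sum => y yc; rewrite !(clu_large_leaves (Lam0 n) _ big) // clu_refl.
by apply: ler_sum_sub => //; exact/subsetP.
Qed.

Definition large n m (h : R) x c : bool :=
  leaves n m x c && (h < #|clu (Lam n) c x|%:R).

Lemma large_tr n m h x y c : x \in Lam n ->
  large n m h (x + y) (translate x c) = large n m h y c.
Proof.
move=> xn; rewrite /large leaves_tr //; congr (_ && (_ < _%:R)).
by rewrite -{1}(Lam_tr xn) clu_tr card_imset //; exact: addrI.
Qed.

(** Chebyshev for the number of large points. Its second moment is bounded by that of the leaving
    points, so the estimate is sharp when [l] is close to the probability of leaving. *)
Lemma few_large n m (h l d : R) : (m <= n)%N -> 0 < d ->
    Pr (large n m h 0) = l ->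
  Pr (fun c => (\sum_(x in Lam n) (large n m h x c)%:R) < (l - d) * #|Lam n|%:R)
  <= (pair_bound m n / #|Lam n|%:R - l ^+ 2) / d ^+ 2.
Proof.
move=> mn d0 hl; set N := #|Lam n|%:R; pose L c : R := \sum_(x in Lam n) (large n m h x c)%:R.
have N0 : 0 < N by rewrite ltr0n; apply/card_gt0P; exists 0; exact: Lam0.
have EL : Ex L = N * l.
  rewrite /L Ex_sum (eq_bigr (fun=> l)) => [|x xn]; first by rewrite sumr_const mulr_natl.
  rewrite -hl -[LHS](Pr_tr x); apply: eq_Pr => c.
  by rewrite -{1}[x]addr0 large_tr.
have EL2 : Ex (fun c => L c ^+ 2) <= N * pair_bound m n.
  have L2 c : L c ^+ 2 = \sum_(x in Lam n) \sum_(y in Lam n)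
     (large n m h x c && large n m h y c)%:R.
    rewrite expr2 mulr_suml; apply: eq_bigr => x _; rewrite mulr_sumr.
    by apply: eq_bigr => y _; rewrite -natrM mulnb.
  rewrite (eq_Ex _ L2) Ex_sum /N -sumr_const mulr_suml; apply: ler_sum => x xn.
  rewrite mul1r; apply: le_trans (sum_leaves_both mn); rewrite Ex_sum.
  rewrite (reindex_inj (addrI x)) /=.
  rewrite [leLHS](eq_bigl (mem (Lam n))) => [|y]; last first.
    apply/idP/idP => [xyn|yn]; last exact: LamD.
    by have : - x + (x + y) \in Lam n; [rewrite LamD ?LamN | rewrite addKr].
  apply: ler_sum => y yn; rewrite -/(Pr _) -(Pr_tr x).
  apply: Pr_sub => [|c]; first exact: edge_prob01.
  rewrite large_tr // -{1}[x]addr0 large_tr //.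
  by case/andP => /andP[-> _] /andP[-> _].
have Ed : Ex (fun c => (L c - l * N) ^+ 2) <= N * pair_bound m n - (l * N) ^+ 2.
  have dev c : (L c - l * N) ^+ 2 = L c ^+ 2 + (- 2 * l * N) * L c + (l * N) ^+ 2.
    by ring.
  rewrite (eq_Ex _ dev) !ExD ExZ EL Ex_cst; nra.
apply: le_trans (Markov edge_prob01 (f := fun c => (L c - l * N) ^+ 2) (a := (d * N) ^+ 2) _ _ _) _.
- by rewrite exprn_gt0 // mulr_gt0.
- by move=> c; exact: sqr_ge0.
- move=> c; rewrite -/(L c) mulrBl => Lc; have dN : 0 < d * N by rewrite mulr_gt0.
  by rewrite -[leRHS]sqrrN ler_sqr ?nnegrE; lra.
rewrite ler_pdivrMr ?exprn_gt0 ?mulr_gt0 //; apply: le_trans Ed _.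
rewrite le_eqVlt; apply/orP; left; apply/eqP; field.
by rewrite !gt_eqF.
Qed.

(** * Merging of the large clusters of two blocks *)

Definition bigclu B (h : R) c : {set {set V}} :=
  [set clu B c x | x in B & h < #|clu B c x|%:R].
Definition bigpts B (h : R) c : {set V} := [set x in B | h < #|clu B c x|%:R].
Definition unions B (h : R) c : {set {set V}} :=
  [set cover X | X : {set {set V}} in powerset (bigclu B h c)].

Lemma in_bigpts B h c x :
  (x \in bigpts B h c) = (x \in B) && (h < #|clu B c x|%:R).
Proof. by rewrite inE. Qed.

Lemma bigpts_clu B h c x y :
  x \in bigpts B h c -> y \in clu B c x -> y \in bigpts B h c.
Proof.
rewrite !in_bigpts => /andP[xB hx] yx; rewrite (clu_eq yx) hx andbT.
exact: subsetP (clu_sub c xB) _ yx.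
Qed.

Lemma unions_sub B h c S : S \in unions B h c -> S \subset B.
Proof.
move=> /imsetP[X]; rewrite inE => /subsetP Xsub ->; apply/bigcupsP => C /Xsub.
by move=> /imsetP[x]; rewrite !inE => /andP[xB _] ->; exact: clu_sub.
Qed.

Lemma mem_unions B h c S :
    (forall x, x \in S -> x \in bigpts B h c -> clu B c x \subset S) ->
  S :&: bigpts B h c \in unions B h c.
Proof.
move=> closedS; apply/imsetP.
exists [set C in bigclu B h c | C \subset S].
  by rewrite inE; apply/subsetP => C; rewrite inE => /andP[].
apply/setP => x; apply/setIP/bigcupP => [[xS xb]|[C]].
  exists (clu B c x); last exact: clu_refl.
  by rewrite inE closedS // andbT; apply/imsetP; exists x => //; rewrite in_bigpts in xb.
rewrite inE => /andP[/imsetP[y yb ->] /subsetP sub] yx; split; first exact: sub.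
by apply: bigpts_clu yx; rewrite in_bigpts; rewrite inE in yb.
Qed.

(** Distinct clusters are disjoint, so at most [#|B| / h] of them have more than [h] points; and
    [2 <= expR 1]. *)
Lemma card_unions B h c : 0 < h -> #|unions B h c|%:R <= expR (#|B|%:R / h).
Proof.
move=> h0; apply: (@le_trans _ _ (2 ^+ #|bigclu B h c|)).
  by rewrite -natrX ler_nat -card_powerset leq_imset_card.
apply: (@le_trans _ _ (expR #|bigclu B h c|%:R)).
  rewrite -[X in expR X]mulr1 expRM_natl.
  rewrite lerXn2r ?nnegrE ?expR_ge0 //.
  by have := expR_ge1Dx (1 : R); lra.
rewrite ler_expR ler_pdivlMr //.
have tI : trivIset (bigclu B h c).
  apply/trivIsetP => C C' /imsetP[x _ ->] /imsetP[y _ ->]; apply: contraNT.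
  by move=> /pred0Pn[z /andP[/= zx zy]]; rewrite -(clu_eq zx) -(clu_eq zy).
apply: (@le_trans _ _ (#|cover (bigclu B h c)|%:R)); last first.
  rewrite ler_nat; apply: subset_leq_card; apply/bigcupsP => C /imsetP[x].
  by rewrite !inE => /andP[xB _] ->; exact: clu_sub.
rewrite -(eqP tI) natr_sum mulr_natl -sumr_const; apply: ler_sum => C.
by move=> /imsetP[x]; rewrite inE => /andP[_ hx] ->; exact: ltW.
Qed.

(** Among the unions of traces of clusters with at most half of [S], a largest one passes the half
    as soon as one more cluster, of at most [a] points, is added. *)
Lemma balanced_closed_set B c S (a : R) : 0 < a ->
    (0 < #|S|)%N -> (forall x, #|clu B c x|%:R <= a) ->
  exists2 S' : {set V}, S' \subset S &
    [/\ forall x y, x \in S' -> y \in S -> y \in clu B c x -> y \in S',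
        #|S'|%:R <= #|S|%:R / 2 :> R & #|S|%:R / 2 - a <= #|S'|%:R].
Proof.
move=> a0 S0 small.
pose closedb (S' : {set V}) := (S' \subset S) && [forall x in S', S :&: clu B c x \subset S'].
pose P (S' : {set V}) := closedb S' && (2 * #|S'| <= #|S|)%N.
have P0 : P set0.
  rewrite /P cards0 muln0 leq0n andbT /closedb sub0set /=.
  by apply/forall_inP => x; rewrite inE.
case: (arg_maxnP (fun S' : {set V} => #|S'|) P0) => S' /andP[/andP[S'S cl] half] maxS'.
have {cl} clS' x y : x \in S' -> y \in S -> y \in clu B c x -> y \in S'.
  move=> xS' yS yx; move/forall_inP: cl => /(_ _ xS') /subsetP; apply.
  by rewrite inE yS.
exists S' => //; split => //.
  by rewrite ler_pdivlMr // -natrM ler_nat mulnC.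
have [x xS xS'] : exists2 x, x \in S & x \notin S'.
  by apply/subsetPn; apply: contraL half => /subset_leq_card; lia.
pose S2 := S' :|: (S :&: clu B c x).
have cl2 : closedb S2.
  rewrite /closedb subUset S'S subsetIl /=; apply/forall_inP => y yS2.
  apply/subsetP => z /setIP[zS zy]; rewrite !inE zS /=.
  move: yS2; rewrite in_setU in_setI => /orP[yS'|/andP[_ yx]].
    by rewrite (clS' y).
  by rewrite (clu_eq yx) in zy; move: zy; rewrite inE => ->; rewrite orbT.
have card2 : (#|S'| < #|S2|)%N.
  apply: proper_card; apply/properP; split; first exact: subsetUl.
  by exists x => //; rewrite !inE xS connect0 orbT.
have big2 : (#|S| < 2 * #|S2|)%N.
  rewrite ltnNge; apply/negP => le2.
  have : (#|S2| <= #|S'|)%N by apply: maxS'; rewrite /P cl2 le2.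
  by rewrite leqNgt card2.
have : (#|S2| <= #|S'| + #|clu B c x|)%N.
  apply: leq_trans (leq_card_setU _ _) _; rewrite leq_add2l.
  exact: subset_leq_card (subsetIr _ _).
move: big2; rewrite -(ltr_nat R) -(ler_nat R) natrM natrD.
by have := small x; lra.
Qed.

(* If no giant cluster forms, the large clusters of [B0] and [B1] split into two
   balanced families with no open edge across; as these clusters have more than
   [h] points, there are few families to choose from. *)
Lemma unmerged_bound B0 B1 B (l : nat) (h mu : R) : 0 < h -> 0 < mu ->
    [disjoint B0 & B1] -> B0 \subset B -> B1 \subset B ->
    (forall u v, u \in B0 -> v \in B1 -> lev (u - v) = l) ->
  Pr (fun c => [&& mu <= #|bigpts B0 h c|%:R, mu <= #|bigpts B1 h c|%:R
       & [forall x, #|clu B c x|%:R < mu / 2]]) <=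
  expR (#|B0|%:R / h + #|B1|%:R / h - J l * (mu ^+ 2 / 8)).
Proof.
move=> h0 mu0 d01 B0B B1B lev01.
pose D := inner B0 :|: inner B1.
pose U c (S : {set V} * {set V}) := [&& S.1 \in unions B0 h c, S.2 \in unions B1 h c &
  mu ^+ 2 / 8 <= #|S.1|%:R * #|S.2|%:R].
have D0 : inner B0 \subset D by exact: subsetUl.
have D1 : inner B1 \subset D by exact: subsetUr.
have usupp B' : inner B' \subset D -> supported D (unions B' h).
  move=> B'D c c' cc'; rewrite /unions; suff -> : bigclu B' h c = bigclu B' h c' by [].
  have cl x : clu B' c x = clu B' c' x by exact: (clu_supportedS x B'D).
  rewrite /bigclu; apply/setP => C.
  by apply/imsetP/imsetP => -[x xb ->]; exists x => //; move: xb; rewrite !inE cl.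
have u0 := usupp _ D0; have u1 := usupp _ D1.
have cross_cond S0 S1 : S0 \subset B0 -> S1 \subset B1 ->
    [disjoint S0 & S1] /\ conductance S0 S1 = J l * (#|S0|%:R * #|S1|%:R).
  move=> /[dup] S0B /subsetP sS0 /[dup] S1B /subsetP sS1; split.
    exact: disjointWl S0B (disjointWr S1B d01).
  rewrite /conductance (eq_bigr (fun=> #|S1|%:R * J l)) => [|u /sS0 uB0].
    by rewrite sumr_const -[LHS]mulr_natl mulrA mulrC.
  rewrite (eq_bigr (fun=> J l)) ?sumr_const ?[RHS]mulr_natl // => v /sS1 vB1.
  by rewrite lev01.
apply: (@le_trans _ _ (Pr (fun c =>
    [exists S, U c S && [disjoint c & cross S.1 S.2]]))).
  apply: Pr_sub => [|c /and3P[m0 m1 /forallP small]]; first exact: edge_prob01.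
  pose Pt := bigpts B0 h c :|: bigpts B1 h c.
  have b0B : bigpts B0 h c \subset B0 by apply/subsetP => x; rewrite in_bigpts => /andP[].
  have b1B : bigpts B1 h c \subset B1 by apply/subsetP => x; rewrite in_bigpts => /andP[].
  have [dbb _] := cross_cond _ _ b0B b1B.
  have cardPt : #|Pt| = (#|bigpts B0 h c| + #|bigpts B1 h c|)%N.
    by rewrite cardsU; move: dbb; rewrite -setI_eq0 => /eqP->; rewrite cards0 subn0.
  have Pt_clu B' S : B' \subset B -> bigpts B' h c \subset Pt ->
      (forall x y, x \in S -> y \in Pt -> y \in clu B c x -> y \in S) ->
    forall x, x \in S -> x \in bigpts B' h c -> clu B' c x \subset S.
    move=> B'B /subsetP sub cl x xS xb; apply/subsetP => y yx.
    apply: (cl x) => //; first by apply: sub; exact: bigpts_clu yx.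
    exact: subsetP (clu_mono x B'B (subxx c)) _ yx.
  have Pt0 : bigpts B0 h c \subset Pt by exact: subsetUl.
  have Pt1 : bigpts B1 h c \subset Pt by exact: subsetUr.
  (* No cluster of [B] reaches [mu / 2], so the split misses balance by at most [mu / 2], the slack
     that [balanced_product] tolerates. *)
  have [S SPt [clS half1 half2]] : exists2 S : {set V}, S \subset Pt &
     [/\ forall x y, x \in S -> y \in Pt -> y \in clu B c x -> y \in S,
        #|S|%:R <= #|Pt|%:R / 2 :> R & #|Pt|%:R / 2 - mu / 2 <= #|S|%:R].
    apply: balanced_closed_set; first lra; last by move=> x; exact: ltW.
    by rewrite -(ltr_nat R) cardPt natrD; lra.
  pose T := Pt :\: S.
  have clT x y : x \in T -> y \in Pt -> y \in clu B c x -> y \in T.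
    move=> /setDP[xP xS] yP yx; rewrite inE yP andbT.
    by apply: contra xS => yS; apply: (clS y) => //; rewrite clu_sym.
  have noedge u v : u \in S -> v \in T -> u \in B -> v \in B -> [set u; v] \notin c.
    move=> uS /setDP[vP vS] uB vB; apply: contra (vS) => uvc; apply: (clS u) => //.
    apply: clu_adj (clu_refl _ _ _) _; rewrite /adj uB vB uvc andbT /=.
    by apply: contraNneq vS => <-.
  have SD B' : B' \subset B -> bigpts B' h c \subset Pt -> bigpts B' h c \subset B' ->
      [/\ S :&: bigpts B' h c \in unions B' h c, T :&: bigpts B' h c \in unions B' h c
       & (#|S :&: bigpts B' h c| + #|T :&: bigpts B' h c|)%N = #|bigpts B' h c|].
    move=> B'B sub bB'; split; [| |].
    - by apply: mem_unions; exact: Pt_clu.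
    - by apply: mem_unions; exact: Pt_clu.
    - rewrite -[RHS](cardsID S) [S :&: _]setIC; congr (_ + #|pred_of_set _|)%N.
      apply/setP => x; rewrite in_setI /T !in_setD.
      by case: (boolP (x \in bigpts _ _ _)) => [/(subsetP sub)->|]; rewrite ?andbT ?andbF.
  have [S0u T0u e0] := SD _ B0B Pt0 b0B; have [S1u T1u e1] := SD _ B1B Pt1 b1B.
  have eS : (#|S :&: bigpts B0 h c| + #|S :&: bigpts B1 h c|)%N = #|S|.
    rewrite -[in RHS](setIidPl SPt) setIUr cardsU -[LHS]subn0; congr (_ - _)%N.
    apply/esym/eqP; rewrite cards_eq0 setIACA setIid.
    by move: dbb; rewrite -setI_eq0 => /eqP->; rewrite setI0.
  have nocross B' B'' : B' \subset B -> B'' \subset B ->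
      bigpts B' h c \subset B' -> bigpts B'' h c \subset B'' ->
      forall u v, u \in S :&: bigpts B' h c -> v \in T :&: bigpts B'' h c ->
      [set u; v] \notin c.
    move=> B'B B''B b'B b''B u v /setIP[uS /(subsetP b'B) uB] /setIP[vT /(subsetP b''B) vB].
    by apply: noedge => //; [exact: subsetP B'B _ _ | exact: subsetP B''B _ _].
  have [big|big] : mu ^+ 2 / 8 <= #|S :&: bigpts B0 h c|%:R * #|T :&: bigpts B1 h c|%:R
      \/ mu ^+ 2 / 8 <= #|T :&: bigpts B0 h c|%:R * #|S :&: bigpts B1 h c|%:R.
  - by apply: balanced_product => //; rewrite -?natrD ?e0 ?e1 ?eS -?cardPt // natrD.
  - apply/existsP; exists (S :&: bigpts B0 h c, T :&: bigpts B1 h c).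
    rewrite /U /= S0u T1u big /=; apply/negPn/crossP => -[u [v [uu vv]]].
    exact/negP/(nocross _ _ B0B B1B b0B b1B).
  - apply/existsP; exists (T :&: bigpts B0 h c, S :&: bigpts B1 h c).
    rewrite /U /= S1u T0u big /=; apply/negPn/crossP => -[u [v [uu vv]]].
    by rewrite setUC; exact/negP/(nocross _ _ B1B B0B b1B b0B).
(* Inside [D] the configuration [c] is frozen and fixes the candidate families; the edges across lie
   outside [D] and come from [c'], so a union bound over the families applies. *)
rewrite (Pr_mix _ D); apply: Ex_le_cst => [|c]; first exact: edge_prob01.
pose K := expR (- (J l * (mu ^+ 2 / 8))).
apply: (@le_trans _ _ (\sum_(S | U c S) K)).
  apply: (@le_trans _ _ (Pr (fun c' => [exists S, U c S && [disjoint c' & cross S.1 S.2]]))).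
    apply: Pr_sub => [|c' /existsP[S /andP[]]]; first exact: edge_prob01.
    rewrite /U (supported_mix _ _ u0) (supported_mix _ _ u1) => US.
    have /and3P[/unions_sub/subsetP S0B /unions_sub/subsetP S1B _] := US.
    rewrite disjoint_mix => [dis|]; first by apply/existsP; exists S; rewrite /U US.
    apply/subsetP => e /imset2P[u v /S0B uB /S1B vB ->]; rewrite !inE negb_or.
    rewrite !negb_and !subUset !sub1set uB vB /= (disjointFr d01 uB).
    by rewrite (disjointFl d01 vB) !orbT.
  apply: le_trans (Pr_exists _ _ _) _; first exact: edge_prob01.
  apply: ler_sum => S /and3P[/unions_sub S0B /unions_sub S1B big].
  have [dS condS] := cross_cond _ _ S0B S1B.
  rewrite Pr_disjoint prod_cross // condS ler_expR lerN2; exact: ler_wpM2l.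
apply: (@le_trans _ _ (\sum_(S in setX (unions B0 h c) (unions B1 h c)) K)).
  apply: ler_sum_sub => S; last by rewrite expR_ge0.
  by case: S => S0 S1 /and3P[? ? _]; rewrite inE /=; apply/andP.
rewrite sumr_const cardsX -[leLHS]mulr_natl natrM 2!expRD; apply: ler_wpM2r; first exact: expR_ge0.
by apply: ler_pM => //; exact: card_unions.
Qed.

Lemma Pr_escapes_exit m n M : (m <= n <= M)%N ->
  Pr (escapes m M) <= Pr (escapes m n) + #|Lam m|%:R * tail_mass n.
Proof.
move=> /andP[mn nM]; apply: le_trans (_ : _ <= Pr (escapes m n)
    + Pr (fun c => ~~ [disjoint c & cross (Lam m) (~: Lam n)])) _.
  by apply: Pr_or_sub => [|c Hc]; [exact: edge_prob01 | exact: escapes_exit Hc].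
rewrite lerD2l; apply: le_trans (Pr_cross_le _) _.
  by rewrite disjoints_subset setCK LamS.
by rewrite conductance_Lam // LamS.
Qed.

(** Comparison with a branching process: every point of the cluster other than the origin is joined,
    off the origin, to a neighbour [x] of the origin. This connection is independent of the edge
    from the origin to [x], whence [chi <= 1 + tail_mass 0 * chi]. *)
Lemma mean_cluster_le : tail_mass 0 < 1 ->
  Ex (fun c => #|clu [set: V] c 0|%:R) <= (1 - tail_mass 0)^-1.
Proof.
move=> b1; set chi := Ex _.
pose V0 := [set~ (0 : V)]; pose op x c := ~~ [disjoint c & cross [set 0] [set x]].
suff : chi <= 1 + tail_mass 0 * chi.
  by move=> chi_le; rewrite -[leRHS]mul1r ler_pdivlMr ?subr_gt0 //; lra.
have pw c : #|clu [set: V] c 0|%:R <=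
    1 + \sum_(x in V0) (op x c)%:R * #|clu V0 c x|%:R :> R.
  pose S := 0 |: \bigcup_(x in V0 | op x c) clu V0 c x.
  apply: (@le_trans _ _ #|S|%:R).
    rewrite ler_nat; apply: subset_leq_card; apply: clu_closed_sub => [|u v].
      by rewrite !inE eqxx.
    rewrite !in_setU1 => uS uv; case: eqP => //= /eqP v0.
    have vV0 : v \in V0 by rewrite !inE.
    have [/eqP u0|u0] := boolP (u == 0).
      apply/bigcupP; exists v; last exact: clu_refl.
      rewrite vV0 /=; apply/crossP; exists 0, v; rewrite !inE eqxx; split=> //.
      by move: uv; rewrite u0 => /and4P[].
    move: uS; rewrite (negbTE u0) => /= /bigcupP[x xP ux].
    apply/bigcupP; exists x => //; apply: clu_adj (ux) _.
    by move: uv => /and4P[_ _ uv uvc]; rewrite /adj !inE u0 v0 uv.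
  apply: (@le_trans _ _ (1 + \sum_(x in V0 | op x c) #|clu V0 c x|)%N%:R).
    rewrite ler_nat; apply: leq_trans (leq_card_setU _ _) _.
    by rewrite cards1 leq_add2l card_bigcup_le.
  rewrite natrD lerD2l natr_sum big_mkcondr /=; apply: ler_sum => x _.
  by case: ifP; rewrite ?mul1r ?mul0r.
rewrite /chi; apply: le_trans (ler_Ex edge_prob01 pw) _.
rewrite ExD Ex_cst lerD2l Ex_sum /tail_mass mulr_suml.
apply: (@le_trans _ _ (\sum_(x in V0) J (lev x) * chi)); last first.
  apply: ler_sum_sub => x; first by rewrite lt0n lev_eq0 !inE.
  by move=> _; apply: mulr_ge0 => //; apply: (Ex_ge0 edge_prob01) => c; exact: ler0n.
apply: ler_sum => x; rewrite !inE => x0.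
pose D : {set {set V}} := [set e : {set V} | 0 \in e].
have d0x : [disjoint [set 0] & [set x]] by rewrite disjoints1 inE eq_sym.
rewrite (@Ex_indep _ _ _ D).
- apply: ler_pM; [exact: Pr_ge0 edge_prob01 _|by apply: (Ex_ge0 edge_prob01) => c; exact: ler0n| |].
    apply: le_trans (Pr_cross_le d0x) _.
    by rewrite /conductance !big_set1 sub0r levN.
  apply: (@le_trans _ _ (Ex (fun c => #|clu [set: V] c x|%:R))).
    apply: ler_Ex => [|c]; first exact: edge_prob01.
    by rewrite ler_nat; apply: subset_leq_card; exact: clu_mono (subsetT _) _.
  rewrite -(Ex_tr x) le_eqVlt; apply/orP; left; apply/eqP; apply: eq_Ex => c.
  have trT : [set x + z | z in [set: V]] = [set: V].
    apply/setP => y; rewrite in_setT; apply/imsetP; exists (y - x) => //.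
    by rewrite addrC subrK.
  by rewrite -[in X in clu _ _ X](addr0 x) -{1}trT clu_tr card_imset //; exact: addrI.
- move=> c c' cc'; congr (~~ _)%:R; apply: (disjoint_supported (D := D)
    (T := fun=> cross [set 0] [set x])) cc' => // _.
  by apply/subsetP => e /imset2P[u v /set1P-> _ ->]; rewrite inE set21.
- move=> c c' cc'; congr (#|pred_of_set _|)%:R.
  apply: (clu_supportedS (B := V0) (D := ~: D)) cc'.
  apply/subsetP => e; rewrite !inE => /andP[_ /subsetP eV0].
  by apply/negP => /eV0; rewrite !inE eqxx.
Qed.

(** * Renormalisation of giant clusters *)

Definition max_clu B x0 c : {set V} := clu B c [arg max_(x > x0 in B) #|clu B c x|].

Lemma max_clu_sub B x0 c : x0 \in B -> max_clu B x0 c \subset B.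
Proof.
by move=> x0B; rewrite /max_clu; case: arg_maxnP => //= x xB _; exact: clu_sub.
Qed.

Lemma max_clu_max B x0 c x : x0 \in B -> x \in B -> (#|clu B c x| <= #|max_clu B x0 c|)%N.
Proof. by move=> x0B xB; rewrite /max_clu; case: arg_maxnP => //= y yB; exact. Qed.

Lemma max_clu_connected B x0 c x y :
  x \in max_clu B x0 c -> y \in max_clu B x0 c -> y \in clu B c x.
Proof. by move=> xm ym; rewrite (clu_eq xm). Qed.

Lemma max_clu_supported B x0 : supported (inner B) (max_clu B x0).
Proof.
move=> c c' cc'; rewrite /max_clu; suff -> : clu B c = clu B c' by [].
by apply: boolp.funext => x; exact: (clu_supported x cc').
Qed.

Lemma inner_tr a B : inner [set a + z | z in B] = translate a (inner B).
Proof.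
apply/setP => e; apply/idP/imsetP => [|[f]]; rewrite !inE.
  move=> /andP[/set0Pn[x xe] /subsetP eB].
  have eE : e = [set a + z | z in [set - a + z | z in e]].
    rewrite -imset_comp (eq_imset (g := id)) ?imset_id // => z /=.
    by rewrite addNKr.
  exists [set - a + z | z in e] => //; rewrite inE; apply/andP; split.
    by apply/set0Pn; exists (- a + x); apply/imsetP; exists x.
  apply/subsetP => _ /imsetP[z /eB /imsetP[w wB ->] ->].
  by rewrite addKr.
move=> /andP[/set0Pn[x xf] fB ->]; rewrite imsetS // andbT.
by apply/set0Pn; exists (a + x); apply/imsetP; exists x.
Qed.

Lemma supported_tr (X : Type) a B (f : {set {set V}} -> X) :
  supported (inner [set a + z | z in B]) f -> supported (inner B) (fun c => f (translate a c)).
Proof.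
move=> fB c c' cc'; apply: fB; rewrite inner_tr.
have inj : injective (fun e : {set V} => [set a + x | x in e]).
  by apply: imset_inj; exact: addrI.
by rewrite /translate -!imsetI ?cc' // => ? ? _ _; exact: inj.
Qed.

(** A certified lower bound for the density of some cluster, rather than the largest density itself:
    gluing may then discard blocks, or give up and return [0]. *)
Definition lower_density n (v : {set {set V}} -> R) :=
  [/\ supported (inner (Lam n)) v, forall c, 0 <= v c <= 1 &
   forall c, exists2 x, x \in Lam n & v c * #|Lam n|%:R <= #|clu (Lam n) c x|%:R].

Definition Var (f : {set {set V}} -> R) := Ex (fun c => (f c - Ex f) ^+ 2).

(* A lower bound for the mean density of a giant cluster survives gluing up to
   summable errors only once it is corrected by the variance: gluing discards
   the blocks of density below [t], which are controlled by the variance, and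
   averaging over the blocks contracts the variance. *)
Definition potential a f := Ex f - 4 / (3 * a) * Var f.

Lemma Ex_sqrB f m : Ex (fun c => (f c - m) ^+ 2) = Var f + (Ex f - m) ^+ 2.
Proof.
rewrite /Var; set E := Ex f.
have dev c : (f c - m) ^+ 2 = (f c - E) ^+ 2 + (2 * (E - m) * f c + (m ^+ 2 - E ^+ 2)).
  by ring.
rewrite (eq_Ex _ dev) ExD ExD ExZ Ex_cst -/E; ring.
Qed.

Lemma Var_ge0 f : 0 <= Var f.
Proof. by apply: (Ex_ge0 edge_prob01) => c; exact: sqr_ge0. Qed.

Lemma lower_tail f t : t < Ex f -> Pr (fun c => f c < t) <= Var f / (Ex f - t) ^+ 2.
Proof.
move=> tE; apply: (Markov edge_prob01) => [|c|c ft]; first by rewrite exprn_gt0 // subr_gt0.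
  exact: sqr_ge0.
by rewrite -[leRHS]sqrrN ler_sqr ?nnegrE; lra.
Qed.

Lemma mean_square (I : finType) (X : I -> {set {set V}} -> R) m s :
    (0 < #|I|)%N -> (forall i, Ex (X i) = m) -> (forall i, Var (X i) = s) ->
    (forall i j, i != j -> Ex (fun c => X i c * X j c) = m ^+ 2) ->
  Ex (fun c => ((\sum_i X i c) / #|I|%:R - m) ^+ 2) = s / #|I|%:R.
Proof.
move=> I0 EX VX indX; set k : R := #|I|%:R.
have k0 : 0 < k by rewrite ltr0n.
have dev c : ((\sum_i X i c) / k - m) ^+ 2 =
    (\sum_i \sum_j (X i c - m) * (X j c - m)) * (k ^+ 2)^-1.
  have -> : (\sum_i X i c) / k - m = (\sum_i (X i c - m)) / k.
    rewrite sumrB sumr_const -[m *+ _]mulr_natl -/k mulrBl.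
    by rewrite [k * m]mulrC mulfK // gt_eqF.
  rewrite expr_div_n; congr (_ / _); rewrite expr2 mulr_suml.
  by apply: eq_bigr => i _; rewrite mulr_sumr.
rewrite (eq_Ex _ dev) ExZr Ex_sum (eq_bigr (fun=> s)) => [|i _]; last first.
  rewrite Ex_sum (bigD1 i) //= [X in _ + X]big1 => [|j ji].
    by rewrite addr0 -(VX i) /Var EX; apply: eq_Ex => c; rewrite expr2.
  have dev2 c : (X i c - m) * (X j c - m) =
      X i c * X j c + ((- m) * X i c + ((- m) * X j c + m ^+ 2)) by ring.
  rewrite (eq_Ex _ dev2) !ExD !ExZ !EX Ex_cst indX; last by rewrite eq_sym.
  ring.
rewrite sumr_const -[s *+ _]mulr_natl -/k; field; by rewrite gt_eqF.
Qed.

Section RenormStep.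
Variables (I : finType) (rep : I -> V) (n : nat) (t : R) (v : {set {set V}} -> R).
Hypotheses (I0 : (0 < #|I|)%N) (rep_in : forall i, rep i \in Lam n.+1).
Hypothesis rep_diff : forall i j, i != j -> rep i - rep j \notin Lam n.
Hypothesis card_LamS : #|Lam n.+1| = (#|I| * #|Lam n|)%N.
Hypotheses (t0 : 0 < t) (v_dens : lower_density n v).

Let bl i := block n (rep i).
Let vi i c := v (translate (- rep i) c).
Let C i c := max_clu (bl i) (rep i) c.
(** Only blocks that certify density [t] have to be joined, since for two such blocks a missing edge
    is very unlikely. The others are dropped, which is not a failure. *)
Let fail c := [exists p : I * I, [&& p.1 != p.2, t <= vi p.1 c, t <= vi p.2 c
   & [disjoint c & cross (C p.1 c) (C p.2 c)]]].
Let kept i c := if t <= vi i c then vi i c else 0.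

Definition glued c : R := if fail c then 0 else (\sum_i kept i c) / #|I|%:R.

Let v_supp : supported (inner (Lam n)) v. Proof. by case: v_dens. Qed.
Let v01 c : 0 <= v c <= 1. Proof. by case: v_dens. Qed.

Let shift_bl i : [set - rep i + z | z in bl i] = Lam n.
Proof.
by rewrite /bl block_tr -imset_comp (eq_imset (g := id)) ?imset_id // => z /=;
  rewrite addKr.
Qed.

Let vi_supp i : supported (inner (bl i)) (vi i).
Proof. by apply: supported_tr; rewrite shift_bl; exact: v_supp. Qed.

Let Ex_vi (F : R -> R) i : Ex (fun c => F (vi i c)) = Ex (fun c => F (v c)).
Proof. exact: (Ex_tr _ (fun c => F (v c))). Qed.

Let C_sub i c : C i c \subset bl i.
Proof. by apply: max_clu_sub; exact: block_refl. Qed.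

Let C_big i c : vi i c * #|Lam n|%:R <= #|C i c|%:R.
Proof.
have [_ _ /(_ (translate (- rep i) c))[x xn]] := v_dens; rewrite -/(vi i c) => vx.
apply: le_trans vx _; rewrite -(shift_bl i) in xn *.
have /imsetP[y yb ->] := xn; rewrite clu_tr card_imset; last exact: addrI.
by rewrite ler_nat; apply: max_clu_max => //; exact: block_refl.
Qed.

Let bl_lev i j x y : i != j -> x \in bl i -> y \in bl j -> lev (x - y) = n.+1.
Proof.
move=> ij; rewrite !inE => xi yj.
have nin : rep j - rep i \notin Lam n by rewrite rep_diff // eq_sym.
have -> : x - y = (x - rep i) - (y - rep i) by rewrite opprB addrA subrK.
rewrite (lev_block_diff nin) ?inE //; last by rewrite opprB addrA subrK.
apply/eqP; rewrite eqn_leq; move: nin; rewrite inE -ltnNge => ->; rewrite andbT.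
by have := LamB (rep_in j) (rep_in i); rewrite inE.
Qed.

Let bl_disj i j : i != j -> [disjoint bl i & bl j].
Proof.
move=> ij; apply/pred0P => x /=; apply/negbTE/negP => /andP[xi xj].
by have := bl_lev ij xi xj; rewrite subrr lev0.
Qed.

Let bl_LamS i : bl i \subset Lam n.+1.
Proof. by rewrite /bl block_tr -(Lam_tr (rep_in i)) imsetS // LamS. Qed.

Let vi01 i c : 0 <= vi i c <= 1. Proof. exact: v01. Qed.

Let kept01 i c : 0 <= kept i c <= vi i c.
Proof. by rewrite /kept; have /andP[h _] := vi01 i c; case: ifP => _; rewrite h lexx. Qed.

Let k0 : 0 < #|I|%:R :> R. Proof. by rewrite ltr0n. Qed.

Let N0 : 0 < #|Lam n|%:R :> R.
Proof. by rewrite ltr0n; apply/card_gt0P; exists 0; exact: Lam0. Qed.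

Let sum_kept_le c : \sum_i kept i c <= #|I|%:R.
Proof.
rewrite -sum1_card natr_sum; apply: ler_sum => i _.
by have /andP[_] := kept01 i c; have /andP[_] := vi01 i c; lra.
Qed.

Let T_sub i j c : i != j -> cross (C i c) (C j c) \subset ~: (inner (bl i) :|: inner (bl j)).
Proof.
move=> ij; apply/subsetP => e /imset2P[x y /(subsetP (C_sub i c)) xi
  /(subsetP (C_sub j c)) yj ->].
rewrite !inE negb_or !negb_and !subUset !sub1set xi yj /=.
by rewrite (disjointFr (bl_disj ij) xi) (disjointFl (bl_disj ij) yj) !orbT.
Qed.

Let T_supp i j (D : {set {set V}}) : inner (bl i) \subset D -> inner (bl j) \subset D ->
  supported D (fun c => cross (C i c) (C j c)).
Proof.
move=> iD jD c c' cc'; rewrite /C.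
rewrite (supportedS iD (@max_clu_supported (bl i) (rep i)) cc').
by rewrite (supportedS jD (@max_clu_supported (bl j) (rep j)) cc').
Qed.

(** Given the interiors of two such blocks, the edges between their clusters are unexplored, all of
    level [n.+1], and at least [(t * #|Lam n|) ^ 2] in number. *)
Lemma Pr_fail :
  Pr fail <= #|I|%:R ^+ 2 * expR (- (J n.+1 * (t * #|Lam n|%:R) ^+ 2)).
Proof.
apply: le_trans (Pr_exists edge_prob01 _ _) _ => /=.
apply: (@le_trans _ _ (\sum_(p : I * I) expR (- (J n.+1 * (t * #|Lam n|%:R) ^+ 2)))).
  rewrite big_mkcond; apply: ler_sum => -[i j] _ /=.
  case: ifP => [ij|_]; last exact: expR_ge0.
  pose D := inner (bl i) :|: inner (bl j).
  have iD : inner (bl i) \subset D by exact: subsetUl.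
  have jD : inner (bl j) \subset D by exact: subsetUr.
  pose Q c := (t <= vi i c) && (t <= vi j c).
  rewrite (eq_Pr _ (Q' := fun c => Q c && [disjoint c & cross (C i c) (C j c)])); last first.
    by move=> c; rewrite andbA.
  rewrite (@Pr_and_disjoint _ _ _ D).
  - apply: (Ex_le_cst edge_prob01) => c; rewrite /Q.
    have [ti|_] := boolP (t <= vi i c); last by rewrite mul0r expR_ge0.
    have [tj|_] := boolP (t <= vi j c); last by rewrite mul0r expR_ge0.
    rewrite mul1r prod_cross; last first.
      exact: disjointWl (C_sub i c) (disjointWr (C_sub j c) (bl_disj ij)).
    rewrite ler_expR lerN2.
    have -> : conductance (C i c) (C j c) = J n.+1 * (#|C i c|%:R * #|C j c|%:R).
      rewrite /conductance (eq_bigr (fun=> #|C j c|%:R * J n.+1)) => [|x xi].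
        by rewrite sumr_const -[LHS]mulr_natl mulrA mulrC.
      rewrite (eq_bigr (fun=> J n.+1)) ?sumr_const ?[RHS]mulr_natl // => y yj.
      by rewrite (bl_lev ij) //; [exact: subsetP (C_sub i c) _ xi | exact: subsetP (C_sub j c) _ yj].
    rewrite ler_wpM2l // expr2.
    have tN i' : t <= vi i' c -> t * #|Lam n|%:R <= #|C i' c|%:R.
      by move=> ti'; apply: le_trans (C_big i' c); rewrite ler_wpM2r // ltW.
    by apply: ler_pM; rewrite ?tN // mulr_ge0 // ltW.
  - move=> c c' cc'; have ei := supportedS iD (@vi_supp i) cc'.
    by have ej := supportedS jD (@vi_supp j) cc'; rewrite /Q ei ej.
  - exact: T_supp.
  - by move=> c; exact: T_sub.
by rewrite sumr_const card_prod -[leLHS]mulr_natl natrM expr2.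
Qed.

Lemma glued_density : lower_density n.+1 glued.
Proof.
split.
- have sub i : inner (bl i) \subset inner (Lam n.+1) by exact: innerS.
  move=> c c' cc'; have eqv i : vi i c = vi i c'.
    exact: (supportedS (sub i) (@vi_supp i) cc').
  have dis i j : [disjoint c & cross (C i c) (C j c)] =
      [disjoint c' & cross (C i c') (C j c')].
    apply: (disjoint_supported (T_supp (sub i) (sub j))) cc' => d.
    apply/subsetP => e /imset2P[x y xi yj ->]; rewrite inE; apply/andP; split.
      by apply/set0Pn; exists x; rewrite set21.
    rewrite subUset !sub1set (subsetP (bl_LamS i) _ (subsetP (C_sub i d) _ xi)).
    by rewrite (subsetP (bl_LamS j) _ (subsetP (C_sub j d) _ yj)).
  rewrite /glued; have -> : fail c = fail c'.
    by apply: eq_existsb => -[i j] /=; rewrite !eqv dis.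
  by case: ifP => // _; congr (_ / _); apply: eq_bigr => i _; rewrite /kept eqv.
- move=> c; rewrite /glued; case: ifP => _; first by rewrite lexx ler01.
  rewrite divr_ge0 ?(ltW k0) //=; last by apply: sumr_ge0 => i _; case/andP: (kept01 i c).
  by rewrite ler_pdivrMr // mul1r sum_kept_le.
move=> c; rewrite /glued; have [_|nofail] := boolP (fail c).
  by exists 0; rewrite ?Lam0 // mul0r.
rewrite card_LamS natrM mulrA divfK; last by rewrite gt_eqF.
(* Any kept block [i0] is a hub: without failure every other kept cluster has an open edge to its
   cluster. If no block is kept, the claimed density is [0] and any point will do. *)
have [i0 ti0|none] := pickP (fun i => t <= vi i c); last first.
  exists 0; rewrite ?Lam0 // big1 ?mul0r // => i _.
  by rewrite /kept none.
have [x xi0] : exists x, x \in C i0 c.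
  apply/card_gt0P; rewrite -(ltr_nat R); apply: lt_le_trans (C_big i0 c).
  by rewrite mulr_gt0 // (lt_le_trans t0).
exists x; first exact: subsetP (bl_LamS i0) _ (subsetP (C_sub i0 c) _ xi0).
pose F i := if t <= vi i c then C i c else set0.
have Fdisj i j : i != j -> [disjoint F i & F j].
  move=> ij; rewrite -setI_eq0 /F; case: ifP => _; last by rewrite set0I.
  case: ifP => _; last by rewrite setI0.
  by rewrite setI_eq0 (disjointWl (C_sub i c) (disjointWr (C_sub j c) (bl_disj ij))).
apply: (@le_trans _ _ (#|\bigcup_i F i|%:R)).
  have := partition_disjoint_bigcup addn (fun=> 1%N) Fdisj.
  rewrite sum1_card /= => ->; rewrite natr_sum mulr_suml.
  apply: ler_sum => i _; rewrite sum1_card /F /kept.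
  by case: ifP => _; rewrite ?C_big // cards0 mul0r.
rewrite ler_nat; apply: subset_leq_card; apply/bigcupsP => i _; rewrite /F.
case: ifP => [ti|_]; last exact: sub0set.
have blS j : bl j \subset Lam n.+1 by exact: bl_LamS.
have Cclu j y z : y \in C j c -> z \in C j c -> z \in clu (Lam n.+1) c y.
  move=> yj zj; apply: subsetP (clu_mono y (blS j) (subxx c)) _ _.
  exact: max_clu_connected yj zj.
apply/subsetP => y yi; have [ii0|ii0] := eqVneq i i0.
  by apply: (Cclu i0) => //; rewrite -ii0.
have /crossP[u [w [ui w0 uwc]]] : ~~ [disjoint c & cross (C i c) (C i0 c)].
  apply: contra nofail => dis; apply/existsP; exists (i, i0) => /=.
  by rewrite ii0 ti ti0.
have uL := subsetP (blS i) _ (subsetP (C_sub i c) _ ui).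
have wL := subsetP (blS i0) _ (subsetP (C_sub i0 c) _ w0).
have wu : w \in clu (Lam n.+1) c u.
  apply: clu_adj (clu_refl _ _ _) _; rewrite /adj uL wL uwc andbT /=.
  apply: contraTneq (subsetP (C_sub i c) _ ui) => ->.
  by rewrite (disjointFl (bl_disj ii0) (subsetP (C_sub i0 c) _ w0)).
rewrite -(clu_eq (Cclu i0 _ _ xi0 w0)) (clu_eq wu).
exact: (Cclu i).
Qed.

Let m := Ex v.
Let q := Pr (fun c => v c < t).
Let X c := (\sum_i vi i c) / #|I|%:R.
Let drop c := (\sum_i (vi i c - kept i c)) / #|I|%:R.

Let Ex_X : Ex X = m.
Proof.
rewrite /X ExZr Ex_sum (eq_bigr (fun=> m)) => [|i _]; last exact: (Ex_vi id).
by rewrite sumr_const -[m *+ _]mulr_natl mulrC mulrA mulVf ?mul1r // gt_eqF.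
Qed.

Let drop1 i c : vi i c - kept i c <= t * (vi i c < t)%R%:R.
Proof.
rewrite /kept ltNge; case: ifP => /= [_|/negbT]; first by rewrite subrr mulr0.
by rewrite -ltNge subr0 mulr1 => /ltW.
Qed.

Let drop01 c : 0 <= drop c <= t.
Proof.
apply/andP; split.
  apply: divr_ge0; last exact: ltW.
  by apply: sumr_ge0 => i _; case/andP: (kept01 i c) => _; rewrite subr_ge0.
rewrite ler_pdivrMr // mulr_natr -sumr_const; apply: ler_sum => i _.
by apply: le_trans (drop1 i c) _; rewrite ler_piMr ?(ltW t0) // lern1 leq_b1.
Qed.

Let Ex_drop : Ex drop <= t * q.
Proof.
rewrite /drop ExZr Ex_sum ler_pdivrMr // mulrC mulr_natl -sumr_const.
apply: ler_sum => i _; rewrite /q /Pr -(Ex_vi (fun r => (r < t)%R%:R) i) -ExZ.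
by apply: (ler_Ex edge_prob01) => c; exact: drop1.
Qed.

Let gluedE c : glued c = if fail c then 0 else X c - drop c.
Proof.
rewrite /glued; case: ifP => // _; rewrite /X /drop -mulrBl -sumrB.
by congr (_ / _); apply: eq_bigr => i _; rewrite subKr.
Qed.

Let XD01 c : 0 <= X c - drop c <= 1.
Proof.
rewrite /X /drop -mulrBl -sumrB (eq_bigr (kept^~ c)) => [|i _]; last by rewrite subKr.
rewrite divr_ge0 ?(ltW k0) //=; last by apply: sumr_ge0 => i _; case/andP: (kept01 i c).
by rewrite ler_pdivrMr // mul1r sum_kept_le.
Qed.

Lemma Ex_glued_ge : m - t * q - Pr fail <= Ex glued.
Proof.
apply: (@le_trans _ _ (Ex (fun c => X c - drop c - (fail c)%:R))).
  by rewrite !ExB Ex_X lerD2r lerD2l lerN2.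
apply: (ler_Ex edge_prob01) => c; rewrite gluedE; have := XD01 c.
by case: (fail c) => /=; lra.
Qed.

(** Rests on [(x - y) ^+ 2 <= 4 / 3 * x ^+ 2 + 4 * y ^+ 2], a form of [0 <= (x + 3 * y) ^+ 2], with
    [x = X c - m] and [y = drop c <= t]. The weight [4 / 3] is small enough for averaging over two
    blocks still to contract the variance. *)
Lemma Ex_glued_sqr_le :
  Ex (fun c => (glued c - m) ^+ 2) <= 4 / 3 * (Var v / #|I|%:R) + 4 * t ^+ 2 * q + Pr fail.
Proof.
have m01 : 0 <= m <= 1.
  by rewrite (Ex_ge0 edge_prob01) ?(Ex_le_cst edge_prob01) // => c; case/andP: (v01 c).
apply: (@le_trans _ _ (Ex (fun c => 4 / 3 * (X c - m) ^+ 2 + 4 * t * drop c + (fail c)%:R))).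
  apply: (ler_Ex edge_prob01) => c; rewrite gluedE.
  have := drop01 c; have := XD01 c; case: (fail c) => /= h1 h2.
    have : 0 <= (X c - m) ^+ 2 by exact: sqr_ge0.
    by nra.
  have : 0 <= (X c - m + 3 * drop c) ^+ 2 by exact: sqr_ge0.
  by nra.
rewrite ExD ExD !ExZ lerD2r; apply: lerD.
  rewrite le_eqVlt; apply/orP; left; apply/eqP; congr (_ * _).
  apply: mean_square => // [i|i|i j ij].
  - exact: (Ex_vi id).
  - by rewrite /Var [Ex (vi i)](Ex_vi id); exact: (Ex_vi (fun r => (r - m) ^+ 2)).
  - rewrite (@Ex_indep _ _ _ (inner (bl i))) => [||].
    + by rewrite [Ex (vi i)](Ex_vi id) [Ex (vi j)](Ex_vi id) expr2.
    + exact: vi_supp.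
    + apply: supportedS (@vi_supp j); apply/subsetP => e.
      rewrite !inE => /andP[/set0Pn[x xe] /subsetP ej].
      rewrite negb_and; apply/orP; right; apply/subsetPn; exists x => //.
      by rewrite (disjointFl (bl_disj ij)) // ej.
rewrite (_ : 4 * t ^+ 2 * q = 4 * t * (t * q)); last by ring.
by apply: ler_wpM2l Ex_drop; rewrite mulr_ge0 // ltW.
Qed.

(** The variance shrinks to [3 / 4 * Var v + Pr fail], where [3 / 4] is [4 / 3 / 2], from averaging
    at least two blocks, plus [1 / 12] from the dropped ones. Weighted by [4 / (3 * a)], the quarter
    gained is worth [Var v / (3 * a)], which pays for the dropped mean [t * q]. *)
Lemma potential_glued a : (1 < #|I|)%N -> 0 < a -> t = a / 16 ->
    a / 2 <= potential a v ->
  potential a v - (1 + 4 / (3 * a)) * Pr fail <= potential a glued.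
Proof.
move=> I2 a0 ta hpot; have s0 := Var_ge0 v.
have am : a / 2 <= m.
  apply: le_trans hpot _; rewrite /potential gerBl mulr_ge0 // divr_ge0 //; lra.
have tm : t < m by rewrite ta; lra.
(* Chebyshev with [m - t >= a / 2 - a / 16]. The choice [t = a / 16] makes both uses fit:
   [16 / 49 <= 1 / 3] for [t * q] and [4 / 49 <= 1 / 12] for [4 * t ^+ 2 * q]. *)
have qle : q * (49 / 256 * a ^+ 2) <= Var v.
  have := lower_tail tm; rewrite ler_pdivlMr ?exprn_gt0 ?subr_gt0 // -/q => h.
  have q0 : 0 <= q by exact: Pr_ge0 edge_prob01 _.
  apply: le_trans h; apply: ler_wpM2l => //.
  have -> : 49 / 256 * a ^+ 2 = (7 / 16 * a) ^+ 2 by field.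
  by rewrite ler_sqr ?nnegrE -?/m; lra.
have tq : t * q <= Var v / (3 * a).
  rewrite ler_pdivlMr ?mulr_gt0 //; rewrite ta; nra.
have tq2 : 4 * t ^+ 2 * q <= Var v / 12.
  by rewrite ta; nra.
have sk : Var v / #|I|%:R <= Var v / 2.
  by rewrite ler_wpM2l // lef_pV2 ?posrE // ler_nat.
have h1 := Ex_glued_ge; have h2 := Ex_glued_sqr_le.
have h3 : Var glued <= 3 / 4 * Var v + Pr fail.
  have := Ex_sqrB glued m; have := sqr_ge0 (Ex glued - m); lra.
have a3 : 0 < 4 / (3 * a) by rewrite divr_gt0 ?mulr_gt0.
have h4 : 4 / (3 * a) * Var glued <= 4 / (3 * a) * (3 / 4 * Var v + Pr fail).
  by rewrite ler_pM2l.
have e5 : 4 / (3 * a) * Var v = Var v / (3 * a) + 4 / (3 * a) * (3 / 4 * Var v).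
  by field; rewrite gt_eqF.
rewrite /potential -/m; lra.
Qed.

End RenormStep.

(** The variable is [a] times an indicator of probability at least [15 / 16]; the missing mean and
    the variance correction together cost less than [a / 4]. *)
Lemma density_base n a : 0 < a <= 1 ->
    15 / 16 <= Pr (fun c => [exists x in Lam n, a * #|Lam n|%:R <= #|clu (Lam n) c x|%:R]) ->
  exists2 v, lower_density n v & 3 / 4 * a <= potential a v.
Proof.
move=> /andP[a0 a1]; set Q := (fun c => _); set p := Pr Q => hp.
have p1 : p <= 1 by exact: Pr_le1 edge_prob01 _.
have Ev : Ex (fun c => a * (Q c)%:R) = a * p by rewrite ExZ.
exists (fun c => a * (Q c)%:R).
  split => [c c' cc'|c|c].
  - suff -> : Q c = Q c' by [].
    by apply: eq_existsb => x; rewrite (clu_supported x cc').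
  - by case: (Q c); rewrite ?mulr1 ?mulr0 ?lexx ?ler01 ?(ltW a0).
  - have [/exists_inP[x xn hx]|_] := boolP (Q c).
      by exists x => //; rewrite mulr1.
    by exists 0; rewrite ?Lam0 // mulr0 mul0r.
have := Ex_sqrB (fun c => a * (Q c)%:R) 0.
have -> : Ex (fun c => (a * (Q c)%:R - 0) ^+ 2) = a ^+ 2 * p.
  by rewrite /p /Pr -ExZ; apply: eq_Ex => c; case: (Q c) => /=; ring.
rewrite /potential Ev => VE.
have {VE} -> : Var (fun c => a * (Q c)%:R) = a ^+ 2 * p - (a * p - 0) ^+ 2.
  by rewrite VE addrK.
have -> : a * p - 4 / (3 * a) * (a ^+ 2 * p - (a * p - 0) ^+ 2) =
  a * (p - 4 / 3 * (p * (1 - p))) by field; rewrite gt_eqF.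
rewrite [leLHS]mulrC ler_pM2l //; nra.
Qed.

(** When [v c > a / 4], the points of the certified cluster all lie in a cluster of density at least
    [a / 4], so the fraction of such points is at least [v c]. By translation its mean is the
    probability for the origin. *)
Lemma density_origin n a (v : {set {set V}} -> R) : 0 < a -> lower_density n v -> a / 2 <= Ex v ->
  a / 4 <= Pr (fun c => a / 4 * #|Lam n|%:R <= #|clu (Lam n) c 0|%:R).
Proof.
move=> a0 [_ v01 vclu] Ev; set Q := (fun c => _).
have N0 : 0 < #|Lam n|%:R :> R by rewrite ltr0n; apply/card_gt0P; exists 0; exact: Lam0.
pose big x c := a / 4 * #|Lam n|%:R <= #|clu (Lam n) c x|%:R.
have Ebig x : x \in Lam n -> Pr (big x) = Pr Q.
  move=> xn; rewrite -(Pr_tr x); apply: eq_Pr => c; rewrite /big /Q.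
  have := clu_tr x (Lam n) c 0; rewrite Lam_tr // addr0 => ->.
  by rewrite card_imset //; exact: addrI.
have : Ex v <= Ex (fun c => a / 4 + (\sum_(x in Lam n) (big x c)%:R) / #|Lam n|%:R).
  apply: (ler_Ex edge_prob01) => c; have [x xn vx] := vclu c.
  have [va|va] := lerP (v c) (a / 4).
    by rewrite (le_trans va) // lerDl divr_ge0 // sumr_ge0.
  have bx : big x c by rewrite /big (le_trans _ vx) // ler_wpM2r // ltW.
  rewrite -[leLHS]add0r; apply: lerD; first by rewrite divr_ge0 // ltW.
  rewrite ler_pdivlMr //; apply: le_trans vx _; rewrite -sumr_const.
  apply: (@le_trans _ _ (\sum_(y in clu (Lam n) c x) (big y c)%:R)).
    by apply: ler_sum => y yx; rewrite /big (clu_eq yx) -/(big x c) bx.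
  by apply: ler_sum_sub => //; exact/subsetP/clu_sub.
rewrite ExD Ex_cst ExZr Ex_sum (eq_bigr (fun=> Pr Q)) => [|x xn]; last exact: Ebig.
rewrite sumr_const -[Pr Q *+ _]mulr_natl [_ * Pr Q]mulrC mulfK ?gt_eqF //; lra.
Qed.

Lemma tail_mass_step n : tail_mass n <= #|Lam n.+1|%:R * J n.+1 + tail_mass n.+1.
Proof.
rewrite /tail_mass (bigID (fun x => lev x == n.+1)) /=; apply: lerD; last first.
  apply: ler_sum_sub => // x /andP[nx nx1]; by rewrite ltn_neqAle eq_sym nx1.
rewrite mulr_natl -sumr_const.
apply: (@le_trans _ _ (\sum_(x | (n < lev x)%N && (lev x == n.+1)) J n.+1)).
  by apply: ler_sum => x /andP[_ /eqP->].
by apply: ler_sum_sub => // x /andP[_ /eqP xn]; rewrite inE xn.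
Qed.

Lemma tail_mass_antimono m n : (m <= n)%N -> tail_mass n <= tail_mass m.
Proof. by move=> mn; apply: ler_sum_sub => // x; exact: leq_ltn_trans. Qed.

Lemma tail_mass_max M : (forall x, (lev x <= M)%N) -> tail_mass M = 0.
Proof. by move=> levM; rewrite /tail_mass big_pred0 // => x; rewrite ltnNge levM. Qed.

Lemma Pr_bigpts_tr n r (h mu : R) :
  Pr (fun c => #|bigpts (block n r) h c|%:R < mu) =
  Pr (fun c => #|bigpts (Lam n) h c|%:R < mu).
Proof.
rewrite -(Pr_tr r); apply: eq_Pr => c; congr (_%:R < mu).
rewrite block_tr -[RHS](card_imset _ (addrI r)); congr #|pred_of_set _|.
apply/setP => x; rewrite in_bigpts; apply/andP/imsetP.
  move=> [/imsetP[y yn ->]]; rewrite clu_tr card_imset; last exact: addrI.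
  by move=> hy; exists y => //; rewrite in_bigpts yn.
move=> [y]; rewrite in_bigpts => /andP[yn hy ->]; rewrite mem_imset; last exact: addrI.
by rewrite clu_tr card_imset //; exact: addrI.
Qed.

End Hier.

(** * The block of level [M] as a group of matrices *)

Section Model.
Variables (L' d M : nat).
Local Notation L := L'.+1.
Local Notation vertex := 'M['I_L]_(M, d).
Implicit Types (v w : vertex) (n : nat).

(* A point of the block [Lam M] is the matrix whose rows are its first [M]
   components; row [i] has level [i.+1]. *)
Definition mlev v : nat := \max_(i < M | row i v != 0) i.+1.

Lemma mlev_leP v n :
  reflect (forall (i : 'I_M) j, (n <= i)%N -> v i j = 0) (mlev v <= n)%N.
Proof.
rewrite /mlev; apply: (iffP (bigmax_leqP _ _ _)) => [h i j ni|h i vi].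
  apply/eqP; apply: contraTT ni => vij; rewrite -ltnNge; apply: h.
  by apply: contraNneq vij => /rowP/(_ j); rewrite !mxE => ->.
rewrite ltnNge; apply: contraNN vi => ni; apply/eqP/rowP => j.
by rewrite !mxE h.
Qed.

Lemma mlev_eq0 v : (mlev v == 0%N) = (v == 0).
Proof.
rewrite -leqn0; apply/mlev_leP/eqP => [h|-> i j _]; last by rewrite mxE.
by apply/matrixP => i j; rewrite h // mxE.
Qed.

Lemma mlevN v : mlev (- v) = mlev v.
Proof.
have le w : (mlev (- w) <= mlev w)%N.
  by apply/mlev_leP => i j wi; rewrite mxE; move/mlev_leP: wi => ->; rewrite ?oppr0.
by apply/eqP; rewrite eqn_leq le -{1}[v]opprK le.
Qed.

Lemma mlevD v w : (mlev (v + w)%R <= maxn (mlev v) (mlev w))%N.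
Proof.
apply/mlev_leP => i j; rewrite geq_max => /andP[/mlev_leP vi /mlev_leP wi].
by rewrite mxE vi // wi // addr0.
Qed.

Lemma mlev_le v : (mlev v <= M)%N.
Proof. by apply/mlev_leP => i j; rewrite leqNgt ltn_ord. Qed.

(** Representatives of the blocks of level [n] in [Lam n.+1]: they differ only in row [n], the row
    of level [n.+1]. *)
Definition digit n (g : 'rV['I_L]_d) : vertex :=
  \matrix_(i, j) if i == n :> nat then g 0 j else 0.

Lemma digit_in n g : digit n g \in Lam mlev n.+1.
Proof.
rewrite inE; apply/mlev_leP => i j ni; rewrite mxE gtn_eqF //.
Qed.

Lemma digit_diff n g g' : (n < M)%N -> g != g' ->
  digit n g - digit n g' \notin Lam mlev n.
Proof.
move=> nM; apply: contraNN; rewrite inE => /mlev_leP h; apply/eqP/rowP => j.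
apply/eqP; rewrite -subr_eq0; apply/eqP.
by have := h (Ordinal nM) j (leqnn n); rewrite !mxE eqxx.
Qed.

Lemma card_digits : #|'rV['I_L]_d| = (L ^ d)%N.
Proof. by rewrite card_mx card_ord mul1n. Qed.

Lemma card_LamS n : (n < M)%N ->
  #|Lam mlev n.+1| = (#|'rV['I_L]_d| * #|Lam mlev n|)%N.
Proof.
move=> nM; rewrite -cardsT -cardsX.
have inj : {in setX [set: 'rV['I_L]_d] (Lam mlev n) &,
    injective (fun p => digit n p.1 + p.2)}.
  move=> [g x] [g' x'] /=; rewrite !inE /= => xn x'n eqx.
  have gg' : g = g'.
    apply/eqP/negPn/negP => /(digit_diff nM)/negP; apply.
    have -> : digit n g - digit n g' = x' - x.
      by apply/eqP; rewrite subr_eq addrAC eq_sym subr_eq addrC eqx addrC.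
    rewrite inE (leq_trans (levB mlevN mlevD _ _)) // geq_max.
    by rewrite x'n xn.
  by rewrite gg' in eqx *; move/addrI: eqx => ->.
rewrite -(card_in_imset inj); congr #|pred_of_set _|; apply/setP => x.
apply/idP/imsetP => [|[[g y] /=]]; last first.
  rewrite !inE /= => yn ->; rewrite (leq_trans (mlevD _ _)) // geq_max.
  by have := digit_in n g; rewrite inE => ->; exact: leqW.
rewrite inE => /mlev_leP xn.
pose g := row (Ordinal nM) x; exists (g, x - digit n g); last by rewrite /= addrC subrK.
rewrite !inE /=; apply/mlev_leP => i j ni; rewrite !mxE.
case: eqP => [ie|/eqP ie]; last by rewrite subr0 xn // ltn_neqAle eq_sym ie.
by rewrite (_ : Ordinal nM = i) ?subrr //; apply: val_inj.
Qed.

Lemma card_Lam n : (n <= M)%N -> #|Lam mlev n| = ((L ^ d) ^ n)%N.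
Proof.
elim: n => [_|n IH nM]; last by rewrite card_LamS // IH ?card_digits ?expnS // ltnW.
rewrite expn0 -(cards1 (0 : vertex)); congr #|pred_of_set _|.
by apply/setP => v; rewrite !inE leqn0 mlev_eq0.
Qed.

End Model.

From mathcomp Require Import all_classical all_reals all_analysis.
Import numFieldNormedType.Exports.
Local Open Scope classical_set_scope.

(** * Transfer to the infinite lattice *)

Section Atoms.
Variables (R : realType) (dT : measure_display) (Omega : measurableType dT).
Variables (P : probability Omega R) (E : finType) (A : E -> set Omega) (t : E -> R).
Hypothesis mA : forall e, measurable (A e).
Hypothesis PA : forall S : {set E},
  P (\bigcap_(e in [set` S]) A e) = (\prod_(e in S) t e)%:E.

Let Z (S : {set E}) (T : seq E) := \bigcap_(e in [set` S]) A e `&`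
  \bigcap_(e in [set` T]) ~` A e.

Let mZ S T : measurable (Z S T).
Proof.
apply: measurableI; apply: fin_bigcap_measurable => //; try exact: finite_finset.
- by move=> e _; exact: measurableC.
Qed.

(** The hypothesis speaks of open edges only. Closed edges are added one at a time by subtraction:
    [Z S T] splits into [Z S (e :: T)] and the pattern where [e] is open. *)
Lemma P_pattern (S : {set E}) (T : seq E) : uniq T -> (forall e, e \in T -> e \notin S) ->
  P (Z S T) = ((\prod_(e in S) t e) * \prod_(e <- T) (1 - t e))%:E.
Proof.
elim: T S => [|e T IH] S /=.
  move=> _ _; rewrite big_nil mulr1 -PA /Z [X in _ `&` X](_ : _ = setT) ?setIT //.
  by apply/seteqP; split => // w _ e.
move=> /andP[eT uT] TS.
have eS : e \notin S by apply: TS; rewrite mem_head.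
have T'S e' : e' \in T -> e' \notin S by move=> e'T; apply: TS; rewrite in_cons e'T orbT.
have dec : Z S T = Z S (e :: T) `|` Z (e |: S)%SET T.
  apply/seteqP; split => [w [wS wT]|w [[wS wT]|[wS wT]]].
  - have [Aw|Aw] := pselect (A e w); [right|left]; split => // e' /=.
      by rewrite finset.in_setU1 => /orP[/eqP->//|/wS].
    by rewrite in_cons => /orP[/eqP->//|/wT].
  - by split => // e' e'T; apply: wT => /=; rewrite in_cons e'T orbT.
  - by split => // e' e'S; apply: wS => /=; rewrite finset.in_setU1 e'S orbT.
have disj : Z S (e :: T) `&` Z (e |: S)%SET T = set0.
  apply/seteqP; split => // w [[_ wT] [wS _]].
  by apply: (wT e) => /=; [rewrite mem_head|apply: wS => /=; rewrite finset.setU11].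
have PZ : P (Z S T) = (P (Z S (e :: T)) + P (Z (e |: S)%SET T))%E.
  by rewrite dec; exact: measureU (mZ _ _) (mZ _ _) disj.
have := IH S uT T'S; rewrite PZ (IH (e |: S)%SET) //; last first.
  move=> e' e'T; rewrite finset.in_setU1 negb_or T'S // andbT.
  by apply: contraNneq eT => <-.
rewrite finset.big_setU1 //= big_cons.
move=> /(congr1 (fun z => z - (t e * (\prod_(i in S) t i) * \prod_(i <- T) (1 - t i))%:E)%E).
rewrite addeK // => ->; rewrite -EFinB; congr EFin; ring.
Qed.

Let atomE (c : {set E}) :
  [set w | forall e, (e \in c) <-> A e w] = Z c (enum (~: c)%SET).
Proof.
apply/seteqP; split => [w cw|w [wc wc'] e].
  split => e /=; first by move=> /cw.
  by rewrite mem_enum finset.inE => /negP ec /cw.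
split; first by move=> ec; exact: wc.
move=> Ae; apply/negPn/negP => ec; apply: (wc' e) => //=.
by rewrite mem_enum finset.inE.
Qed.

Lemma P_atom (c : {set E}) :
  P [set w | forall e, (e \in c) <-> A e w] = (wt t c)%:E.
Proof.
rewrite atomE P_pattern ?enum_uniq //; last by move=> e; rewrite mem_enum finset.inE.
congr EFin; rewrite /wt [RHS](bigID (mem c)) /= big_enum /=; congr (_ * _).
  by apply: eq_bigr => e ec; rewrite ec.
rewrite (eq_bigl (fun e => e \notin c)) => [|e]; last by rewrite finset.inE.
by apply: eq_bigr => e /negbTE->.
Qed.

Lemma measurable_atom (c : {set E}) :
  measurable [set w | forall e, (e \in c) <-> A e w].
Proof. by rewrite atomE; exact: mZ. Qed.

End Atoms.

(** * Finite blocks inside the lattice *)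

Section Embedding.
Variables (L' d : nat).
Local Notation L := L'.+1.
Local Notation vertex M := 'M['I_L]_(M, d).

Definition emb M (v : vertex M) : pt d :=
  fun i j => if insub i is Some i' then nat_of_ord (v i' j) else 0%N.

Definition proj M (x : pt d) : vertex M := \matrix_(i, j) inord (x i j).

Lemma emb_at M (v : vertex M) (i : 'I_M) j : emb v i j = v i j.
Proof. by rewrite /emb valK. Qed.

Lemma emb_out M (v : vertex M) i j : (M <= i)%N -> emb v i j = 0%N.
Proof. by move=> Mi; rewrite /emb insubN // -leqNgt. Qed.

Lemma emb_HL M (v : vertex M) : HL d L (emb v).
Proof.
split; last by exists M => i j; exact: emb_out.
by move=> i j; rewrite /emb; case: insub.
Qed.

Lemma inblock_emb M n (v w : vertex M) :
  inblock d n (emb v) (emb w) <-> (mlev (v - w) <= n)%N.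
Proof.
split => [h|/mlev_leP h i ni].
  apply/mlev_leP => i j ni; rewrite !mxE; apply/eqP; rewrite subr_eq0.
  by apply/eqP/val_inj => /=; rewrite -!emb_at h.
apply: funext => j; have [iM|Mi] := ltnP i M; last by rewrite !emb_out.
have := h (Ordinal iM) j ni; rewrite !mxE => /eqP; rewrite subr_eq0 => /eqP vw.
by have := emb_at v (Ordinal iM) j; have := emb_at w (Ordinal iM) j; rewrite vw /= => -> ->.
Qed.

Lemma emb0 M : emb (0 : vertex M) = pt0 d.
Proof.
apply: funext => i; apply: funext => j.
have [iM|Mi] := ltnP i M; last by rewrite emb_out.
by have := emb_at (0 : vertex M) (Ordinal iM) j; rewrite mxE.
Qed.

Lemma emb_Lam M n (v : vertex M) : Defs.Lam d n (emb v) <-> v \in Lam (@mlev L' d M) n.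
Proof.
rewrite /Defs.Lam /= -(emb0 M) inblock_emb finset.inE.
by rewrite sub0r mlevN.
Qed.

Lemma emb_inj M : injective (@emb M).
Proof.
move=> v w vw; apply/eqP; rewrite -subr_eq0 -mlev_eq0 -leqn0.
by apply/inblock_emb; rewrite vw.
Qed.

Lemma emb_proj M x : HL d L x -> Defs.Lam d M x -> emb (proj M x) = x.
Proof.
move=> [xL _] xM; apply: funext => i; apply: funext => j.
have [iM|Mi] := ltnP i M; last by rewrite emb_out // -(xM i Mi).
by have := emb_at (proj M x) (Ordinal iM) j; rewrite !mxE /= inordK.
Qed.

Lemma dexpP x y n : inblock d n x y ->
  inblock d (dexp d x y) x y /\ forall m, inblock d m x y -> (dexp d x y <= m)%N.
Proof.
move=> nxy; rewrite /dexp; apply: (@xgetPex _ 0%N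
  [set n | inblock d n x y /\ forall m, inblock d m x y -> (n <= m)%N]).
have ex : exists n, `[< inblock d n x y >] by exists n; apply/asboolP.
exists (ex_minn ex); case: ex_minnP => m /asboolP mxy min; split => // k kxy.
by apply: min; apply/asboolP.
Qed.

Lemma dexp_emb M (v w : vertex M) : dexp d (emb v) (emb w) = mlev (v - w).
Proof.
have vw : inblock d (mlev (v - w)) (emb v) (emb w) by apply/inblock_emb.
have [h1 h2] := dexpP vw; apply/eqP; rewrite eqn_leq h2 //=.
exact/inblock_emb.
Qed.

Lemma is_edge_emb M (v w : vertex M) : v != w -> is_edge d L (emb v) (emb w).
Proof.
move=> vw; split; [exact: emb_HL|split; first exact: emb_HL].
by move=> /emb_inj /eqP; apply/negP.
Qed.

Lemma HL_Lam x : HL d L x -> exists n, forall M, (n <= M)%N -> Defs.Lam d M x.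
Proof.
move=> [_ [N xN]]; exists N => M NM i Mi; apply: funext => j.
by rewrite xN // (leq_trans NM).
Qed.

End Embedding.

(* Think of [u m n] as the probability that the cluster of the origin in [Lam n]
   leaves [Lam m]: [f] is its limit in [n] and [th] the limit of [f]. *)
Definition profile (R : realType) (u : nat -> nat -> R) (f : nat -> R) (th : R) :=
  [/\ forall m n, 0 <= u m n <= f m,
      forall m, {homo u m : n n' / (n <= n')%N >-> n <= n'},
      forall m e, 0 < e -> exists n, f m - e < u m n,
      forall m m', (m <= m')%N -> f m' <= f m <= 1 &
      (forall m, th <= f m) /\ forall e, 0 < e -> exists m, f m < th + e].

(** * Percolation on the lattice through finite volumes *)

Section Bridge.
Variables (R : realType) (L' d : nat) (dT : measure_display) (Omega : measurableType dT).
Variables (P : probability Omega R) (U : pt d -> pt d -> Omega -> R).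
Local Notation L := L'.+1.
Hypothesis hU : iid_uniform_edges R d L P U.
Variable K : pt d -> pt d -> R.
Hypothesis Ksym : kernel_sym R d L K.
Local Notation vertex M := 'M['I_L]_(M, d).
Local Notation mlev M := (@mlev L' d M).

Definition opened (w : Omega) (x y : pt d) : Prop := open_edge R d U K w x y.

Definition conf M (w : Omega) : {set {set vertex M}} :=
  [set e | [exists p : vertex M * vertex M, [&& p.1 != p.2, e == [set p.1; p.2]%SET
     & `[< opened w (emb p.1) (emb p.2) >]]]]%SET.

Lemma opened_sym w M (u v : vertex M) : u != v ->
  opened w (emb u) (emb v) -> opened w (emb v) (emb u).
Proof.
move=> uv; rewrite /opened /open_edge; have euv := is_edge_emb uv.
have evu : is_edge d L (emb v) (emb u) by apply: is_edge_emb; rewrite eq_sym.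
have [Us _ _] := hU.
by rewrite (Us _ _ _ euv) (Ksym euv).
Qed.

Lemma mem_conf M w (u v : vertex M) : u != v ->
  ([set u; v]%SET \in conf M w) <-> opened w (emb u) (emb v).
Proof.
move=> uv; rewrite /conf finset.inE; split => [/existsP[[u' v'] /= /and3P[u'v' e /asboolP o]]|o].
  have /eqP/setP eqs := e; have := eqs u; have := eqs v; rewrite !finset.inE !eqxx orbT /=.
  move=> /esym/orP[]/eqP ev /esym/orP[]/eqP eu.
  - by rewrite ev eu eqxx in uv.
  - by rewrite ev eu; exact: opened_sym o.
  - by rewrite ev eu.
  - by rewrite ev eu eqxx in uv.
by apply/existsP; exists (u, v); rewrite /= uv eqxx /=; apply/asboolP.
Qed.

Let A M (e : {set vertex M}) : set Omega := [set w | e \in conf M w].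

Let A_pair M (u v : vertex M) : u != v ->
  A [set u; v]%SET = [set w | opened w (emb u) (emb v)].
Proof. by move=> uv; apply/seteqP; split => w /=; rewrite /A /= mem_conf. Qed.

Let A_dummy M (e : {set vertex M}) : #|e| != 2%N -> A e = set0.
Proof.
move=> e2; apply/seteqP; split => // w; rewrite /A /= finset.inE.
move=> /existsP[[u v] /and3P[/= uv /eqP e_def _]].
by move: e2; rewrite e_def cards2 uv.
Qed.

Let mA M (e : {set vertex M}) : measurable (A e).
Proof.
have [/cards2P[u [v [uv ->]]]|/A_dummy->] := boolP (#|e| == 2%N); last exact: measurable0.
by rewrite A_pair //; have [_ + _] := hU; apply; exact: is_edge_emb.
Qed.

Lemma measurable_conf M c : measurable [set w | conf M w = c].
Proof.
have := measurable_atom (@mA M) c; congr (measurable _).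
apply/seteqP; split => w /= => [h|<- //].
by apply/finset.setP => e; apply/idP/idP; have := h e; rewrite /A /=; tauto.
Qed.

Lemma measurable_event M (Q : pred {set {set vertex M}}) :
  measurable [set w | Q (conf M w)].
Proof.
have -> : [set w | Q (conf M w)] = [set w | conf M w \in enum Q].
  by apply/seteqP; split => w /=; rewrite mem_enum.
elim: (enum Q) => [|c s IH].
  by rewrite (_ : [set w | _] = set0) //; apply/seteqP; split.
have -> : [set w | conf M w \in c :: s] =
    [set w | conf M w = c] `|` [set w | conf M w \in s].
  apply/seteqP; split => w /=; rewrite in_cons.
    by move=> /orP[/eqP|]; [left|right].
  by move=> [->|->]; rewrite ?eqxx ?orbT.
by apply: measurableU => //; exact: measurable_conf.
Qed.

(** Defined on the lattice by paths that stay in [Lam n], hence independently of the size of a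
    model; [origin_clu_clu] identifies it in every model with [n <= M]. *)
Definition origin_clu n (w : Omega) : set (pt d) :=
  [set y | exists (m : nat) (z : nat -> pt d),
     [/\ z 0%N = pt0 d, z m = y, forall k, (k <= m)%N -> Defs.Lam d n (z k) &
         forall k, (k < m)%N -> is_edge d L (z k) (z k.+1) /\ opened w (z k) (z k.+1)]].

Lemma origin_clu_step n w x y : origin_clu n w x -> Defs.Lam d n y ->
  is_edge d L x y -> opened w x y -> origin_clu n w y.
Proof.
move=> [m [z [z0 zm zn ze]]] yn exy oxy.
exists m.+1, (fun k => if (k <= m)%N then z k else y); split => //.
- by rewrite ltnn.
- by move=> k _; case: ifP => // km; exact: zn.
move=> k; rewrite ltnS => km; rewrite km; case: ifP => km'; first exact: ze.
have -> : k = m by apply/eqP; rewrite eqn_leq km leqNgt km'.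
by rewrite zm.
Qed.

Lemma pt0_HL : HL d L (pt0 d).
Proof. by split => //; exists 0%N. Qed.

Lemma origin_clu_HL n w x : origin_clu n w x -> HL d L x.
Proof.
move=> [m [z [z0 zm _ ze]]]; rewrite -zm; case: m {zm} ze => [_|m ze].
  by rewrite z0; exact: pt0_HL.
by have [[_ [+ _]] _] := ze m (leqnn _).
Qed.

Lemma origin_clu_clu M n w (v : vertex M) : (n <= M)%N ->
  origin_clu n w (emb v) <-> v \in clu (Lam (mlev M) n) (conf M w) 0.
Proof.
move=> nM; split.
  move=> [m [z [z0 zm zn ze]]].
  have LM x : Defs.Lam d n x -> Defs.Lam d M x.
    by move=> xn i Mi; apply: xn; exact: leq_trans nM Mi.
  have zHL k : (k <= m)%N -> HL d L (z k).
    case: k => [_|k km]; first by rewrite z0; exact: pt0_HL.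
    by have [[_ [+ _]] _] := ze k km.
  have zE k : (k <= m)%N -> emb (proj L' M (z k)) = z k.
    by move=> km; apply: emb_proj; [exact: zHL|exact/LM/zn].
  suff : forall k, (k <= m)%N -> proj L' M (z k) \in clu (Lam (mlev M) n) (conf M w) 0.
    move=> /(_ m (leqnn m)); rewrite zm (_ : proj L' M (emb v) = v) //.
    by apply: emb_inj; have := zE m (leqnn m); rewrite zm.
  elim=> [_|k IH km].
    rewrite z0 (_ : proj L' M (pt0 d) = 0) ?clu_refl //.
    by apply: emb_inj; rewrite emb0 -z0 zE.
  have [zkS okS] := ze k km; apply: clu_adj (IH (ltnW km)) _.
  have neq : proj L' M (z k) != proj L' M (z k.+1).
    apply/eqP => /(congr1 (@emb L' d M)); rewrite !zE // ?(ltnW km) // => zz.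
    by case: zkS => _ [_]; exact.
  have inL k' : (k' <= m)%N -> proj L' M (z k') \in Lam (mlev M) n.
    by move=> k'm; apply/emb_Lam; rewrite zE //; exact: zn.
  rewrite /adj !inL ?(ltnW km) // neq /=.
  by apply/mem_conf => //; rewrite !zE // ltnW.
pose S : {set vertex M} := [set v | `[< origin_clu n w (emb v) >]]%SET.
suff /fintype.subsetP sub : clu (Lam (mlev M) n) (conf M w) 0 \subset S.
  by move=> /sub; rewrite finset.inE => /asboolP.
apply: clu_closed_sub => [|u v']; rewrite !finset.inE.
  apply/asboolP; rewrite emb0; exists 0%N, (fun=> pt0 d); split => //.
move=> /asboolP ru; rewrite /adj => /and4P[uL vL uv uvc]; apply/asboolP.
apply: origin_clu_step ru _ _ _; first exact/emb_Lam.
  exact: is_edge_emb.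
exact/mem_conf.
Qed.

Definition escape_event m n : set Omega := [set w | ~ (origin_clu n w `<=` Defs.Lam d m)].

Lemma escape_event_conf M m n w : (n <= M)%N -> escape_event m n w <-> escapes (mlev M) m n (conf M w).
Proof.
move=> nM; rewrite /escape_event /= /escapes; split => [nsub|/fintype.subsetPn[v vc vm] sub].
  apply/fintype.subsetPn; apply: contra_notP nsub => allm y yr.
  have yM : Defs.Lam d M y.
    case: yr => k [z [_ <- zn _]] i Mi; apply: (zn k (leqnn k)).
    exact: leq_trans nM Mi.
  have yE := emb_proj (origin_clu_HL yr) yM; rewrite -yE; apply/emb_Lam.
  apply/negPn/negP => pm; apply: allm; exists (proj L' M y) => //.
  by apply/(origin_clu_clu _ _ nM); rewrite yE.
by case/negP: vm; apply/emb_Lam/sub; apply/(origin_clu_clu _ _ nM).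
Qed.

Lemma escape_event_mono m n n' : (n <= n')%N -> escape_event m n `<=` escape_event m n'.
Proof.
move=> nn' w; rewrite !(escape_event_conf (M := n')) //; exact: escapes_mono.
Qed.

Lemma escape_event_antimono m m' n : (m <= m')%N -> escape_event m' n `<=` escape_event m n.
Proof.
by move=> mm' w; rewrite !(escape_event_conf (M := n)) //; exact: escapes_antimono.
Qed.

Let clus w := cluster0 R d L U K w.

Lemma clusE w y : clus w y <-> exists n, origin_clu n w y.
Proof.
split=> [[m [z [z0 zm ze]]]|[n [m [z [z0 zm _ ze]]]]]; last by exists m, z; split.
have zHL k : (k <= m)%N -> HL d L (z k).
  case: k => [_|k km]; first by rewrite z0; exact: pt0_HL.
  by have [[_ [+ _]] _] := ze k km.
have [N zN] : exists N, forall k, (k <= m)%N -> Defs.Lam d N (z k).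
  elim: {-2}m (leqnn m) => [_|k IH km].
    by exists 0%N => k; rewrite leqn0 => /eqP->; rewrite z0.
  have [N1 h1] := IH (ltnW km); have [N2 h2] := HL_Lam (zHL _ km).
  exists (maxn N1 N2) => k'; rewrite leq_eqVlt => /orP[/eqP->|].
    by apply: h2; exact: leq_maxr.
  rewrite ltnS => /h1 h i Ni; apply: h; exact: leq_trans (leq_maxl _ _) Ni.
by exists N, m, z; split.
Qed.

Lemma clus_infinite w : ~ finite_set (clus w) <-> forall m, exists n, escape_event m n w.
Proof.
split=> [inf m|unb fin].
  apply: contra_notP inf => none; apply: (@sub_finite_set _ _ (@emb L' d m @` setT)).
    move=> y yc; have [n yn] := (clusE w y).1 yc.
    exists (proj L' m y) => //; apply: emb_proj; first exact: origin_clu_HL yn.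
    by apply: contra_notP none => ym; exists n => /(_ y yn).
  by apply: finite_image; exact: finite_finset.
have [s sE] := (finite_seqP _).1 fin.
have [N sN] : exists N, forall y, y \in s -> Defs.Lam d N y.
  have : forall y, y \in s -> HL d L y.
    move=> y ys; have : clus w y by rewrite sE.
    by move=> /clusE[n /origin_clu_HL].
  elim: (s : seq _) => [_|y s' IH h]; first by exists 0%N.
  have [|N1 h1] := IH; first by move=> y' y's; apply: h; rewrite in_cons y's orbT.
  have [N2 h2] := HL_Lam (h y (mem_head _ _)).
  exists (maxn N1 N2) => y'; rewrite in_cons => /orP[/eqP->|/h1 h3].
    by apply: h2; exact: leq_maxr.
  by move=> i Ni; apply: h3; exact: leq_trans (leq_maxl _ _) Ni.
have [n nN] := unb N; apply: nN => y yn; apply: sN.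
have : clus w y by apply/clusE; exists n.
by rewrite sE.
Qed.

Lemma measurable_escape_event m n : measurable (escape_event m n).
Proof.
have -> : escape_event m n = [set w | escapes (mlev n) m n (conf n w)].
  by apply/seteqP; split => w /=; rewrite (escape_event_conf _ _ (leqnn n)).
exact: measurable_event.
Qed.

Lemma infinite_clusterE :
  [set w | ~ finite_set (cluster0 R d L U K w)] = \bigcap_m \bigcup_n escape_event m n.
Proof.
apply/seteqP; split => w /=.
  by move=> /clus_infinite h m _; have [n Hn] := h m; exists n.
by move=> h; apply/clus_infinite => m; have [n _ Hn] := h m I; exists n.
Qed.

Lemma measurable_infinite_cluster :
  measurable [set w | ~ finite_set (cluster0 R d L U K w)].
Proof.
rewrite infinite_clusterE; apply: bigcapT_measurable => m.
by apply: bigcupT_measurable => n; exact: measurable_escape_event.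
Qed.

Section Law.
Variable J : nat -> R.
Hypothesis J_ge0 : forall n, 0 <= J n.
Hypothesis KJ : forall x y, is_edge d L x y -> K x y = J (dexp d x y).

Let t M (e : {set vertex M}) : R := edge_prob (mlev M) J e.

(** Independence is given for lists of distinct edges with named endpoints, so [pr] chooses an
    orientation for each pair of [S]. A set that is not a pair has probability [0] on both sides. *)
Let PA M (S : {set {set vertex M}}) :
  P (\bigcap_(e in [set` S]) A e) = (\prod_(e in S) t e)%:E.
Proof.
have [[e eS e2]|all2] := pselect (exists2 e, e \in S & #|e| != 2%N).
  rewrite (bigD1 e) //= {1}/t /edge_prob (negbTE e2) mul0r.
  suff -> : \bigcap_(e in [set` S]) A e = set0 by rewrite measure0.
  by apply/seteqP; split => // w /(_ e eS); rewrite A_dummy.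
have two e : e \in S -> #|e| == 2%N.
  by move=> eS; apply/negPn/negP => e2; apply: all2; exists e.
pose pr (e : {set vertex M}) : vertex M * vertex M :=
  odflt (0, 0) [pick p | (p.1 != p.2) && (e == [set p.1; p.2]%SET)].
have prP e : e \in S -> (pr e).1 != (pr e).2 /\ e = [set (pr e).1; (pr e).2]%SET.
  move=> /two/cards2P[u [v [uv e_def]]]; rewrite /pr; case: pickP => [p /andP[? /eqP]|] //=.
  by move=> /(_ (u, v)); rewrite /= uv e_def eqxx.
have [_ _ indep] := hU.
pose x (k : 'I_#|S|) := emb (pr (enum_val k)).1.
pose y (k : 'I_#|S|) := emb (pr (enum_val k)).2.
pose tt (k : 'I_#|S|) := t (enum_val k).
have := indep _ x y tt => h.
transitivity (P (\bigcap_(k in [set: 'I_#|S|]) [set w | U (x k) (y k) w <= tt k])).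
  congr (P _); apply/seteqP; split => w hw.
    move=> k _; have kS := enum_valP k; have := hw _ kS.
    have [uv e_def] := prP _ kS; rewrite /A /= [X in X \in _]e_def mem_conf //.
    rewrite /opened /open_edge KJ; last exact: is_edge_emb.
    by rewrite dexp_emb /tt /t e_def (edge_prob_pair J (@mlev_eq0 _ _ _) (@mlevN _ _ _)) -?e_def.
  move=> e eS; have := hw (enum_rank_in eS e) I; rewrite /x /y /tt /=.
  rewrite enum_rankK_in //.
  have [uv e_def] := prP _ eS; rewrite /A /= [X in _ -> X \in _]e_def mem_conf //.
  rewrite /opened /open_edge KJ; last exact: is_edge_emb.
  by rewrite dexp_emb /t {3}e_def (edge_prob_pair J (@mlev_eq0 _ _ _) (@mlevN _ _ _)).
rewrite h.
- congr EFin; rewrite [RHS]big_enum_val; exact: eq_bigr.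
- move=> k; have kS := enum_valP k; have [uv _] := prP _ kS.
  by split; [exact: is_edge_emb | exact: (edge_prob01 _ J_ge0 _)].
- move=> k k' kk'; have [_ ek] := prP _ (enum_valP k); have [_ ek'] := prP _ (enum_valP k').
  suff ne : enum_val k <> enum_val k'.
    split => -[/emb_inj h1 /emb_inj h2]; apply: ne; rewrite ek ek' h1 h2 //.
    by rewrite finset.setUC.
  by move=> /enum_val_inj.
Qed.

Lemma P_conf M c : P [set w | conf M w = c] = (wt (edge_prob (mlev M) J) c)%:E.
Proof.
rewrite -(P_atom (@mA M) (@PA M) c); congr (P _).
apply/seteqP; split => w /= => [<- //|h].
by apply/finset.setP => e; apply/idP/idP; have := h e; rewrite /A /=; tauto.
Qed.

Let P_conf_seq M (s : seq {set {set vertex M}}) : uniq s ->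
  P [set w | conf M w \in s] = (\sum_(c <- s) wt (edge_prob (mlev M) J) c)%:E.
Proof.
elim: s => [_|c s IH /= /andP[cs us]].
  have -> : [set w | conf M w \in [::]] = set0 by apply/seteqP; split.
  by rewrite big_nil measure0.
have -> : [set w | conf M w \in c :: s] =
    [set w | conf M w = c] `|` [set w | conf M w \in s].
  apply/seteqP; split => w /=; rewrite in_cons.
    by move=> /orP[/eqP|]; [left|right].
  by move=> [->|->]; rewrite ?eqxx ?orbT.
have -> : P ([set w | conf M w = c] `|` [set w | conf M w \in s]) =
    (P [set w | conf M w = c] + P [set w | conf M w \in s])%E.
  apply: measureU; [exact: measurable_conf|exact: (measurable_event (mem s))|].
  apply/seteqP; split => // w [/= -> cs'].
  by rewrite cs' in cs.
by rewrite P_conf IH // big_cons.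
Qed.

Lemma P_event M (Q : pred {set {set vertex M}}) :
  P [set w | Q (conf M w)] = (Pr (edge_prob (mlev M) J) Q)%:E.
Proof.
have -> : [set w | Q (conf M w)] = [set w | conf M w \in enum Q].
  by apply/seteqP; split => w /=; rewrite mem_enum.
rewrite (P_conf_seq (enum_uniq Q)); congr EFin.
rewrite big_enum /= /Pr /Ex big_mkcond; apply: eq_bigr => c _.
by rewrite unfold_in; case: (Q c); rewrite ?mulr1 ?mulr0.
Qed.

Definition escape_prob m n : R := Pr (edge_prob (mlev n) J) (escapes (mlev n) m n).

Lemma P_escape_event M m n : (n <= M)%N ->
  P (escape_event m n) = (Pr (edge_prob (mlev M) J) (escapes (mlev M) m n))%:E.
Proof.
move=> nM; have -> : escape_event m n = [set w | escapes (mlev M) m n (conf M w)].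
  by apply/seteqP; split => w /=; rewrite (escape_event_conf _ _ nM).
exact: P_event.
Qed.

Lemma escape_probE M m n : (n <= M)%N -> escape_prob m n = Pr (edge_prob (mlev M) J) (escapes (mlev M) m n).
Proof. by move=> nM; apply: EFin_inj; rewrite -P_escape_event // -P_escape_event. Qed.

(** Continuity of the measure from below in [n], then from above in [m]. *)
Lemma theta_profile : exists f, exists th : R,
  theta R d L P U K = th%:E /\ profile escape_prob f th.
Proof.
have mH := measurable_escape_event.
have PH m n : P (escape_event m n) = (escape_prob m n)%:E by exact: P_escape_event.
pose F m := \bigcup_n escape_event m n.
have mF m : measurable (F m) by exact: bigcupT_measurable.
have thE : theta R d L P U K = P (\bigcap_m F m) by rewrite /theta infinite_clusterE.
have mI : measurable (\bigcap_m F m) by exact: bigcapT_measurable.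
have fin B : measurable B -> P B \is a fin_num.
  by move=> mB; rewrite fin_num_measure.
have cvgF m : escape_prob m @ \oo --> fine (P (F m)).
  have : P \o escape_event m @ \oo --> P (F m).
    apply: nondecreasing_cvg_mu; [exact: mH|exact: mF|].
    by move=> n n' nn'; apply/subsetPset; exact: escape_event_mono.
  rewrite -[X in _ --> X -> _](fineK (fin _ (mF m))) => /fine_cvgP[_].
  by have -> : escape_prob m = fine \o (P \o escape_event m) by apply: funext => n /=; rewrite PH.
have Fdec m m' : (m <= m')%N -> F m' `<=` F m.
  by move=> mm' w [n _ Hn]; exists n => //; exact: escape_event_antimono Hn.
have cvgT : (fun m => fine (P (F m))) @ \oo --> fine (P (\bigcap_m F m)).
  have : P \o F @ \oo --> P (\bigcap_m F m).
    apply: nonincreasing_cvg_mu; [by rewrite ltey_eq fin|exact: mF|exact: mI|].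
    by move=> n n' nn'; apply/subsetPset; exact: Fdec.
  by rewrite -[X in _ --> X -> _](fineK (fin _ mI)) => /fine_cvgP[_].
exists (fun m => fine (P (F m))), (fine (P (\bigcap_m F m))).
split; first by rewrite thE fineK // fin.
have conn_mono m : {homo escape_prob m : n n' / (n <= n')%N >-> n <= n'}.
  move=> n n' nn'; rewrite -lee_fin -!PH; apply: le_measure; rewrite ?inE //.
  exact: escape_event_mono.
have f_mono : {homo (fun m => fine (P (F m))) : m m' / (m' <= m)%N >-> m <= m'}.
  move=> m m' mm'; rewrite fine_le ?fin //; apply: le_measure; rewrite ?inE //.
  exact: Fdec.
split.
- move=> m n; apply/andP; split.
    by rewrite -lee_fin -PH measure_ge0.
  rewrite -lee_fin -PH fineK ?fin //; apply: le_measure; rewrite ?inE //.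
  by move=> w Hw; exists n.
- exact: conn_mono.
- move=> m e e0; have /cvgrPdist_lt/(_ e e0)[n _ hn] := cvgF m.
  by exists n; have := hn n (leqnn n); rewrite ltr_norml => /andP[_] /=; lra.
- move=> m m' mm'; rewrite f_mono //=.
  by rewrite -lee_fin fineK ?fin // probability_le1.
- split=> [m|e e0].
    rewrite fine_le ?fin //; apply: le_measure; rewrite ?inE //.
    by move=> w /(_ m I).
  have /cvgrPdist_lt/(_ e e0)[m _ hm] := cvgT.
  by exists m; have := hm m (leqnn m); rewrite ltr_norml => /andP[+ _] /=; lra.
Qed.

End Law.

End Bridge.

(** * A single kernel *)

(** Otherwise the gaps telescope and bound the partial sums of the harmonic series. *)
Lemma harmonic_gap (R : realType) (g : nat -> R) (a : R) k0 : 0 < a ->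
  (forall k, 0 <= g k <= 1) -> exists k, (k0 <= k)%N /\ g k - g k.+1 < a / k.+1%:R.
Proof.
move=> a0 g01; apply: contrapT => none.
have gap k : (k0 <= k)%N -> a * harmonic k <= g k - g k.+1.
  by move=> k0k; rewrite leNgt; apply/negP => lt; apply: none; exists k.
have bnd k : a * series harmonic (k0 + k)%N <= a * series harmonic k0 + g k0 - g (k0 + k)%N.
  elim: k => [|k IH]; first by rewrite addn0 addrK.
  rewrite addnS seriesSr mulrDr; have := gap (k0 + k)%N (leq_addr _ _); lra.
apply: (@dvg_harmonic R); apply: nondecreasing_is_cvgn.
  by apply: nondecreasing_series => k _ _; exact: harmonic_ge0.
exists (series harmonic k0 + 1 / a) => _ [n _ <-].
have [nk0|k0n] := leqP n k0.
  apply: (@le_trans _ _ (series harmonic k0)).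
    by apply: nondecreasing_series => // k _ _; exact: harmonic_ge0.
  by rewrite lerDl divr_ge0 // ltW.
rewrite -(ler_pM2l a0) mulrDr (_ : a * (1 / a) = 1); last by field; rewrite gt_eqF.
have := bnd (n - k0)%N; rewrite subnKC ?(ltnW k0n) //.
by have := g01 k0; have := g01 n; lra.
Qed.

(** [eta] is such that [(1 + eta) ^+ 2 - (1 - eta) ^+ 2 = 4 * eta = 1 / 64 / 32]. With the first
    term this makes [th ^+ 2 / 1024], that is [(th / 4) ^+ 2 / 64], and [l - th / 2] exceeds
    [th / 4]. *)
Lemma concentration_numerics (R : realType) (th fm l eta : R) :
    0 < th -> th <= fm -> fm < th + eta * th -> th * (1 - eta) <= l ->
    eta = 1 / 16 / 64 / 8 ->
  th ^+ 2 / 64 / 32 + fm ^+ 2 - l ^+ 2 <= 1 / 64 * (l - th / 2) ^+ 2.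
Proof.
move=> th0 thm hm hl etaE.
have h1 : fm ^+ 2 <= (th * (1 + eta)) ^+ 2.
  by rewrite ler_sqr ?nnegrE; move: hm; rewrite etaE; lra.
have h2 : (th * (1 - eta)) ^+ 2 <= l ^+ 2.
  by rewrite ler_sqr ?nnegrE; move: hl; rewrite etaE; lra.
have h3 : (th / 4) ^+ 2 <= (l - th / 2) ^+ 2.
  by rewrite ler_sqr ?nnegrE; move: hl; rewrite etaE; lra.
have e1 : (th * (1 + eta)) ^+ 2 - (th * (1 - eta)) ^+ 2 = th ^+ 2 / 64 / 32.
  by rewrite etaE; field.
have e2 : (th / 4) ^+ 2 = th ^+ 2 / 16 by field.
lra.
Qed.

Lemma sqrS_expand k : (k.+1 ^ 2 = k ^ 2 + (2 * k).+1)%N.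
Proof. by rewrite -!mulnn mulSn mulnS; lia. Qed.

Lemma leq_sqr k : (k <= k ^ 2)%N.
Proof. by rewrite -mulnn; case: k => // k; rewrite leq_pmulr. Qed.

Lemma orb_cases (a b c : bool) : c -> ~~ a || (~~ b || [&& a, b & c]).
Proof. by case: a; case: b. Qed.

Section Profile.
Variables (R : realType) (L' d : nat).
Hypotheses (L2 : (0 < L')%N) (d0 : (0 < d)%N).
Local Notation L := L'.+1.
Local Notation mlev M := (@mlev L' d M).
Let B : R := (L ^ d)%:R.

Lemma branching_ge2 : 2 <= B.
Proof.
rewrite ler_nat; apply: leq_trans (_ : L ^ 1 <= _)%N; first by rewrite expn1.
by rewrite leq_exp2l.
Qed.

Let B0 : 0 < B. Proof. by have := branching_ge2; lra. Qed.

Let BX n : 0 < B ^+ n. Proof. exact: exprn_gt0. Qed.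

Lemma card_LamR M n : (n <= M)%N -> #|Lam (mlev M) n|%:R = B ^+ n :> R.
Proof. by move=> nM; rewrite card_Lam // natrX. Qed.

Lemma nat_le_pow n : n%:R <= B ^+ n.
Proof.
rewrite -natrX ler_nat ltnW // ltn_expl // -(ltr_nat R).
by have := branching_ge2; rewrite /B; lra.
Qed.

Lemma pow_large (x : R) : exists n0, forall n, (n0 <= n)%N -> x <= B ^+ n.
Proof.
exists (Num.bound `|x|) => n nx; apply: le_trans (nat_le_pow n).
apply: le_trans (ler_norm x) (le_trans (ltW (archi_boundP (normr_ge0 x))) _).
by rewrite ler_nat.
Qed.

Section Kernel.
Variables (J : nat -> R) (f : nat -> R) (th : R).
Hypothesis J_ge0 : forall n, 0 <= J n.
Local Notation escape_prob := (escape_prob L' d J).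
Local Notation PrM M := (Pr (edge_prob (mlev M) J)).
Local Notation tail_mass M := (tail_mass (mlev M) J).
Hypothesis hprof : profile escape_prob f th.
Hypothesis hconn : forall M m n, (n <= M)%N -> escape_prob m n = PrM M (escapes (mlev M) m n).

Let e0 M := @mlev_eq0 L' d M.
Let eN M := @mlevN L' d M.
Let eD M := @mlevD L' d M.
Let eM M := @mlev_le L' d M.

Let f1 m : f m <= 1.
Proof. by have [_ _ _ /(_ m m (leqnn m))/andP[]] := hprof. Qed.

Let conn_le m n : escape_prob m n <= f m.
Proof. by have [/(_ m n)/andP[]] := hprof. Qed.

Let f_anti m m' : (m <= m')%N -> f m' <= f m.
Proof. by move=> mm'; have [_ _ _ /(_ m m' mm')/andP[]] := hprof. Qed.

Let th_le m : th <= f m.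
Proof. by have [_ _ _ _ []] := hprof. Qed.

Let conn_near m n0 e : 0 < e -> exists2 n, (n0 <= n)%N & f m - e < escape_prob m n.
Proof.
move=> epos; have [_ mono /(_ m e epos)[n hn] _ _] := hprof.
exists (maxn n0 n); first exact: leq_maxl.
exact: lt_le_trans hn (mono m _ _ (leq_maxr _ _)).
Qed.

Let f_near m0 e : 0 < e -> exists2 m, (m0 <= m)%N & f m < th + e.
Proof.
move=> epos; have [_ _ _ _ [_ /(_ e epos)[m hm]]] := hprof.
exists (maxn m0 m); first exact: leq_maxl.
exact: le_lt_trans (f_anti (leq_maxr _ _)) hm.
Qed.

(** The limit of [isolation] as [M] grows; the bound [q] on the clusters too large to be isolated
    has to be uniform in [M]. *)
Lemma isolation_profile n' n (A q : R) : (n' <= n)%N ->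
    (forall M, (n <= M)%N ->
       PrM M (fun c => A < #|clu (Lam (mlev M) n) c 0|%:R * tail_mass M n) <= q) ->
  expR (- A) * (escape_prob n' n - q) <= f n' - f n.
Proof.
move=> n'n hq; apply/ler_addgt0Pr => e epos.
have [M nM hM] := conn_near n n epos.
apply: (@le_trans _ _ (escape_prob n' M - escape_prob n M)); last first.
  by have := conn_le n' M; lra.
have n'nM : (n' <= n <= M)%N by rewrite n'n.
have := isolation (@e0 M) (@eN M) (@eD M) J_ge0 A n'nM (@eM M).
rewrite -!hconn //; apply: le_trans; rewrite ler_pM2l ?expR_gt0 // lerBlDr.
apply: le_trans (lerD (lexx _) (hq M nM)); rewrite (hconn _ nM).
apply: Pr_or_sub => [|c Hc]; first exact: edge_prob01.
by rewrite Hc leNgt; case: (A < _).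
Qed.

(** Mean cluster sizes are bounded, so isolation has a probability bounded below at every level; a
    positive [th] would make [f] drop by a fixed amount beyond every level, although it
    converges. *)
Lemma subcritical (S : R) : S < 1 -> (forall M, tail_mass M 0 <= S) -> th <= 0.
Proof.
move=> S1 hS; rewrite leNgt; apply/negP => th0.
have S0 : 0 <= S by apply: le_trans (hS 0%N); exact: tail_mass_ge0.
(* By Markov and the bound [(1 - S)^-1] on the mean, more than [s] points have probability at most
   [th / 4]. *)
pose s := 4 / (th * (1 - S)); pose A := s * S.
have s0 : 0 < s by rewrite divr_gt0 // mulr_gt0 // subr_gt0.
have tail n M : (n <= M)%N -> PrM M (fun c => A < #|clu (Lam (mlev M) n) c 0|%:R * tail_mass M n) <= th / 4.
  move=> nM; apply: le_trans (Markov (edge_prob01 _ J_ge0) (a := s)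
    (f := fun c => #|clu [set: 'M['I_L]_(M, d)]%SET c 0|%:R) s0 _ _) _.
  - by move=> c; exact: ler0n.
  - move=> c hA; have bS : tail_mass M n <= S.
      exact: le_trans (tail_mass_antimono (mlev M) J_ge0 (leq0n n)) (hS M).
    have cs : s <= #|clu (Lam (mlev M) n) c 0|%:R.
      rewrite leNgt; apply: contraTN hA => cs; rewrite -leNgt /A.
      by apply: ler_pM => //; [exact: tail_mass_ge0|exact: ltW].
    apply: le_trans cs _; rewrite ler_nat; apply: subset_leq_card.
    exact: clu_mono (finset.subsetT _) _.
  have bM : tail_mass M 0 < 1 by exact: le_lt_trans (hS M) S1.
  have := mean_cluster_le (@e0 M) (@eN M) J_ge0 bM => hmean.
  rewrite ler_pdivrMr //; apply: le_trans hmean _.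
  have -> : th / 4 * s = (1 - S)^-1.
    by rewrite /s; field; rewrite ?gt_eqF ?subr_gt0.
  by rewrite lef_pV2 ?posrE ?subr_gt0 // lerD2l lerN2.
have epos : 0 < expR (- A) * (th / 2) by rewrite mulr_gt0 ?expR_gt0 // divr_gt0.
have th4 : 0 < th / 4 by lra.
have [n' _ hn'] := f_near 0 epos.
have [n n'n hn] := conn_near n' n' th4.
have := isolation_profile n'n (tail n).
have h1 : expR (- A) * (th / 2) <= expR (- A) * (escape_prob n' n - th / 4).
  by rewrite ler_pM2l ?expR_gt0 //; have := th_le n'; lra.
by have := th_le n; lra.
Qed.

Lemma conn_tail m n (T : R) : (m <= n)%N -> (forall M, (n <= M)%N -> tail_mass M n <= T) ->
  f m <= escape_prob m n + B ^+ m * T.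
Proof.
move=> mn hT; apply/ler_addgt0Pr => e epos.
have [M nM hM] := conn_near m n epos.
have mnM : (m <= n <= M)%N by rewrite mn.
have := Pr_escapes_exit (@e0 M) (@eN M) (@eD M) J_ge0 mnM.
rewrite -!hconn // card_LamR ?(leq_trans mn) // => h.
have : B ^+ m * tail_mass M n <= B ^+ m * T by rewrite ler_pM2l // hT.
lra.
Qed.

(** Downward induction from [M]. The step amounts to [4 * ln n.+1 <= 3 * B * ln n], which follows
    from [2 <= B] and [(n + 1) ^ 2 <= n ^ 3], true from [n = 3] on. *)
Lemma log_tail_mass (C : R) k0 n M : 0 <= C ->
    (forall k, (k0 <= k)%N -> B ^+ (2 * k) * J k <= C * ln k%:R) ->
    (k0 <= n)%N -> (3 <= n <= M)%N ->
  tail_mass M n <= 3 * C * ln n%:R / B ^+ n.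
Proof.
move=> C0 hJ; elim: {n}(M - n)%N {-2}n (erefl (M - n)%N) => [|j IH] n Mn k0n /andP[n3 nM].
  have -> : n = M by lia.
  rewrite tail_mass_max; last exact: eM.
  rewrite divr_ge0 ?(ltW (BX _)) // mulr_ge0 ?mulr_ge0 // ln_ge0 // ler1n; lia.
have nM1 : (n.+1 <= M)%N by lia.
apply: le_trans (tail_mass_step _ J_ge0 n) _; rewrite card_LamR //.
have hn1 := hJ n.+1 (leqW k0n).
have {IH} hb : tail_mass M n.+1 <= 3 * C * ln n.+1%:R / B ^+ n.+1.
  by apply: IH; rewrite ?(leqW n3) //; lia.
apply: le_trans (lerD (lexx _) hb) _.
have {}hn1 : B ^+ n.+1 * J n.+1 <= C * ln n.+1%:R / B ^+ n.+1.
  by rewrite ler_pdivlMr // mulrAC -exprD addnn -mul2n.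
apply: le_trans (lerD hn1 (lexx _)) _.
have -> : C * ln n.+1%:R / B ^+ n.+1 + 3 * C * ln n.+1%:R / B ^+ n.+1 =
    4 * (C * ln n.+1%:R) / B / B ^+ n.
  by rewrite exprS; field; rewrite !gt_eqF.
rewrite ler_pM2r ?invr_gt0 // ler_pdivrMr //.
have ln0 : 0 <= ln n%:R :> R by rewrite ln_ge0 // ler1n; lia.
have hln : 2 * ln n.+1%:R <= 3 * ln n%:R :> R.
  rewrite !mulr_natl -!lnXn ?ltr0n //; last lia.
  by rewrite ler_ln ?posrE ?exprn_gt0 ?ltr0n -?natrX ?ler_nat //; [nia|lia].
have hC : 2 * (C * ln n.+1%:R) <= 3 * (C * ln n%:R).
  by rewrite mulrCA [leRHS]mulrCA ler_wpM2l.
have hB : C * ln n%:R * 2 <= C * ln n%:R * B.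
  by rewrite ler_wpM2l ?branching_ge2 // mulr_ge0.
lra.
Qed.

(** In [pair_bound m n / (s * B ^+ n)] only the term of independent exits survives as [n] grows, and
    it is at most [f m ^+ 2 / s < q]. *)
Lemma upper_tail_profile m (S s q : R) : 0 < s -> (forall M, tail_mass M 0 <= S) ->
    f m ^+ 2 < s * q ->
  exists n0, forall n M, (n0 <= n <= M)%N ->
    PrM M (fun c => s * B ^+ n < #|clu (Lam (mlev M) n) c 0|%:R) <= q.
Proof.
move=> s0 hS fq.
have S0 : 0 <= S by apply: le_trans (hS 0%N); exact: tail_mass_ge0.
pose E := B ^+ m + (B ^+ m) ^+ 2 * S.
have [n1 hn1] := pow_large (B ^+ m / s).
have [n2 hn2] := pow_large (E / (s * q - f m ^+ 2)).
exists (maxn m (maxn n1 n2)) => n M /andP[]; rewrite !geq_max => /and3P[mn n1n n2n] nM.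
have mM := leq_trans mn nM.
have sB : 0 < s * B ^+ n by rewrite mulr_gt0.
have ms : #|Lam (mlev M) m|%:R <= s * B ^+ n.
  by rewrite card_LamR // mulrC -ler_pdivrMr // hn1.
apply: le_trans (cluster_upper_tail (@e0 M) (@eN M) (@eD M) J_ge0 mn sB ms) _.
rewrite ler_pdivrMr // /pair_bound !card_LamR // -hconn //.
have h1 := hn2 n n2n; rewrite ler_pdivrMr ?subr_gt0 // in h1.
have h2 : (B ^+ m) ^+ 2 * tail_mass M 0 <= (B ^+ m) ^+ 2 * S.
  by rewrite ler_wpM2l // exprn_ge0 // ltW.
have h3 : B ^+ n * escape_prob m n ^+ 2 <= B ^+ n * f m ^+ 2.
  rewrite ler_pM2l // ler_sqr ?nnegrE ?conn_le //; last first.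
    by have [/(_ m n)/andP[]] := hprof; lra.
  by have [/(_ m n)/andP[? ?]] := hprof; lra.
rewrite /E in h1; lra.
Qed.

(* Isolation at the levels [k ^ 2]: were [th] positive, [f (k ^ 2)] would
   decrease by a multiple of the non-summable [k.+1^-1] at each step. *)
Lemma log_kernel (C S : R) k0 : 0 <= C ->
    (forall k, (k0 <= k)%N -> B ^+ (2 * k) * J k <= C * ln k%:R) ->
    (forall M, tail_mass M 0 <= S) -> 54 * th * C <= 1 -> th <= 0.
Proof.
move=> C0 hJ hS hC; rewrite leNgt; apply/negP => th0.
have th2 : 0 < th / 2 by lra.
have [m _ hm] := f_near 0 th2.
have s0 : 0 < 9 * th by lra.
(* Since [f m < 3 / 2 * th], the square is below [9 / 4 * th ^+ 2]. Clusters of more than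
   [9 * th * B ^+ n] points will thus have probability at most [th / 2]. *)
have fq : f m ^+ 2 < 9 * th * (th / 2).
  have := th_le m; nra.
have [n0 tail] := upper_tail_profile s0 hS fq.
pose T n : R := 3 * C * ln n%:R / B ^+ n.
have tail_massT n M : (k0 <= n)%N -> (3 <= n <= M)%N -> tail_mass M n <= T n.
  by move=> k0n nM; exact: log_tail_mass C0 hJ k0n nM.
have [k1 hk1] := pow_large (24 * C / th).
pose K := maxn (maxn n0 k0) (maxn 3 k1).
suff step k : (K <= k)%N -> th / 4 / k.+1%:R <= f (k ^ 2)%N - f (k.+1 ^ 2)%N.
  have th4 : 0 < th / 4 by lra.
  have g01 k : 0 <= f (k ^ 2)%N <= 1.
    by apply/andP; split; [have := th_le (k ^ 2); lra | exact: f1].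
  have [k [Kk]] := harmonic_gap K th4 g01.
  by rewrite ltNge step.
rewrite !geq_max => /and3P[/andP[n0k k0k] k3 k1k].
have kk2 : (k <= k ^ 2)%N by exact: leq_sqr.
have kk : (k ^ 2 <= k.+1 ^ 2)%N by rewrite leq_exp2r.
have kS : (k <= k.+1 ^ 2)%N by exact: leq_trans kk2 kk.
pose n := (k.+1 ^ 2)%N.
have k0n : (k0 <= n)%N := leq_trans k0k kS.
have n3 : (3 <= n)%N := leq_trans k3 kS.
pose A := 9 * th * B ^+ n * T n.
have lnn : ln n%:R = 2 * ln k.+1%:R :> R by rewrite natrX lnXn ?ltr0n // mulr_natl.
have lnk : 0 <= ln k.+1%:R :> R by rewrite ln_ge0 // ler1n.
have h1 : expR (- A) * (escape_prob (k ^ 2) n - th / 2) <= f (k ^ 2)%N - f n.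
  apply: isolation_profile => // M nM.
  apply: le_trans (tail n M _); last by rewrite (leq_trans n0k) //=.
  apply: Pr_sub => [|c hA]; first exact: edge_prob01.
  rewrite ltNge; apply: contraTN hA => cs; rewrite -leNgt /A.
  by apply: ler_pM => //; [exact: tail_mass_ge0|by apply: tail_massT; rewrite // n3].
(* The squares are sparse enough for an edge from [Lam (k ^ 2)] out of [Lam n] to be unlikely:
   [B ^+ (k ^ 2) * T n] is of order [ln k.+1 / B ^+ (2 * k).+1]. Yet [ln n] is only
   [2 * ln k.+1]. *)
have h2 : th - th / 4 <= escape_prob (k ^ 2) n.
  have hb M : (n <= M)%N -> tail_mass M n <= T n.
    by move=> nM; apply: tail_massT; rewrite // n3.
  have := conn_tail kk hb.
  have -> : B ^+ (k ^ 2) * T n = 6 * C * ln k.+1%:R / B ^+ (2 * k).+1.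
    rewrite /T lnn /n (_ : (k.+1 ^ 2 = k ^ 2 + (2 * k).+1)%N); last first.
      by exact: sqrS_expand.
    by rewrite exprD; move: (ln _) (BX (k ^ 2)) (BX (2 * k).+1) => *; field; rewrite !gt_eqF.
  have hk : ln k.+1%:R <= B ^+ k.
    apply: le_trans (nat_le_pow k).
    by rewrite -natr1 addrC; apply: le_ln1Dx; have := ler0n R k; lra.
  have hq : 6 * C * ln k.+1%:R / B ^+ (2 * k).+1 <= th / 4.
    rewrite ler_pdivrMr // exprS mul2n -addnn exprD.
    have h24 := hk1 k k1k; rewrite ler_pdivrMr // in h24.
    have hB := branching_ge2; have hBk := BX k.
    apply: (@le_trans _ _ (6 * C * B ^+ k)); first by rewrite ler_wpM2l // mulr_ge0.
    rewrite (_ : th / 4 * (B * (B ^+ k * B ^+ k)) = B * (th / 4 * B ^+ k) * B ^+ k); last by ring.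
    rewrite ler_pM2r //; nra.
  by have := th_le (k ^ 2); lra.
(* [A] is [9 * 3 * th * C * ln n], that is [54 * th * C * ln k.+1]; hence the constant [54]. *)
have h3 : k.+1%:R^-1 <= expR (- A).
  rewrite -[k.+1%:R in leLHS](@lnK R) ?posrE ?ltr0n // -expRN ler_expR lerN2.
  have -> : A = 27 * th * C * ln n%:R by rewrite /A /T; field; rewrite gt_eqF.
  rewrite lnn; nra.
apply: le_trans h1; rewrite mulrC; apply: ler_pM => //; lra.
Qed.

Lemma exp_neg_small (x k : R) : 0 < k -> k <= x -> expR (- x) <= k^-1.
Proof.
move=> k0 kx; rewrite expRN lef_pV2 ?posrE ?expR_gt0 //.
by have := expR_ge1Dx x; lra.
Qed.

Lemma shift_exists M n : (n < M)%N ->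
  exists2 r : 'M['I_L]_(M, d), r \in Lam (mlev M) n.+1 & r \notin Lam (mlev M) n.
Proof.
move=> nM; have : (1 < #|'rV['I_L]_d|)%N.
  by rewrite card_digits -(ltr_nat R); have := branching_ge2; rewrite /B; lra.
rewrite -cardsT => /card_gt1P[g [g' [_ _ gg']]].
exists (digit M n g - digit M n g'); last exact: digit_diff.
by apply: (LamB (@eN M) (@eD M)); exact: digit_in.
Qed.

(* At most levels the origin lies with probability about [th] in a cluster too
   large to be isolated; by the second moment bound the points of such clusters
   have density close to [th], and two neighbouring blocks of this kind merge. *)
Lemma giant_block (C S : R) n0 N : 0 < C -> 0 < th ->
    (forall n M, (n0 <= n <= M)%N -> tail_mass M n <= C * B ^+ n.+1 * J n.+1) ->
    (forall X : R, exists n1, forall n, (n1 <= n)%N -> X <= B ^+ (2 * n) * J n.+1) ->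
    (forall M, tail_mass M 0 <= S) ->
  exists n M0, (N <= n)%N /\ forall M, (M0 <= M)%N -> (n <= M)%N /\
    61 / 64 <= PrM M (fun c => [exists x in Lam (mlev M) n,
      th / (4 * B) * #|Lam (mlev M) n|%:R <= #|clu (Lam (mlev M) n) c x|%:R]).
Proof.
move=> C0 th0 hreg growth hS; have B2 := branching_ge2.
have [eta eta_gt0 etaE] : exists2 eta : R, 0 < eta & eta = 1 / 16 / 64 / 8.
  by exists (1 / 16 / 64 / 8) => //; lra.
(* Two blocks contain at most [2 * B ^+ n / h] large clusters; this [A] makes that number half of
   the exponent [J n.+1 * (mu ^+ 2 / 8)] of a cut. *)
pose A : R := 128 * C * B / th ^+ 2.
have A0 : 0 < A by rewrite /A divr_gt0 ?exprn_gt0 ?mulr_gt0.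
have eta0 : 0 < eta * th by rewrite mulr_gt0.
have [m _ hm] := f_near 0 eta0.
(* Isolation loses a factor [expR (- A)], so [f] must be this close to [th] and to its finite-volume
   values for the isolable clusters to have probability at most [eta * th / 2]. *)
pose e := expR (- A) * (eta * th / 4).
have epos : 0 < e by rewrite mulr_gt0 ?expR_gt0 // divr_gt0.
have [n' mn' hn'] := f_near m epos.
have eta2 : 0 < eta * th / 2 by rewrite divr_gt0.
have [n1 n'n1 hn1] := conn_near n' n' eta2.
pose E := B ^+ m + (B ^+ m) ^+ 2 * S.
have [n2 hn2] := pow_large (64 * 32 * E / th ^+ 2).
have [n3 hn3] := growth (64 * 64 / th ^+ 2).
pose n := maxn (maxn N n0) (maxn n1 (maxn n2 n3)).
have [Nn n0n] : (N <= n)%N /\ (n0 <= n)%N.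
  by split; rewrite leq_max leq_max leqnn ?orbT.
have [n1n n2n n3n] : [/\ (n1 <= n)%N, (n2 <= n)%N & (n3 <= n)%N].
  by split; rewrite /n !leq_max leqnn ?orbT.
have {}hn2 := hn2 n n2n; have {}hn3 := hn3 n n3n.
have n'n : (n' <= n)%N := leq_trans n'n1 n1n.
have mn : (m <= n)%N := leq_trans mn' n'n.
have hconn' : th - eta * th / 2 <= escape_prob n' n.
  have [_ mono _ _ _] := hprof; have := mono n' _ _ n1n; have := th_le n'; lra.
have th2 : 0 < th ^+ 2 by exact: exprn_gt0.
have J0 : 0 < J n.+1.
  by rewrite -(pmulr_rgt0 _ (BX (2 * n))) (lt_le_trans _ hn3) // divr_gt0 ?mulr_gt0.
(* [rho] bounds the tail mass by regularity, so [isolation] with exponent [A] covers the clusters of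
   at most [h] points. *)
pose rho := C * B ^+ n.+1 * J n.+1; pose h := A / rho.
have rho0 : 0 < rho by rewrite /rho !mulr_gt0.
have h0 : 0 < h by rewrite divr_gt0.
have [M0 nM0 hM0] := conn_near n n.+1 epos.
exists n.+1, M0; split; first exact: leqW.
move=> M M0M; have nM1 : (n.+1 <= M)%N := leq_trans nM0 M0M; split => //.
have nM : (n <= M)%N := ltnW nM1.
pose l := PrM M (large (mlev M) n m h 0).
have connM : f n - e < escape_prob n M.
  by have [_ mono _ _ _] := hprof; apply: lt_le_trans hM0 (mono n _ _ M0M).
have hl : th * (1 - eta) <= l.
  have n'nM : (n' <= n <= M)%N by rewrite n'n.
  have := isolation (@e0 M) (@eN M) (@eD M) J_ge0 A n'nM (@eM M).
  rewrite -!hconn //; set p := Pr _ _ => hiso.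
  have hp : p <= eta * th / 2.
    have : expR (- A) * p <= expR (- A) * (eta * th / 2).
      apply: le_trans hiso _; have := conn_le n' M; have := th_le n.
      by move: hn' connM; rewrite /e; lra.
    by rewrite ler_pM2l ?expR_gt0.
  have : escape_prob n' n <= p + l.
    rewrite (hconn _ nM); apply: Pr_or_sub => [|c Hc]; first exact: edge_prob01.
    rewrite Hc /=; case: (lerP _ A) => //= hA.
    rewrite /large leaves0 // (escapes_antimono mn' Hc) /=.
    rewrite ltNge; apply: contraTN hA => cs; rewrite -leNgt.
    apply: (@le_trans _ _ (h * rho)).
      by apply: ler_pM => //; [exact: tail_mass_ge0|apply: hreg; rewrite n0n].
    by rewrite /h divfK // gt_eqF.
  by lra.
pose mu := th / 2 * B ^+ n.
have few : PrM M (fun c => #|bigpts (Lam (mlev M) n) h c|%:R < mu) <= 1 / 64.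
  have d0' : 0 < l - th / 2 by move: hl; rewrite etaE; lra.
  have := few_large (@e0 M) (@eN M) (@eD M) J_ge0 mn d0' (erefl l).
  rewrite subKr card_LamR // => hfew; apply: le_trans (le_trans _ hfew) _.
    apply: Pr_sub => [|c]; first exact: edge_prob01.
    apply: le_lt_trans; rewrite -natr_sum ler_nat -sum1_card big_mkcond [leqRHS]big_mkcond /=.
    apply: leq_sum => x _; rewrite in_bigpts.
    case: (x \in _) => //=; rewrite /large.
    by case: (h < _); rewrite ?andbF // andbT leq_b1.
  rewrite ler_pdivrMr ?exprn_gt0 //.
  have hpair : pair_bound (mlev M) J m n / B ^+ n <= th ^+ 2 / 64 / 32 + f m ^+ 2.
    rewrite ler_pdivrMr // /pair_bound !card_LamR ?(leq_trans mn) // -hconn //.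
    rewrite ler_pdivrMr // in hn2.
    have h2 : (B ^+ m) ^+ 2 * tail_mass M 0 <= (B ^+ m) ^+ 2 * S.
      by rewrite ler_wpM2l // exprn_ge0 // ltW.
    have h3 : B ^+ n * escape_prob m n ^+ 2 <= B ^+ n * f m ^+ 2.
      have [/(_ m n)/andP[? ?] _ _ _ _] := hprof.
      by rewrite ler_pM2l // ler_sqr ?nnegrE //; lra.
    rewrite /E in hn2; lra.
  apply: le_trans (lerB hpair (lexx _)) _.
  exact: (concentration_numerics th0 (th_le m) hm hl etaE).
have [r rin rout] := shift_exists nM1.
have mu0 : 0 < mu by rewrite mulr_gt0 // divr_gt0.
have rlev : mlev M r = n.+1.
  apply/eqP; rewrite eqn_leq; move: rin rout; rewrite !finset.inE => -> /=.
  by rewrite -ltnNge.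
have dis : [disjoint Lam (mlev M) n & block (mlev M) n r]%B.
  by have := block_disjoint (@eN M) (@eD M) rout; rewrite block0.
have sub0 : Lam (mlev M) n \subset Lam (mlev M) n.+1 by exact: LamS.
have sub1 : block (mlev M) n r \subset Lam (mlev M) n.+1.
  by rewrite block_tr -(Lam_tr (@eN M) (@eD M) rin) imsetS // LamS.
have lev01 u v : u \in Lam (mlev M) n -> v \in block (mlev M) n r -> mlev M (u - v) = n.+1.
  by move=> un vr; rewrite (lev_block_diff (@eN M) (@eD M) rout un vr).
have hcut := unmerged_bound (@e0 M) (@eN M) J_ge0 h0 mu0 dis sub0 sub1 lev01.
have hexp : expR (#|Lam (mlev M) n|%:R / h + #|block (mlev M) n r|%:R / h -
    J n.+1 * (mu ^+ 2 / 8)) <= 64^-1.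
  rewrite card_block ?card_LamR //.
  have -> : B ^+ n / h + B ^+ n / h - J n.+1 * (mu ^+ 2 / 8) =
      - (B ^+ (2 * n) * J n.+1 * (th ^+ 2 / 64)).
    rewrite /h /A /rho /mu (exprS B n) mul2n -addnn exprD; field.
    by rewrite !gt_eqF // ?mulr_gt0.
  apply: exp_neg_small => //; rewrite -ler_pdivrMr ?divr_gt0 //.
  by apply: le_trans hn3; rewrite invf_div mulrA -natrM.
set good := PrM M _.
(* Three errors of at most [1 / 64]: too few points in large clusters, in either block, or no
   merging. In [Lam n.+1], [mu / 2] points are a density of [th / (4 * B)]. *)
suff : PrM M (fun c => ~~ [exists x in Lam (mlev M) n.+1, th / (4 * B) * #|Lam (mlev M) n.+1|%:R
    <= #|clu (Lam (mlev M) n.+1) c x|%:R]) <= 3 / 64.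
  by rewrite Pr_predC -/good; lra.
have few1 : PrM M (fun c => #|bigpts (block (mlev M) n r) h c|%:R < mu) <= 1 / 64.
  by rewrite Pr_bigpts_tr.
apply: (@le_trans _ _ (PrM M (fun c => #|bigpts (Lam (mlev M) n) h c|%:R < mu) +
    (PrM M (fun c => #|bigpts (block (mlev M) n r) h c|%:R < mu) + 64^-1))); last first.
  have -> : 3 / 64 = 1 / 64 + (1 / 64 + 64^-1) :> R by field.
  exact: (lerD few (lerD few1 (lexx _))).
have cut2 := le_trans hcut hexp.
apply: le_trans (lerD (lexx _) (lerD (lexx _) cut2)).
apply: le_trans (lerD (lexx _) (Pr_or (edge_prob01 _ J_ge0) _ _)).
apply: Pr_or_sub => [|c nogood]; first exact: edge_prob01.
rewrite !(ltNge _ mu); apply: orb_cases.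
have muE : th / (4 * B) * #|Lam (mlev M) n.+1|%:R = mu / 2.
  by rewrite card_LamR // /mu (exprS B n); field; rewrite gt_eqF.
have small x : x \in Lam (mlev M) n.+1 -> #|clu (Lam (mlev M) n.+1) c x|%:R < mu / 2.
  move=> xn; rewrite ltNge -muE; apply: contra nogood => hx; apply/existsP; exists x.
  by rewrite xn hx.
apply/forallP => x; have [xn|xn] := boolP (x \in Lam (mlev M) n.+1); first exact: small.
apply: le_lt_trans (small 0 (Lam0 (@e0 M) _)); rewrite ler_nat.
apply: (@leq_trans 1%N); last by apply/card_gt0P; exists 0; exact: clu_refl.
rewrite -(cards1 x); apply: subset_leq_card; apply: clu_closed_sub => [|u v].
  by rewrite finset.inE.
rewrite finset.in_set1 => /eqP ->; rewrite /adj => /andP[xn'].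
by rewrite xn' in xn.
Qed.

(** The growth of [J] bounds the probability of failure at step [n] by [B ^+ 2 / n.+1 ^ 2], below a
    multiple of the telescoping [1 / n - 1 / n.+1]. The potential loses at most [Q / n1 <= a / 4] in
    all and stays above the [a / 2] that each step requires. *)
Lemma renorm_percolates (a : R) n1 M : 0 < a <= 1 -> (0 < n1 <= M)%N ->
    (1 + 4 / (3 * a)) * B ^+ 2 / n1%:R <= a / 4 ->
    (forall n, (n1 <= n)%N -> 2 * ln n.+1%:R <= J n.+1 * (a / 16 * B ^+ n) ^+ 2) ->
    15 / 16 <= PrM M (fun c => [exists x in Lam (mlev M) n1,
      a * #|Lam (mlev M) n1|%:R <= #|clu (Lam (mlev M) n1) c x|%:R]) ->
  a / 4 <= PrM M (fun c => a / 4 * B ^+ M <= #|clu (Lam (mlev M) M) c 0|%:R).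
Proof.
move=> a01 /andP[n1_gt0 n1M] hQ hJ hbase; have /andP[a0 a1] := a01.
set Q := (1 + 4 / (3 * a)) * B ^+ 2 in hQ.
have c0 : 0 < 1 + 4 / (3 * a) by rewrite ltr_pwDl // divr_ge0 // mulr_ge0 // ltW.
have Q0 : 0 < Q by rewrite mulr_gt0 // exprn_gt0.
have n1R : 0 < n1%:R :> R by rewrite ltr0n.
have t0 : 0 < a / 16 by rewrite divr_gt0.
pose kap n : R := 3 / 4 * a - Q * (n1%:R^-1 - n%:R^-1).
have kap_ge n : (n1 <= n)%N -> a / 2 <= kap n.
  move=> n1n; rewrite /kap; have : 0 <= Q * n%:R^-1 by rewrite mulr_ge0 ?invr_ge0 // ltW.
  by rewrite mulrBr; lra.
have main n : (n1 <= n <= M)%N -> exists2 v, lower_density (mlev M) n v &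
    kap n <= potential (mlev M) J a v.
  elim: n => [|n IH]; first by rewrite leqn0 => /andP[/eqP n10]; rewrite n10 in n1_gt0.
  move=> /andP[]; rewrite leq_eqVlt => /orP[/eqP <- _|].
    have [v vd vp] := density_base (@e0 M) J_ge0 a01 hbase.
    by exists v => //; apply: le_trans vp; rewrite /kap subrr mulr0 subr0.
  rewrite ltnS => n1n nM.
  have [|v vd vp] := IH; first by rewrite n1n ltnW.
  have rep_in g := @digit_in L' d M n g.
  have rep_diff g g' := @digit_diff L' d M n g g' nM.
  have I2 : (1 < #|'rV['I_L]_d|)%N.
    by rewrite card_digits -(ltr_nat R); have := branching_ge2; rewrite /B; lra.
  have I0 := ltnW I2; have hcard := card_LamS L' d nM.
  have hd := glued_density (@e0 M) (@eN M) (@eD M) I0 rep_in rep_diff hcard t0 vd.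
  exists (glued (mlev M) (digit M n) n (a / 16) v) => //.
  have hk := kap_ge n n1n.
  have hpot := potential_glued (@e0 M) (@eN M) (@eD M) J_ge0 I0 rep_in rep_diff t0 vd
    I2 a0 erefl (le_trans hk vp).
  apply: le_trans hpot; have hf := Pr_fail (@e0 M) (@eN M) (@eD M) J_ge0 rep_in rep_diff t0 vd.
  set pf := Pr _ _ in hf *.
  have n0 : 0 < n%:R :> R by rewrite ltr0n (leq_trans n1_gt0).
  have {hf} pf_le : pf <= B ^+ 2 * (n%:R^-1 - n.+1%:R^-1).
    apply: le_trans hf _; rewrite card_digits card_LamR ?(ltnW nM) // -/B.
    rewrite ler_pM2l ?exprn_gt0 //.
    have hexp : expR (- (J n.+1 * (a / 16 * B ^+ n) ^+ 2)) <= n.+1%:R^-1 ^+ 2.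
      rewrite -[n.+1%:R in leRHS](@lnK R) ?posrE ?ltr0n // -expRN -expRM_natl ler_expR.
      by have := hJ n n1n; rewrite mulrN lerN2.
    apply: le_trans hexp _; rewrite -natr1.
    have -> : n%:R^-1 - (n%:R + 1)^-1 = (n%:R * (n%:R + 1))^-1 :> R.
      by field; rewrite !gt_eqF // ltr_wpDl // ltW.
    by rewrite exprVn lef_pV2 ?posrE ?exprn_gt0 ?mulr_gt0 //; nra.
  have hmul : (1 + 4 / (3 * a)) * pf <= Q * (n%:R^-1 - n.+1%:R^-1).
    by rewrite /Q -mulrA ler_pM2l.
  move: vp; rewrite /kap; move: (potential _ _ _ _) pf pf_le hmul => pot pf _.
  rewrite !mulrBr; move: (_ * pf) (Q / n1%:R) (Q / n%:R) (Q / n.+1%:R) => x1 x2 x3 x4.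
  by move=> hmul vp; lra.
have [|v vd vp] := main M; first by rewrite n1M leqnn.
have Ev : a / 2 <= Ex (edge_prob (mlev M) J) v.
  apply: le_trans (kap_ge M n1M) (le_trans vp _).
  rewrite /potential gerBl mulr_ge0 ?divr_ge0 ?mulr_ge0 ?(ltW a0) //.
  exact: Var_ge0.
have := density_origin (@e0 M) (@eN M) (@eD M) J_ge0 a0 vd Ev.
by rewrite card_LamR.
Qed.

(** A cluster of density [a] in [Lam M] does not fit into [Lam m] once [B ^+ m < a * B ^+ M]. *)
Lemma percolates_ge (a : R) M1 : 0 < a ->
    (forall M, (M1 <= M)%N ->
      a <= PrM M (fun c => a * B ^+ M <= #|clu (Lam (mlev M) M) c 0|%:R)) ->
  a <= th.
Proof.
move=> a0 hM; rewrite leNgt; apply/negP => tha.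
have gap : 0 < a - th by rewrite subr_gt0.
have [m _ hm] := f_near 0 gap.
have [n2 hn2] := pow_large (2 * B ^+ m / a).
pose M := maxn m (maxn M1 n2).
have mM : (m <= M)%N by rewrite leq_maxl.
have M1M : (M1 <= M)%N by rewrite /M !leq_max leqnn orbT.
have n2M : (n2 <= M)%N by rewrite /M !leq_max leqnn !orbT.
have := conn_le m M; rewrite (hconn m (leqnn M)).
suff : a <= PrM M (escapes (mlev M) m M) by lra.
apply: le_trans (hM M M1M) _; apply: Pr_sub => [|c hc]; first exact: edge_prob01.
apply: contraL hc => sub; rewrite -ltNge.
apply: (@le_lt_trans _ _ (B ^+ m)).
  by rewrite -(card_LamR mM) ler_nat; exact: subset_leq_card.
have := hn2 M n2M; rewrite ler_pdivrMr // mulrC; have := BX m; lra.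
Qed.

End Kernel.
End Profile.

(** * Families of kernels *)

Section LevelKernel.
Variables (R : realType) (L' d : nat).
Hypotheses (L2 : (0 < L')%N) (d0 : (0 < d)%N).
Local Notation L := L'.+1.
Local Notation mlev M := (@mlev L' d M).
Let B : R := (L ^ d)%:R.
Variable K : pt d -> pt d -> R.
Hypothesis Knn : kernel_nonneg R d L K.
Hypothesis Kiso : isometry_invariant R d L K.

Definition unit_pt k : pt d := fun i _ => (i == k) : nat.

(** The value is read off at one reference point per level. No edge has level [0], where the value
    [0] is a convention. *)
Definition level_kernel (k : nat) : R :=
  if k is k'.+1 then K (pt0 d) (unit_pt k') else 0.

Lemma inblock_unit n k : inblock d n (pt0 d) (unit_pt k) <-> (k < n)%N.
Proof.
split=> [h|kn i ni].
  rewrite ltnNge; apply/negP => nk.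
  by have := congr1 (fun g => g (Ordinal d0)) (h k nk); rewrite /pt0 /unit_pt eqxx.
by apply: funext => j; rewrite /pt0 /unit_pt gtn_eqF // (leq_trans kn).
Qed.

Lemma dexp_unit k : dexp d (pt0 d) (unit_pt k) = k.+1.
Proof.
have [h1 h2] := dexpP ((inblock_unit k.+1 k).2 (leqnn _)).
by apply/eqP; rewrite eqn_leq h2 /= ?inblock_unit //; apply/inblock_unit.
Qed.

Lemma is_edge_unit k : is_edge d L (pt0 d) (unit_pt k).
Proof.
split; first exact: pt0_HL.
split; last first.
  by move=> h; have : (k < 0)%N; [apply/(inblock_unit 0 k); rewrite -h|rewrite ltn0].
split=> [i j|].
  by rewrite /unit_pt; case: (i == k).
exists k.+1 => i j ki; by rewrite /unit_pt gtn_eqF.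
Qed.

Lemma level_kernel_ge0 k : 0 <= level_kernel k.
Proof. by case: k => [|k] //=; apply: Knn; exact: is_edge_unit. Qed.

Lemma HL_inblock x y : HL d L x -> HL d L y -> exists n, inblock d n x y.
Proof.
move=> [_ [N1 h1]] [_ [N2 h2]]; exists (maxn N1 N2) => i Ni; apply: funext => j.
by rewrite h1 ?h2 // (leq_trans _ Ni) // ?leq_maxl ?leq_maxr.
Qed.

Lemma dexp_gt0 x y : is_edge d L x y -> (0 < dexp d x y)%N.
Proof.
move=> [xL [yL xy]]; have [n xyn] := HL_inblock xL yL; have [h _] := dexpP xyn.
rewrite lt0n; apply/eqP => d0'; apply: xy; apply: funext => i; apply: h.
by rewrite d0'.
Qed.

Lemma level_kernelE x y : is_edge d L x y -> K x y = level_kernel (dexp d x y).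
Proof.
move=> xy; have := dexp_gt0 xy; case e : (dexp d x y) => [//|k] _ /=.
apply: Kiso => //; first exact: is_edge_unit.
by rewrite /hnorm e dexp_unit.
Qed.

Lemma tail_mass_le_sum0 M n (S : set (pt d)) :
    (forall v : 'M['I_L]_(M, d), (n < mlev M v)%N -> S (emb v)) ->
  ((tail_mass (mlev M) level_kernel n)%:E <= sum0 R d L K S)%E.
Proof.
move=> hS; apply: esum_ge.
pose s := map (@emb L' d M) (enum [set v | (n < mlev M v)%N]%SET).
have us : uniq s by rewrite map_inj_uniq ?enum_uniq //; exact: emb_inj.
have edge0 (v : 'M['I_L]_(M, d)) : v != 0 -> is_edge d L (pt0 d) (emb v).
  by move=> v0; rewrite -(emb0 L' d M); apply: is_edge_emb; rewrite eq_sym.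
have v0 (v : 'M['I_L]_(M, d)) : (n < mlev M v)%N -> v != 0.
  by move=> nv; rewrite -mlev_eq0 -lt0n; exact: leq_ltn_trans nv.
exists [set` s].
  split; first exact: finite_seq.
  move=> x /= /mapP[v]; rewrite mem_enum finset.inE => nv ->.
  have [_ [? ?]] := edge0 v (v0 v nv).
  by split => //; split; [apply/nesym|exact: hS].
rewrite -fsbig_seq // big_map big_enum /= sumEFin lee_fin /tail_mass.
rewrite (eq_bigl (fun v => v \in [set v | (n < mlev M v)%N]%SET)) => [|v]; last first.
  by rewrite finset.inE.
apply: ler_sum => v; rewrite finset.inE => nv; have e := edge0 v (v0 v nv).
by rewrite level_kernelE // -[pt0 d](emb0 L' d M) dexp_emb sub0r mlevN.
Qed.

Lemma sum0_shell_le n :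
  (sum0 R d L K (Defs.Lam d n.+1 `\` Defs.Lam d n) <=
   (B ^+ n.+1 * level_kernel n.+1)%:E)%E.
Proof.
apply: ge_ereal_sup => _ [A [fA AS] <-].
have [s sE] := (finite_seqP A).1 fA.
have {sE} sE : A = [set` undup s] by rewrite sE; apply/seteqP; split => x /=; rewrite mem_undup.
have memA x : x \in undup s -> HL d L x /\ Defs.Lam d n.+1 x /\ K (pt0 d) x = level_kernel n.+1.
  move=> xs; have /AS [xL [x0 [x1 xn]]] : A x by rewrite sE.
  have e : is_edge d L (pt0 d) x by split; [exact: pt0_HL|split => //; exact/nesym].
  split => //; split => //; rewrite level_kernelE //; congr level_kernel.
  have [h1 h2] := dexpP x1; apply/eqP; rewrite eqn_leq h2 //= ltnNge.
  by apply/negP => dn; apply: xn => i ni; apply: h1; exact: leq_trans dn ni.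
rewrite sE -fsbig_seq ?undup_uniq // big_seq.
rewrite (eq_bigr (fun=> (level_kernel n.+1)%:E)) => [|x /memA[_ [_ ->]]] //.
rewrite -big_seq sumEFin lee_fin big_const_seq count_predT iter_addr_0 -mulr_natl.
rewrite ler_wpM2r ?level_kernel_ge0 // /B -natrX ler_nat.
have -> : ((L ^ d) ^ n.+1)%N = #|'M['I_L]_(n.+1, d)|.
  by rewrite card_mx card_ord -expnM mulnC.
rewrite -(size_map (@proj L' d n.+1)).
have up : uniq (map (@proj L' d n.+1) (undup s)).
  rewrite map_inj_in_uniq ?undup_uniq // => x y /memA[xL [xn _]] /memA[yL [yn _]] pxy.
  by rewrite -(emb_proj xL xn) -(emb_proj yL yn) pxy.
by rewrite -(card_uniqP up); exact: max_card.
Qed.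

Lemma sum0_ge0 (S : set (pt d)) : (0 <= sum0 R d L K S)%E.
Proof.
apply: esum_ge0 => x [xL [x0 _]]; rewrite lee_fin; apply: Knn.
by split; [exact: pt0_HL|split => //; exact/nesym].
Qed.

Lemma integrable_tail_mass : Defs.integrable R d L K ->
  forall M, tail_mass (mlev M) level_kernel 0 <= fine (sum0 R d L K setT).
Proof.
move=> hint M; rewrite -lee_fin fineK; first exact: tail_mass_le_sum0.
by rewrite ge0_fin_numE // sum0_ge0.
Qed.

Lemma subcritical_tail_mass (S : R) : (sum0 R d L K setT < S%:E)%E ->
  exists2 S', S' < S & forall M, tail_mass (mlev M) level_kernel 0 <= S'.
Proof.
move=> hS; have hint := lt_trans hS (ltry S).
exists (fine (sum0 R d L K setT)); last exact: integrable_tail_mass.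
by rewrite -lte_fin fineK // ge0_fin_numE // sum0_ge0.
Qed.

Lemma regular_tail_mass : regular R d L K -> exists C n0, 0 < C /\
  forall n M, (n0 <= n <= M)%N ->
    tail_mass (mlev M) level_kernel n <= C * B ^+ n.+1 * level_kernel n.+1.
Proof.
move=> [C [n0 hreg]]; exists (Num.max C 1), n0; split; first by rewrite lt_max ltr01 orbT.
move=> n M /andP[n0n nM]; rewrite -lee_fin.
apply: (@le_trans _ _ (sum0 R d L K (~` Defs.Lam d n))).
  apply: tail_mass_le_sum0 => v nv /emb_Lam.
  by rewrite finset.inE leqNgt nv.
apply: le_trans (hreg n n0n) _.
have S0 := sum0_ge0 (Defs.Lam d n.+1 `\` Defs.Lam d n).
apply: (@le_trans _ _ ((Num.max C 1)%:E * sum0 R d L K (Defs.Lam d n.+1 `\` Defs.Lam d n))%E).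
  by apply: lee_wpmul2r => //; rewrite lee_fin le_max lexx.
rewrite -mulrA EFinM; apply: lee_wpmul2l; last exact: sum0_shell_le.
by rewrite lee_fin le_max ler01 orbT.
Qed.

End LevelKernel.

(** * Continuity in the parameter and growth along the levels *)

Section Family.
Variables (R : realType) (L' d : nat).
Hypotheses (L2 : (0 < L')%N) (d0 : (0 < d)%N).
Local Notation L := L'.+1.
Local Notation mlev M := (@mlev L' d M).
Let B : R := (L ^ d)%:R.
Let B_ge2 : 2 <= B. Proof. exact: branching_ge2. Qed.
Let BX n : 0 < B ^+ n.
Proof. by apply: exprn_gt0; have := B_ge2; lra. Qed.
Variable JJ : R -> pt d -> pt d -> R.
Hypothesis JJ_proper : proper_family R d L JJ.
Local Notation Jl l := (level_kernel (JJ l)).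

Let Jnn l : 0 <= l -> kernel_nonneg R d L (JJ l).
Proof. by have [h _ _ _ _] := JJ_proper; move=> /h[]. Qed.

Lemma sup_ratio_le l ls x y : 0 <= l -> 0 <= ls -> is_edge d L x y ->
    sup_ratio R d L JJ l ls \is a fin_num ->
  JJ l x y <= fine (sup_ratio R d L JJ l ls) * JJ ls x y.
Proof.
move=> l0 ls0 xy sfin.
have : (kratio R (JJ l x y) (JJ ls x y) <= sup_ratio R d L JJ l ls)%E.
  by apply: ereal_sup_ubound; exists (x, y).
rewrite -{1}(fineK sfin) /kratio; have := Jnn ls0 xy.
(* Where the denominator vanishes the ratio is [0] or infinite by convention; a finite supremum
   excludes the latter, so the numerator vanishes too. *)
case: eqP => [->|/eqP bn] b0.
  by case: eqP => [->|_]; rewrite ?mulr0 // leye_eq.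
by rewrite lee_fin ler_pdivrMr // lt0r bn.
Qed.

(** Equality may fail: as [0 / 0] counts as [0], the supremum is [0] for a kernel that vanishes on
    all edges. *)
Lemma sup_ratio_self ls : 0 < ls -> sup_ratio R d L JJ ls ls \is a fin_num ->
  fine (sup_ratio R d L JJ ls ls) <= 1.
Proof.
move=> ls0 sfin; rewrite -lee_fin fineK //; apply: ge_ereal_sup => _ [p _ <-].
rewrite /kratio; case: eqP => [_|/eqP b0]; first by rewrite lee_fin ler01.
by rewrite divff.
Qed.

Lemma kernel_close ls eta : 0 < ls -> 0 < eta -> exists2 del : R, 0 < del &
  forall l, `|ls - l| < del -> 0 < l -> forall x y, is_edge d L x y ->
    JJ ls x y <= (1 + eta) * JJ l x y /\ JJ l x y <= (1 + eta) * JJ ls x y.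
Proof.
move=> ls0 eta0; have [_ _ hcont _ _] := JJ_proper.
have [hfin /(_ ls ls0)[c1 c2]] := hcont ls ls0.
have [s1 s2] := hfin ls ls0.
have self := sup_ratio_self ls0 s1.
have /cvgrPdist_lt/(_ eta eta0) n1 := c1; have /cvgrPdist_lt/(_ eta eta0) n2 := c2.
have /= [del del0 hdel] := filterI n1 n2.
exists del => // l ldel l0 x y xy; have [f1 f2] := hfin l l0.
have [] := hdel l ldel; rewrite !ltr_norml => /andP[h1 _] /andP[h2 _].
split; [apply: le_trans (sup_ratio_le (ltW ls0) (ltW l0) xy f2) _ |
        apply: le_trans (sup_ratio_le (ltW l0) (ltW ls0) xy f1) _].
  by apply: ler_wpM2r; [exact: Jnn (ltW l0) _ _ xy|lra].
by apply: ler_wpM2r; [exact: Jnn (ltW ls0) _ _ xy|lra].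
Qed.

Lemma level_close ls eta : 0 < ls -> 0 < eta -> exists2 del : R, 0 < del &
  forall l, `|ls - l| < del -> 0 < l -> forall k,
    Jl ls k <= (1 + eta) * Jl l k /\ Jl l k <= (1 + eta) * Jl ls k.
Proof.
move=> ls0 eta0; have [del del0 h] := kernel_close ls0 eta0.
exists del => // l ldel l0 [|k] /=; first by rewrite mulr0.
by apply: h => //; exact: is_edge_unit.
Qed.

Lemma edge_prob_close M (J J' : nat -> R) (e : {set 'M['I_L]_(M, d)}) :
    (forall k, 0 <= J k) -> (forall k, 0 <= J' k) ->
  `|edge_prob (mlev M) J e - edge_prob (mlev M) J' e| <=
    `|J (diam (mlev M) e) - J' (diam (mlev M) e)|.
Proof.
move=> J0 J'0; rewrite /edge_prob; case: ifP => _; last by rewrite subrr normr0.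
have lip (a b : R) : 0 <= a -> a <= b -> expR (- a) - expR (- b) <= b - a.
  move=> a0 ab; have -> : - b = - a + - (b - a) by ring.
  rewrite expRD -[X in X - _]mulr1 -mulrBr.
  have := expR_ge1Dx (- (b - a)).
  have : expR (- a) <= 1 by rewrite expR_le1; lra.
  by have := expR_gt0 (- a); nra.
have := J0 (diam (mlev M) e); have := J'0 (diam (mlev M) e).
move: (J _) (J' _) => a b b0 a0.
have -> : 1 - expR (- a) - (1 - expR (- b)) = expR (- b) - expR (- a) by ring.
have [ab|/ltW ba] := lerP a b.
  rewrite distrC !ger0_norm ?subr_ge0 ?ler_expR ?lerN2 //.
  exact: lip.
by rewrite !ger0_norm ?subr_ge0 ?ler_expR ?lerN2 //; exact: lip.
Qed.

Lemma diam_inner M n (e : {set 'M['I_L]_(M, d)}) :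
  e \in inner (Lam (mlev M) n) -> (diam (mlev M) e <= n)%N.
Proof.
rewrite finset.inE => /andP[_ /fintype.subsetP en].
apply/bigmax_leqP => x xe; apply/bigmax_leqP => y ye.
by have := LamB (@mlevN L' d M) (@mlevD L' d M) (en x xe) (en y ye); rewrite finset.inE.
Qed.

Lemma card_inner M n : (n <= M)%N ->
  (#|inner (Lam (mlev M) n)| <= 2 ^ ((L ^ d) ^ n))%N.
Proof.
move=> nM; rewrite -(card_Lam L' d nM) -card_powerset; apply: subset_leq_card.
by apply/fintype.subsetP => e; rewrite !finset.inE => /andP[].
Qed.

(** The number of edges inside [Lam n] does not depend on [M], so one [del] serves all volumes. The
    comparison within a factor [2] covers every level because the renormalisation uses the kernel at
    [l] beyond level [n]. *)
Lemma law_close ls n eps : 0 < ls -> 0 < eps -> exists2 del : R, 0 < del &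
  forall l, `|ls - l| < del -> 0 < l -> (forall k, Jl ls k <= 2 * Jl l k) /\
    forall M (Q : pred {set {set 'M['I_L]_(M, d)}}), (n <= M)%N ->
      supported (inner (Lam (mlev M) n)) Q ->
      Pr (edge_prob (mlev M) (Jl ls)) Q <= Pr (edge_prob (mlev M) (Jl l)) Q + eps /\
      Pr (edge_prob (mlev M) (Jl l)) Q <= Pr (edge_prob (mlev M) (Jl ls)) Q + eps.
Proof.
move=> ls0 eps0.
have Js0 l : 0 < l -> forall k, 0 <= Jl l k.
  by move=> l0 k; exact: level_kernel_ge0 (Jnn (ltW l0)) k.
pose X := 1 + \sum_(k < n.+1) Jl ls k.
have JX k : (k <= n)%N -> Jl ls k <= X.
  move=> kn; rewrite /X (bigD1 (Ordinal (kn : (k < n.+1)%N))) //= addrCA lerDl.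
  by rewrite addr_ge0 // sumr_ge0 // => i _; exact: Js0.
have X1 : 1 <= X by rewrite lerDl sumr_ge0 // => i _; exact: Js0.
pose K := (2 ^ ((L ^ d) ^ n))%N.
(* The error factor of [Pr_perturb]: [K] bounds the number of edges inside [Lam n], and [X] the
   kernel at [ls] up to level [n]. *)
pose W : R := 2 ^+ K * (K%:R * (2 * X)).
have W0 : 0 < W by rewrite !mulr_gt0 ?exprn_gt0 ?ltr0n ?expn_gt0 //; lra.
pose eta := Num.min 1 (eps / W).
have eta0 : 0 < eta by rewrite lt_min ltr01 divr_gt0.
have eta1 : eta <= 1 by rewrite ge_min lexx.
have etaW : eta * W <= eps by rewrite -ler_pdivlMr // ge_min lexx orbT.
have [del del0 hdel] := level_close ls0 eta0.
exists del => // l ldel l0; have {}hdel := hdel l ldel l0; split=> [k|M Q nM QD].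
  have [h _] := hdel k; apply: le_trans h _.
  by rewrite ler_wpM2r ?Js0 //; lra.
have diff k : (k <= n)%N -> `|Jl ls k - Jl l k| <= 2 * eta * X.
  move=> kn; have [h1 h2] := hdel k; have := JX k kn; have := Js0 _ l0 k.
  have := Js0 _ ls0 k; rewrite ler_norml; move: (Jl ls k) (Jl l k) h1 h2 => a b h1 h2 a0 b0 aX.
  have : eta * a <= eta * X by rewrite ler_pM2l.
  have : eta * b <= eta * (2 * X) by rewrite ler_pM2l //; nra.
  by move=> *; apply/andP; split; nra.
have cardD := card_inner nM.
have err : 2 ^+ #|inner (Lam (mlev M) n)| * (#|inner (Lam (mlev M) n)|%:R * (2 * eta * X)) <= eps.
  apply: le_trans etaW.
  have -> : eta * W = 2 ^+ K * (K%:R * (2 * eta * X)) by rewrite /W; ring.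
  have t0 : 0 <= 2 * eta * X by rewrite !mulr_ge0 //; lra.
  have two1 : 1 <= 2 :> R by lra.
  apply: ler_pM; [exact: exprn_ge0|exact: mulr_ge0| |].
    exact: ler_weXn2l two1 _ _ cardD.
  by rewrite ler_wpM2r // ler_nat.
split; apply: le_trans (lerD (lexx _) err); apply: Pr_perturb => //.
- by move=> e; apply: edge_prob01; exact: Js0.
- by move=> e; apply: edge_prob01; exact: Js0.
- move=> e en; apply: le_trans (edge_prob_close _ (Js0 _ ls0) (Js0 _ l0)) _.
  by apply: diff; exact: diam_inner.
- by move=> e; apply: edge_prob01; exact: Js0.
- by move=> e; apply: edge_prob01; exact: Js0.
- move=> e en; apply: le_trans (edge_prob_close _ (Js0 _ l0) (Js0 _ ls0)) _.
  by rewrite distrC; apply: diff; exact: diam_inner.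
Qed.

Lemma fcrit_level k : fcrit R d (L ^ k)%:R = ln (k%:R * ln L%:R) / B ^+ (2 * k).
Proof.
rewrite /fcrit natrX lnXn ?ltr0n // mulr_natl mulrC; congr (_ / _).
by rewrite /B natrX -!exprM; congr (_ ^+ _); lia.
Qed.

(** [ln (k * ln L)] is the double logarithm of the length [L ^ k]; the finite-volume estimates are
    in terms of [ln k] instead. *)
Lemma lnln_bounds : exists k0, forall k, (k0 <= k)%N ->
  [/\ 1 <= ln k%:R :> R, ln k%:R / 2 <= ln (k%:R * ln L%:R) :> R &
      ln (k%:R * ln L%:R) <= 2 * ln k%:R :> R].
Proof.
pose c : R := ln L%:R.
have c0 : 0 < c by rewrite /c ln_gt0 // ltr1n.
exists (maxn (Num.bound (expR 1 : R)) (maxn (Num.bound c) (Num.bound (c ^- 2)))) => k.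
rewrite !geq_max => /and3P[k1 k2 k3].
have bnd (x : R) : 0 <= x -> (Num.bound x <= k)%N -> x <= k%:R.
  move=> x0 xk; apply: le_trans (ltW (archi_boundP x0)) _.
  by rewrite ler_nat.
have ek := bnd _ (expR_ge0 1) k1; have ck := bnd _ (ltW c0) k2.
have c2k : c ^- 2 <= k%:R by apply: bnd => //; rewrite invr_ge0 exprn_ge0 // ltW.
have kpos : 0 < k%:R :> R by apply: lt_le_trans ek; exact: expR_gt0.
rewrite -/c; split.
- by rewrite -[leLHS](@expRK R) ler_ln ?posrE ?expR_gt0.
- have : ln k%:R <= ln ((k%:R * c) ^+ 2) :> R.
    rewrite ler_ln ?posrE ?exprn_gt0 ?mulr_gt0 // exprMn expr2 -mulrA ler_pMr //.
    by rewrite -ler_pdivrMr ?exprn_gt0 // mul1r.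
  by rewrite lnXn ?mulr_gt0 // mulr2n; lra.
have : ln (k%:R * c) <= ln (k%:R ^+ 2) :> R.
  by rewrite ler_ln ?posrE ?exprn_gt0 ?mulr_gt0 // expr2 ler_pM2l.
by rewrite lnXn // [2 * _]mulr_natl.
Qed.

Lemma hnorm_unit k : hnorm d L (pt0 d) (@unit_pt d k) = (L ^ k.+1)%N.
Proof. by rewrite /hnorm dexp_unit. Qed.

(** The quotient on the right is left uncancelled, since the logarithm is only known to be nonzero
    for large [k]. *)
Lemma level_ratio l k :
  ratio_at R d L JJ l (pt0 d) (@unit_pt d k) * ln (k.+1%:R * ln L%:R) =
  B ^+ (2 * k.+1) * Jl l k.+1 * (ln (k.+1%:R * ln L%:R) / ln (k.+1%:R * ln L%:R)).
Proof.
rewrite /ratio_at hnorm_unit fcrit_level invf_div /=.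
by rewrite mulrC mulrCA !mulrA; congr (_ / _); rewrite mulrAC -!mulrA; ring.
Qed.

Lemma level_upper l (C : R) N : 0 <= C ->
    (forall x y, is_edge d L x y -> (N <= hnorm d L x y)%N -> ratio_at R d L JJ l x y <= C) ->
  exists k0, forall k, (k0 <= k)%N -> B ^+ (2 * k) * Jl l k <= 2 * C * ln k%:R.
Proof.
move=> C0 hC; have [k0 hk0] := lnln_bounds.
exists (maxn k0 N.+1) => -[|k]; rewrite geq_max ?ltn0 ?andbF // => /andP[k0k Nk].
have [h1 h2 h3] := hk0 _ k0k; have ln0 : 0 < ln (k.+1%:R * ln L%:R) :> R by lra.
have := hC _ _ (is_edge_unit L2 d0 k); rewrite hnorm_unit.
have Nk' : (N <= L ^ k.+1)%N by apply: leq_trans (ltnW (ltn_expl k.+1 _)); lia.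
move=> /(_ Nk').
rewrite -(ler_pM2r ln0) level_ratio divff ?gt_eqF // mulr1; nra.
Qed.

Lemma level_lower l (C : R) N : 0 <= C ->
    (forall x y, is_edge d L x y -> (N <= hnorm d L x y)%N -> C <= ratio_at R d L JJ l x y) ->
  exists k0, forall k, (k0 <= k)%N ->
    1 <= ln k%:R :> R /\ C / 2 * ln k%:R <= B ^+ (2 * k) * Jl l k.
Proof.
move=> C0 hC; have [k0 hk0] := lnln_bounds.
exists (maxn k0 N.+1) => -[|k]; rewrite geq_max ?ltn0 ?andbF // => /andP[k0k Nk].
have [h1 h2 h3] := hk0 _ k0k; have ln0 : 0 < ln (k.+1%:R * ln L%:R) :> R by lra.
split => //; have := hC _ _ (is_edge_unit L2 d0 k); rewrite hnorm_unit.
have Nk' : (N <= L ^ k.+1)%N by apply: leq_trans (ltnW (ltn_expl k.+1 _)); lia.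
move=> /(_ Nk').
rewrite -(ler_pM2r ln0) level_ratio divff ?gt_eqF // mulr1; nra.
Qed.

End Family.

(** * The critical value and the three regimes *)

Section PhaseTransition.
Variables (R : realType) (L' d : nat).
Hypotheses (L2 : (0 < L')%N) (d0 : (0 < d)%N).
Local Notation L := L'.+1.
Local Notation mlev M := (@mlev L' d M).
Let B : R := (L ^ d)%:R.
Let B_ge2 : 2 <= B. Proof. exact: branching_ge2. Qed.
Let BX n : 0 < B ^+ n.
Proof. by apply: exprn_gt0; have := B_ge2; lra. Qed.
Variable JJ : R -> pt d -> pt d -> R.
Hypothesis JJ_proper : proper_family R d L JJ.
Variables (dT : measure_display) (Omega : measurableType dT).
Variables (P : probability Omega R) (U : pt d -> pt d -> Omega -> R).
Hypothesis hU : iid_uniform_edges R d L P U.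
Local Notation Jl l := (level_kernel (JJ l)).
Local Notation theta l := (theta R d L P U (JJ l)).
Local Notation PrM l M := (Pr (edge_prob (mlev M) (Jl l))).
Local Notation escape_prob l := (escape_prob L' d (Jl l)).

Let Jnn l : 0 <= l -> kernel_nonneg R d L (JJ l).
Proof. by have [h _ _ _ _] := JJ_proper; move=> /h[]. Qed.

Let Jsym l : 0 <= l -> kernel_sym R d L (JJ l).
Proof. by have [h _ _ _ _] := JJ_proper; move=> /h[]. Qed.

Let J_ge0 l k : 0 <= l -> 0 <= Jl l k.
Proof. by move=> l0; exact: level_kernel_ge0 (Jnn l0) k. Qed.

Let Jiso l : 0 < l -> isometry_invariant R d L (JJ l).
Proof. by have [_ _ _ _ h] := JJ_proper; move=> /h[]. Qed.

Let KJ l : 0 < l -> forall x y, is_edge d L x y -> JJ l x y = Jl l (dexp d x y).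
Proof. by move=> l0 x y xy; exact: level_kernelE (Jiso l0) _ _ xy. Qed.

Lemma theta_profile_family l : 0 < l -> exists f, exists th : R,
  [/\ theta l = th%:E, profile (escape_prob l) f th &
   forall M m n, (n <= M)%N -> escape_prob l m n = PrM l M (escapes (mlev M) m n)].
Proof.
move=> l0; have h0 k : 0 <= Jl l k by apply: J_ge0; exact: ltW.
have [f [th [h1 h2]]] := theta_profile hU (Jsym (ltW l0)) h0 (KJ l0).
exists f, th; split => // M m n nM.
exact: (escape_probE hU (Jsym (ltW l0)) h0 (KJ l0)).
Qed.

Lemma theta_mono l l' : 0 <= l -> l <= l' -> (theta l <= theta l')%E.
Proof.
move=> l0 ll'; have l'0 := le_trans l0 ll'.
have ml := measurable_infinite_cluster hU (Jsym l0).
have ml' := measurable_infinite_cluster hU (Jsym l'0).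
apply: le_measure; [by rewrite inE|by rewrite inE|].
move=> w /=; apply: contra_not; apply: sub_finite_set => y [m [z [z0 zm ze]]].
exists m, z; split => // k km; have [e o] := ze k km; split => //.
apply: le_trans o _; rewrite lerD2l lerN2 ler_expR lerN2.
by have [_ mono _ _ _] := JJ_proper; exact: mono.
Qed.

Lemma level_mono l l' k : 0 <= l -> l <= l' -> Jl l k <= Jl l' k.
Proof.
move=> l0 ll'; case: k => [|k] //=; have [_ mono _ _ _] := JJ_proper.
by apply: mono => //; exact: is_edge_unit.
Qed.

Lemma theta_ge0 l : (0 <= theta l)%E. Proof. exact: measure_ge0. Qed.

Lemma theta_small : exists2 del : R, 0 < del & forall l, 0 <= l -> l < del -> theta l = 0%E.
Proof.
have [_ _ _ [del del0 hdel] _] := JJ_proper.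
exists del => //.
have pos l : 0 < l -> l < del -> theta l = 0%E.
  move=> l0 ldel; have [f [th [thE hprof hconn]]] := theta_profile_family l0.
  have [S S1 hS] := subcritical_tail_mass L2 d0 (Jnn (ltW l0)) (Jiso l0) (hdel l (ltW l0) ldel).
  have h0 k : 0 <= Jl l k by apply: J_ge0; exact: ltW.
  have := subcritical h0 hprof hconn S1 hS => th0.
  by apply/eqP; rewrite eq_le theta_ge0 andbT thE lee_fin.
(* Isometry invariance is given for positive parameters only; [l = 0] is dominated by [del / 2]. *)
move=> l; rewrite le_eqVlt => /orP[/eqP <- _|]; last exact: pos.
apply/eqP; rewrite eq_le theta_ge0 andbT.
rewrite -(pos (del / 2)); [apply: theta_mono|..]; lra.
Qed.

Local Notation lc := (lambda_c R d L P U JJ).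

Lemma lambda_c_gt0 : (0 < lc)%E.
Proof.
have [del del0 h] := theta_small.
apply: (@lt_le_trans _ _ del%:E); first by rewrite lte_fin.
apply: le_ereal_inf_tmp => _ [l [l0 tl] <-]; rewrite lee_fin leNgt; apply/negP => ldel.
by rewrite h ?ltxx in tl.
Qed.

Lemma theta_below l : 0 <= l -> (l%:E < lc)%E -> theta l = 0%E.
Proof.
move=> l0 llc; apply/eqP; rewrite eq_le theta_ge0 andbT leNgt; apply/negP => tl.
have : (lc <= l%:E)%E by apply: ereal_inf_lbound; exists l.
by rewrite leNgt llc.
Qed.

Lemma theta_above l : (lc < l%:E)%E -> (0 < theta l)%E.
Proof.
move=> /ereal_inf_lt[_ [l' [l'0 tl'] <-]]; rewrite lte_fin => ll'.
by apply: lt_le_trans tl' _; apply: theta_mono => //; exact: ltW.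
Qed.

Lemma lambda_c_fin : (lc < +oo)%E -> exists2 l : R, 0 < l & lc = l%:E.
Proof.
move=> lcfin; have l0 := lambda_c_gt0.
have : lc \is a fin_num by rewrite ge0_fin_numE ?ltW.
by move=> /fineK lcE; exists (fine lc); rewrite // -lte_fin lcE.
Qed.

Lemma fam_ll_infinite : fam_ll R d L JJ -> lc = +oo%E.
Proof.
move=> hll; apply/eqP; rewrite eq_le leey /=.
suff h0 l : 0 < l -> theta l = 0%E.
  apply: le_ereal_inf_tmp => _ [l [l0 tl] <-]; exfalso.
  have : theta l = 0%E.
    apply/eqP; rewrite eq_le theta_ge0 andbT -(h0 (l + 1)); last lra.
    by apply: theta_mono => //; lra.
  by move=> h; rewrite h ltxx in tl.
move=> l0; have [f [th [thE hprof hconn]]] := theta_profile_family l0.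
have J0 k : 0 <= Jl l k by apply: J_ge0; exact: ltW.
have [_ _ _ _ /(_ l l0)[_ hint _]] := JJ_proper.
have hS := integrable_tail_mass L2 d0 (Jnn (ltW l0)) (Jiso l0) hint.
(* [level_upper] doubles the constant, and [54 * th * (2 / 108) <= 1] because [th <= 1]. *)
have eps0 : 0 < (1 / 108 : R) by lra.
have [N hN] := hll l l0 _ eps0.
have [k0 hk0] := level_upper L2 d0 (ltW eps0) hN.
have th1 : th <= 1.
  by have [_ _ _ /(_ 0 0 (leqnn 0))/andP[_ h1] [/(_ 0%N) h2 _]] := hprof; lra.
have C0 : 0 <= 2 * (1 / 108) :> R by lra.
have hC : 54 * th * (2 * (1 / 108)) <= 1 by lra.
have := log_kernel L2 d0 J0 hprof hconn C0 hk0 hS hC => th0.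
by apply/eqP; rewrite eq_le theta_ge0 andbT thE lee_fin.
Qed.

Lemma escapes_supported M m n : supported (inner (Lam (mlev M) n)) (escapes (mlev M) m n).
Proof. by move=> c c' cc'; rewrite /escapes (clu_supported 0 cc'). Qed.

(** If [theta] vanished at [l0], some [f m] would be below [g / 2]. Moving to a slightly larger [l]
    costs [g / 4] for the finite-volume law and [g / 4] for edges out of [Lam n], so [theta] at [l]
    would be below [g], a value that [log_kernel] excludes when it is positive. *)
Lemma fam_approx_jump (l0 : R) : 0 < l0 -> lc = l0%:E -> fam_approx R d L JJ ->
  (0 < theta l0)%E.
Proof.
move=> l0_gt0 lcE happ; have l1_gt0 : 0 < l0 + 1 by lra.
have [c [C [c0 [N hN]]]] := happ _ l1_gt0.
pose C2 := 2 * Num.max C 1.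
have C2_ge0 : 0 <= C2 by rewrite mulr_ge0 // le_max ler01 orbT.
have C2_gt0 : 0 < C2 by rewrite mulr_gt0 // lt_max ltr01 orbT.
have C'0 : 0 <= Num.max C 1 by rewrite le_max ler01 orbT.
have [|k0 hk0] := @level_upper R L' d L2 d0 JJ (l0 + 1) _ N C'0.
  by move=> x y xy Nxy; have /andP[_ h] := hN x y xy Nxy; rewrite le_max h.
(* By monotonicity the bound at [l0 + 1] serves all smaller parameters, which keeps [g] independent
   of [l]. *)
have {hk0} hJ l k : 0 < l -> l <= l0 + 1 -> (k0 <= k)%N ->
    B ^+ (2 * k) * Jl l k <= C2 * ln k%:R.
  move=> lpos ll1 k0k; apply: le_trans (hk0 k k0k).
  by rewrite ler_pM2l //; apply: level_mono => //; exact: ltW.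
rewrite lt_neqAle theta_ge0 andbT; apply/negP => /eqP thlc.
pose g := (54 * C2)^-1.
have g0 : 0 < g by rewrite invr_gt0 mulr_gt0.
have [f [th [thE hprof hconn]]] := theta_profile_family l0_gt0.
have {thE thlc} th0 : th = 0 by apply: EFin_inj; rewrite -thE -thlc.
have g2 : 0 < g / 2 by lra.
have [m hm] : exists m, f m < th + g / 2 by have [_ _ _ _ [_ h]] := hprof; exact: h.
have [j0 hj0] := pow_large L2 d0 (24 * C2 * B ^+ m / g).
(* With [n = 2 j], one factor [B ^+ j] of [B ^+ n] absorbs [ln n] and the other absorbs [B ^+ m] and
   the constants. *)
pose j := maxn (maxn m k0) (maxn 3 j0); pose n := (j + j)%N.
have [mj k0j] : (m <= j)%N /\ (k0 <= j)%N.
  by split; rewrite leq_max leq_max leqnn ?orbT.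
have [j3 j0j] : (3 <= j)%N /\ (j0 <= j)%N.
  by split; rewrite leq_max [X in _ || X]leq_max leqnn ?orbT.
have jn : (j <= n)%N by exact: leq_addr.
have g4 : 0 < g / 4 by lra.
have [del del0 hdel] := law_close L2 d0 JJ_proper n l0_gt0 g4.
pose l := l0 + Num.min 1 (del / 2).
have [min0 min1 mindel] : [/\ 0 < Num.min 1 (del / 2), Num.min 1 (del / 2) <= 1
    & Num.min 1 (del / 2) < del].
  split; [by rewrite lt_min ltr01 divr_gt0|by rewrite ge_min lexx|].
  by rewrite gt_min; apply/orP; right; lra.
have l_gt0 : 0 < l by rewrite /l; lra.
have ldel : `|l0 - l| < del by rewrite distrC /l addrAC subrr add0r gtr0_norm.
have [_ /(_ n _ (leqnn n) (@escapes_supported n m n))[_ close]] := hdel l ldel l_gt0.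
have ll1 : l <= l0 + 1 by rewrite /l; lra.
have [f' [th' [thE' hprof' hconn']]] := theta_profile_family l_gt0.
have th'0 : 0 < th'.
  by rewrite -lte_fin -thE'; apply: theta_above; rewrite lcE lte_fin /l; lra.
have J0 k : 0 <= Jl l k by apply: J_ge0; exact: ltW.
have hJl k : (k0 <= k)%N -> B ^+ (2 * k) * Jl l k <= C2 * ln k%:R by exact: hJ.
have [_ _ _ _ /(_ l l_gt0)[_ hint _]] := JJ_proper.
have hS := integrable_tail_mass L2 d0 (Jnn (ltW l_gt0)) (Jiso l_gt0) hint.
have gth : g < th'.
  rewrite ltNge; apply/negP => thg.
  suff : th' <= 0 by lra.
  apply: (log_kernel L2 d0 J0 hprof' hconn' C2_ge0 hJl hS).
  have C54 : 0 < 54 * C2 by rewrite mulr_gt0.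
  by move: thg; rewrite -(ler_pM2l C54) divff ?gt_eqF //; lra.
have hT M : (n <= M)%N -> tail_mass (mlev M) (Jl l) n <= 3 * C2 * ln n%:R / B ^+ n.
  move=> nM; apply: (log_tail_mass L2 d0 J0 C2_ge0 hJl); first exact: leq_trans jn.
  by rewrite (leq_trans j3).
have htail := conn_tail L2 d0 J0 hprof' hconn' (leq_trans mj jn) hT.
have hconn0 := hconn n m n (leqnn n); rewrite -hconn -?hconn' // in close.
have small : B ^+ m * (3 * C2 * ln n%:R / B ^+ n) <= g / 4.
  have hj := hj0 j j0j; rewrite ler_pdivrMr // in hj.
  have lnn : ln n%:R <= 2 * B ^+ j.
    have -> : n%:R = 1 + (n%:R - 1) :> R by ring.
    apply: (@le_trans _ _ (n%:R - 1)).
      apply: le_ln1Dx; suff : 0 < n%:R :> R by lra.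
      by rewrite ltr0n (leq_trans _ jn) // (leq_trans _ j3).
    have := @nat_le_pow R L' d L2 d0 j; rewrite /n natrD -/B; lra.
  rewrite mulrA ler_pdivrMr // exprD.
  apply: (@le_trans _ _ (B ^+ m * (3 * C2 * (2 * B ^+ j)))).
    by rewrite ler_pM2l // ler_wpM2l // mulr_ge0.
  have -> : B ^+ m * (3 * C2 * (2 * B ^+ j)) = 24 * C2 * B ^+ m / 4 * B ^+ j by field.
  have -> : g / 4 * (B ^+ j * B ^+ j) = B ^+ j * g / 4 * B ^+ j by field.
  by rewrite ler_pM2r // ler_pM2r // invr_gt0.
have [/(_ m n)/andP[_ h1] _ _ _ _] := hprof.
have [_ _ _ _ [/(_ m) h2 _]] := hprof'.
lra.
Qed.

Lemma fam_gg_continuous (l0 : R) : 0 < l0 -> lc = l0%:E -> fam_gg R d L JJ ->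
  theta l0 = 0%E.
Proof.
move=> l0_gt0 lcE hgg.
have [f [th [thE hprof hconn]]] := theta_profile_family l0_gt0.
apply/eqP; rewrite eq_le theta_ge0 andbT thE lee_fin leNgt; apply/negP => th0.
have B2 := B_ge2.
have J0 l : 0 < l -> forall k, 0 <= Jl l k by move=> /ltW l0' k; exact: J_ge0.
have [_ _ _ _ /(_ l0 l0_gt0)[_ hint hreg]] := JJ_proper.
have hS := integrable_tail_mass L2 d0 (Jnn (ltW l0_gt0)) (Jiso l0_gt0) hint.
have [C [n0 [C0 {}hreg]]] := regular_tail_mass L2 d0 (Jnn (ltW l0_gt0)) (Jiso l0_gt0) hreg.
have growth (X : R) : 0 <= X -> exists n1, forall n, (n1 <= n)%N ->
    X * ln n.+1%:R <= B ^+ (2 * n) * Jl l0 n.+1 /\ 1 <= ln n.+1%:R :> R.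
  (* [level_lower] halves the constant, and [B ^+ 2] accounts for the shift from [B ^+ (2 * n.+1)]
     to [B ^+ (2 * n)]. *)
  move=> X0; pose C' := 2 * (X * B ^+ 2).
  have C'0 : 0 <= C' by rewrite !mulr_ge0 ?exprn_ge0 //; lra.
  have [N hN] := hgg l0 l0_gt0 C'.
  have [k0 hk0] := level_lower L2 d0 C'0 hN.
  exists k0 => n k0n; have [h1 h2] := hk0 n.+1 (leqW k0n); split => //.
  by rewrite mulnS exprD /C' in h2; rewrite -(ler_pM2l (BX 2)); lra.
have growth' (X : R) : exists n1, forall n, (n1 <= n)%N -> X <= B ^+ (2 * n) * Jl l0 n.+1.
  have [n1 hn1] := growth `|X| (normr_ge0 X); exists n1 => n n1n.
  have [h1 h2] := hn1 n n1n; apply: le_trans h1; apply: le_trans (ler_norm X) _.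
  by rewrite ler_peMr.
have th1 : th <= 1.
  by have [_ _ _ /(_ 0 0 (leqnn 0))/andP[_ h1] [/(_ 0%N) h2 _]] := hprof; lra.
pose a := th / (4 * B).
have B0 : 0 < 4 * B by lra.
have a0 : 0 < a by rewrite divr_gt0.
have a1 : a <= 1 by rewrite ler_pdivrMr //; lra.
pose Q := (1 + 4 / (3 * a)) * B ^+ 2.
(* The renormalisation needs [2 * ln n.+1 <= J n.+1 * (a / 16 * B ^+ n) ^+ 2] at some [l < l0],
   where [J] may have been halved. *)
pose X := 4 / (a / 16) ^+ 2.
have X0 : 0 <= X by rewrite divr_ge0 ?exprn_ge0 //; lra.
have [n1 hn1] := growth X X0.
pose N := maxn n1 (Num.bound `|4 * Q / a|).+1.
have [n [M0 [Nn hbase]]] := giant_block L2 d0 (J0 l0 l0_gt0) hprof hconn N C0 th0 hreg growth' hS.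
have [n1n Nb] : (n1 <= n)%N /\ ((Num.bound `|4 * Q / a|).+1 <= n)%N.
  by split; apply: leq_trans Nn; rewrite ?leq_maxl ?leq_maxr.
(* [61 / 64 - 1 / 64] is the [15 / 16] from which the renormalisation starts. *)
have eps0 : 0 < 1 / 64 :> R by lra.
have [del del0 hdel] := law_close L2 d0 JJ_proper n l0_gt0 eps0.
pose r := Num.min l0 del / 2.
have [r0 rl0 rdel] : [/\ 0 < r, r < l0 & r < del].
  have : 0 < Num.min l0 del by rewrite lt_min l0_gt0.
  have : Num.min l0 del <= l0 by rewrite ge_min lexx.
  have : Num.min l0 del <= del by rewrite ge_min lexx orbT.
  by rewrite /r => *; split; lra.
pose l := l0 - r.
have l_gt0 : 0 < l by rewrite /l; lra.
have ldel : `|l0 - l| < del by rewrite /l subKr gtr0_norm.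
have [half close] := hdel l ldel l_gt0.
have [f' [th' [thE' hprof' hconn']]] := theta_profile_family l_gt0.
have th'0 : th' = 0.
  by apply: EFin_inj; rewrite -thE'; apply: theta_below; rewrite ?ltW // lcE lte_fin /l; lra.
suff : a / 4 <= th' by rewrite th'0; lra.
have Jl0 k : 0 <= Jl l k by exact: J0.
have a4 : 0 < a / 4 by rewrite divr_gt0.
apply: (percolates_ge L2 d0 Jl0 hprof' hconn' (M1 := maxn n M0)) => // M.
rewrite geq_max => /andP[nM M0M].
apply: (renorm_percolates L2 d0 Jl0 (n1 := n)); rewrite ?a0 ?a1 ?nM ?andbT ?(leq_trans _ Nb) //.
- have npos : 0 < n%:R :> R by rewrite ltr0n (leq_trans _ Nb).
  rewrite -/Q ler_pdivrMr // mulrC.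
  have h : 4 * Q / a <= n%:R.
    apply: le_trans (ler_norm _) (le_trans (ltW (archi_boundP (normr_ge0 _))) _).
    by rewrite ler_nat ltnW.
  by rewrite ler_pdivrMr // in h; lra.
- move=> k nk; have [h _] := hn1 k (leq_trans n1n nk).
  have a16 : 0 < (a / 16) ^+ 2 by rewrite exprn_gt0 // divr_gt0.
  rewrite mulrAC ler_pdivrMr // in h.
  rewrite exprMn -exprM [(k * 2)%N]mulnC.
  have h2 : (B ^+ (2 * k) * (a / 16) ^+ 2) * Jl l0 k.+1 <=
      (B ^+ (2 * k) * (a / 16) ^+ 2) * (2 * Jl l k.+1).
    by rewrite ler_pM2l ?half // mulr_gt0.
  by lra.
have [_ hb] := hbase M M0M.
set Q' : pred {set {set 'M['I_L]_(M, d)}} := fun c => _ in hb *.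
have Qsupp : supported (inner (Lam (mlev M) n)) Q'.
  by move=> c c' cc'; apply: eq_existsb => x; rewrite (clu_supported x cc').
have [h _] := close M Q' nM Qsupp.
by lra.
Qed.

End PhaseTransition.

Theorem theorem1p1 (R : realType) (d L : nat) (hd : (0 < d)%N) (hL : (2 <= L)%N)
    (JJ : R -> pt d -> pt d -> R)
    (dT : measure_display) (Omega : measurableType dT)
    (P : probability Omega R) (U : pt d -> pt d -> Omega -> R) :
  proper_family R d L JJ ->
  iid_uniform_edges R d L P U ->
  [/\ (fam_gg R d L JJ -> (lambda_c R d L P U JJ < +oo)%E ->
         theta R d L P U (JJ (fine (lambda_c R d L P U JJ))) = 0%E),
      (fam_ll R d L JJ -> lambda_c R d L P U JJ = +oo%E) &
      (fam_approx R d L JJ -> (lambda_c R d L P U JJ < +oo)%E ->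
         (0 < theta R d L P U (JJ (fine (lambda_c R d L P U JJ))))%E)].
Proof.
case: L hL => [//|L'] hL proper hU; split.
- move=> hgg /(lambda_c_fin hL hd proper hU)[l0 l0_gt0 lcE].
  by rewrite lcE; exact: (fam_gg_continuous hL hd proper hU l0_gt0 lcE hgg).
- exact: (fam_ll_infinite hL hd proper hU).
move=> happ /(lambda_c_fin hL hd proper hU)[l0 l0_gt0 lcE].
by rewrite lcE; exact: (fam_approx_jump hL hd proper hU l0_gt0 lcE happ).
Qed.
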